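(* Let $M=\{\mu_k\}_{k\ge1}\subset\mathbb{C}$ be a countable set of nodes that is discrete in $\mathbb{C}$, with multiplicities $m_k\in\mathbb{N}$, and let $\Lambda\subset\mathbb{C}$ be an unbounded set. Assume that for every $s_\tau\in P(M)$ at least one of conditions (A), (B) below holds. Let $\{\lambda_n\}\subset\Lambda$ be an arbitrary sequence with $|\lambda_{n+1}|>2|\lambda_n|$ for all $n$ and $P(\{\lambda_n\})=P_M(\Lambda)$, and let $G_1(z)=\prod_{n=1}^\infty\left(1-\frac{z}{\lambda_n}\right)$. Then: 1) the subspace $\operatorname{Ker}M_{G_1}+(\psi_M)$ is closed in $H(\mathbb{C})$; if $d_M>0$ it has codimension exactly $d_M$ in $H(\mathbb{C})$, and there exist $\xi_1,\dots,\xi_{d_M}\in\mathbb{C}$ such that $$H(\mathbb{C})=\operatorname{Ker}M_{G_1}+(\psi_M)+\operatorname{span}\{e^{\xi_l z}\}_{l=1}^{d_M};$$ 2) if $d_M=0$, then $H(\mathbb{C})=\operatorname{Ker}M_{G_1}+(\psi_M)$; 3) the subspace $\operatorname{Ker}M_{G_1}\cap(\psi_M)$ is infinite-dimensional.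
   Context: $H(\mathbb{C})$ is the space of entire functions with the topology of uniform convergence on compact sets. $\mathbb{S}=\{s\in\mathbb{C}:|s|=1\}$. For an unbounded set $X\subset\mathbb{C}$, the set $P(X)\subset\mathbb{S}$ of limit directions at infinity consists of all $s\in\mathbb{S}$ such that $s=\lim_{k\to\infty}x_k/|x_k|$ for some sequence $\{x_k\}\subset X$ with $x_k\to\infty$. Elements of $P(M)$ are written $s_\tau=e^{i\tau}$ and elements of $P(\Lambda)$ are written $s_\omega=e^{i\omega}$. For $s\in\mathbb{S}$ and $c\in\mathbb{R}$ let $l(s,c)=\{z\in\mathbb{C}:\operatorname{Re}(sz)=c\}$. Condition (A) for $s_\tau\in P(M)$: there exists $s_\omega\in P(\Lambda)$ with $\operatorname{Re}(s_\omega s_\tau)>0$ and a number $\varkappa=\varkappa(s_\omega)\in\mathbb{R}$ such that for every $c>\varkappa$ the line $l(s_\omega,c)$ contains at most one node $\mu_k\in M$. Condition (B) for $s_\tau\in P(M)$: there exists $s_\omega\in P(\Lambda)$ with $\operatorname{Re}(s_\omega s_\tau)=0$ and a number $\varkappa=\varkappa(s_\omega)\in\mathbb{R}$ such that for every $c>\varkappa$ the line $l(s_\omega,c)$ contains at most one node $\mu_k\in M$, and moreover for every subsequence $\{\mu_{k_l}\}\subset M$ with $|\mu_{k_l}|\to\infty$ and $\mu_{k_l}/|\mu_{k_l}|\to s_\tau$ one has $\operatorname{Re}(s_\omega\mu_{k_l})\to+\infty$. $P_M(\Lambda)\subset P(\Lambda)$ denotes the set of all directions $s_\omega\in P(\Lambda)$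 that occur, coupled with some $s_\tau\in P(M)$, in (A) or (B) (with the corresponding numbers $\varkappa(s_\omega)$). Set $D_M=\bigcap_{s_\omega\in P_M(\Lambda)}\{\mu_k\in M:\operatorname{Re}(s_\omega\mu_k)\le\varkappa(s_\omega)\}$; under the hypotheses this set is finite or empty. $d_M\in\mathbb{Z}_+$ is the dimension of the space of all quasi-polynomials $P(z)=\sum_{\mu_k\in D_M}\sum_{j=0}^{m_k-1}c_{k,j}z^je^{\mu_k z}$ ($c_{k,j}\in\mathbb{C}$) that satisfy $P(\lambda_n)=0$ for all $n$ (so $d_M=0$ if $D_M=\emptyset$). $\psi_M\in H(\mathbb{C})$ is an entire function whose zero set is exactly $M$, with the zero at $\mu_k$ of multiplicity exactly $m_k$; $(\psi_M)=\{r\psi_M: r\in H(\mathbb{C})\}$ is the ideal it generates. $M_{G_1}$ is the convolution operator on $H(\mathbb{C})$ generated by the entire function $G_1$ (of minimal type with respect to order 1): if $G_1(z)=\sum_{j\ge0}a_jz^j$ then $M_{G_1}f=\sum_{j\ge0}a_jf^{(j)}$, so that $M_{G_1}e^{\lambda z}=G_1(\lambda)e^{\lambda z}$. Its kernel coincides with the set of sums $\sum_{n}c_ne^{\lambda_nz}$ of series absolutely convergent for all $z\in\mathbb{C}$. *)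

(* Defs.v *)
From Stdlib Require Import Reals List.
Open Scope R_scope.

Definition Cplx : Type := (R * R)%type.
Definition Czero : Cplx := (0, 0).
Definition Cone : Cplx := (1, 0).
Definition Cre (z : Cplx) : R := fst z.
Definition Cim (z : Cplx) : R := snd z.
Definition RtoC (x : R) : Cplx := (x, 0).
Definition Cadd (z w : Cplx) : Cplx := (fst z + fst w, snd z + snd w).
Definition Copp (z : Cplx) : Cplx := (- fst z, - snd z).
Definition Csub (z w : Cplx) : Cplx := Cadd z (Copp w).
Definition Cmul (z w : Cplx) : Cplx :=
  (fst z * fst w - snd z * snd w, fst z * snd w + snd z * fst w).
Definition Cinv (z : Cplx) : Cplx :=
  (fst z / (fst z * fst z + snd z * snd z),
   - snd z / (fst z * fst z + snd z * snd z)).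
Definition Cdiv (z w : Cplx) : Cplx := Cmul z (Cinv w).
Definition Cnorm (z : Cplx) : R := sqrt (fst z * fst z + snd z * snd z).
Fixpoint Cpow (z : Cplx) (n : nat) : Cplx :=
  match n with O => Cone | S n => Cmul z (Cpow z n) end.
Definition Cexp (z : Cplx) : Cplx := (exp (fst z) * cos (snd z), exp (fst z) * sin (snd z)).

Fixpoint Csum (n : nat) (u : nat -> Cplx) : Cplx :=
  match n with O => Czero | S n => Cadd (Csum n u) (u n) end.
Fixpoint Cprod (n : nat) (u : nat -> Cplx) : Cplx :=
  match n with O => Cone | S n => Cmul (Cprod n u) (u n) end.

Definition Ccv (u : nat -> Cplx) (l : Cplx) : Prop :=
  forall eps, 0 < eps -> exists N, forall n, (N <= n)%nat -> Cnorm (Csub (u n) l) < eps.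
Definition Cseries (u : nat -> Cplx) (l : Cplx) : Prop := Ccv (fun n => Csum n u) l.
Definition Cto_infty (x : nat -> Cplx) : Prop :=
  forall A, exists N, forall k, (N <= k)%nat -> A < Cnorm (x k).
Definition Rto_pinfty (x : nat -> R) : Prop :=
  forall A, exists N, forall k, (N <= k)%nat -> A < x k.

Definition Cderiv (f : Cplx -> Cplx) (z l : Cplx) : Prop :=
  forall eps, 0 < eps -> exists delta, 0 < delta /\
    forall h, 0 < Cnorm h < delta ->
      Cnorm (Csub (Cdiv (Csub (f (Cadd z h)) (f z)) h) l) < eps.
Definition entire (f : Cplx -> Cplx) : Prop := forall z, exists l, Cderiv f z l.
Definition deriv_chain (f : Cplx -> Cplx) (D : nat -> Cplx -> Cplx) : Prop :=
  (forall z, D O z = f z) /\ forall j z, Cderiv (D j) z (D (S j) z).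

Definition dir (x : Cplx) : Cplx := Cmul (RtoC (/ Cnorm x)) x.
Definition limit_dir (X : Cplx -> Prop) (s : Cplx) : Prop :=
  Cnorm s = 1 /\
  exists x : nat -> Cplx, (forall k, X (x k)) /\ Cto_infty x /\ Ccv (fun k => dir (x k)) s.

Definition node_set (mu : nat -> Cplx) : Cplx -> Prop := fun z => exists k, mu k = z.
(* discrete in Cplx: only finitely many nodes in every disc *)
Definition discrete_seq (mu : nat -> Cplx) : Prop := Cto_infty mu.
Definition at_most_one_node (mu : nat -> Cplx) (s : Cplx) (c : R) : Prop :=
  forall k k', Cre (Cmul s (mu k)) = c -> Cre (Cmul s (mu k')) = c -> k = k'.

Definition condA (mu : nat -> Cplx) (Lam : Cplx -> Prop) (st sw : Cplx) (kap : R) : Prop :=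
  limit_dir Lam sw /\ 0 < Cre (Cmul sw st) /\
  forall c, kap < c -> at_most_one_node mu sw c.
Definition condB (mu : nat -> Cplx) (Lam : Cplx -> Prop) (st sw : Cplx) (kap : R) : Prop :=
  limit_dir Lam sw /\ Cre (Cmul sw st) = 0 /\
  (forall c, kap < c -> at_most_one_node mu sw c) /\
  forall kl : nat -> nat,
    Cto_infty (fun l => mu (kl l)) -> Ccv (fun l => dir (mu (kl l))) st ->
    Rto_pinfty (fun l => Cre (Cmul sw (mu (kl l)))).

Definition admissible (mu : nat -> Cplx) (Lam : Cplx -> Prop) (sw : Cplx) (kap : R) : Prop :=
  exists st, limit_dir (node_set mu) st /\
    (condA mu Lam st sw kap \/ condB mu Lam st sw kap).
Definition PM (mu : nat -> Cplx) (Lam : Cplx -> Prop) (sw : Cplx) : Prop :=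
  exists kap, admissible mu Lam sw kap.
Definition in_DM (mu : nat -> Cplx) (Lam : Cplx -> Prop) (kappa : Cplx -> R) (k : nat) : Prop :=
  forall sw, PM mu Lam sw -> Cre (Cmul sw (mu k)) <= kappa sw.

Definition quasi_poly_DM (mu : nat -> Cplx) (m : nat -> nat) (Lam : Cplx -> Prop)
  (kappa : Cplx -> R) (P : Cplx -> Cplx) : Prop :=
  exists (L : list nat) (c : nat -> nat -> Cplx),
    (forall k, In k L -> in_DM mu Lam kappa k) /\ NoDup L /\
    forall z, P z = fold_right
      (fun k acc => Cadd (Csum (m k) (fun j => Cmul (c k j) (Cmul (Cpow z j) (Cexp (Cmul (mu k) z))))) acc)
      Czero L.

Definition lin_comb (d : nat) (c : nat -> Cplx) (b : nat -> Cplx -> Cplx) : Cplx -> Cplx :=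
  fun z => Csum d (fun i => Cmul (c i) (b i z)).
Definition lin_indep (d : nat) (b : nat -> Cplx -> Cplx) : Prop :=
  forall c, (forall z, lin_comb d c b z = Czero) -> forall i, (i < d)%nat -> c i = Czero.
Definition has_dim (V : (Cplx -> Cplx) -> Prop) (d : nat) : Prop :=
  exists b, (forall i, (i < d)%nat -> V (b i)) /\ lin_indep d b /\
    forall v, V v -> exists c, forall z, v z = lin_comb d c b z.
Definition infinite_dim (V : (Cplx -> Cplx) -> Prop) : Prop :=
  forall n, exists b, (forall i, (i < n)%nat -> V (b i)) /\ lin_indep n b.
Definition has_codim (S : (Cplx -> Cplx) -> Prop) (d : nat) : Prop :=
  exists b, (forall i, (i < d)%nat -> entire (b i)) /\
    (forall f, entire f -> exists g c, S g /\ forall z, f z = Cadd (g z) (lin_comb d c b z)) /\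
    (forall c, S (lin_comb d c b) -> forall i, (i < d)%nat -> c i = Czero).

(* topology of H(Cplx): uniform convergence on compact sets (H(Cplx) is metrizable,
   so closedness = sequential closedness) *)
Definition loc_unif_cv (fs : nat -> Cplx -> Cplx) (f : Cplx -> Cplx) : Prop :=
  forall Rad eps, 0 < eps -> exists N, forall n z, (N <= n)%nat -> Cnorm z <= Rad ->
    Cnorm (Csub (fs n z) (f z)) < eps.
Definition closed_in_H (S : (Cplx -> Cplx) -> Prop) : Prop :=
  forall fs f, (forall n, S (fs n)) -> entire f -> loc_unif_cv fs f -> S f.

(* f in Ker M_G where a j are the Taylor coefficients of G:  sum_j a_j f^(j) = 0 *)
Definition in_Ker (a : nat -> Cplx) (f : Cplx -> Cplx) : Prop :=
  entire f /\ exists D, deriv_chain f D /\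
    forall z, Cseries (fun j => Cmul (a j) (D j z)) Czero.
Definition in_ideal (psi : Cplx -> Cplx) (f : Cplx -> Cplx) : Prop :=
  exists r, entire r /\ forall z, f z = Cmul (r z) (psi z).
Definition Ker_plus_ideal (a : nat -> Cplx) (psi : Cplx -> Cplx) (f : Cplx -> Cplx) : Prop :=
  exists g h, in_Ker a g /\ in_ideal psi h /\ forall z, f z = Cadd (g z) (h z).

(* Main.v *)
(* An entire function f is represented by its derivatives v at the origin, and v is paired with
   the derivatives u of a function of exponential type by sum_i u_i v_i / i!.  Under this
   pairing the ideal generated by psi consists of the functions whose jets vanish on M, and it
   is annihilated by the quasi-polynomials with exponents in M; exp(lambda_n z) pairs with such
   a quasi-polynomial P to P(lambda_n).

   A quasi-polynomial P with |P(lambda_n)| <= C exp(R |lambda_n|) for all n only involves nodes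
   mu with Re(s mu) <= max(kappa(s), R) for all s in P_M(Lambda): along lambda_n / |lambda_n| -> s
   the exponent maximizing Re(s mu) is unique and dominates.  Conditions (A) and (B) leave only
   finitely many such nodes for each R, and none outside D_M if P vanishes on the lambda_n.  By
   the Mittag-Leffler argument of Eidelheit's theorem, jets on M are therefore those of an
   exponential series over the lambda_n if and only if they are annihilated by every P that
   vanishes on the lambda_n.

   Conversely such P annihilate the kernel: removing the first N factors of G_1 turns f in the
   kernel into a combination of N exponentials, and these converge to f because the remaining
   product tends to 1.  Hence the sum of the kernel and the ideal is the annihilator of a space
   of dimension d_M.  For the last claim one raises the multiplicity of a node outside the
   finite exceptional set and prescribes the additional derivatives. *)
Require Import Defs.
From Coquelicot Require Import Hierarchy Continuity RInt RInt_analysis Derive.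
From Stdlib Require Import Reals Factorial List FinFun Lra Lia.
From Stdlib Require Import Classical ClassicalEpsilon FunctionalExtensionality.
Open Scope R_scope.

(* Notation and arithmetic of complex numbers and finite sums *)
Declare Scope cplx_scope.
Delimit Scope cplx_scope with C.
Bind Scope cplx_scope with Cplx.
Infix "+" := Cadd : cplx_scope.
Infix "-" := Csub : cplx_scope.
Infix "*" := Cmul : cplx_scope.
Infix "/" := Cdiv : cplx_scope.
Notation "- z" := (Copp z) : cplx_scope.
Arguments Cnorm z%_C.
Arguments Cexp z%_C.
Arguments Cpow z%_C n%_nat.

(** Derivative sequences at the origin replace the dual of H(C) by sequences of geometric growth,
    and continuity becomes the single condition A * e <= 1/2 between the growth rates of two paired
    sequences. The existence statements rest on an alternative for finitely many equations on formal
    exponential sums with a seminorm: domination by the norm with weights exp(R |lambda_n|) is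
    tested on one-term sums, which is where the bound |P(lambda_n)| <= C exp(R |lambda_n|) comes
    from.

    A sum of two closed subspaces need not be closed; here its description as an annihilator settles
    closedness, codimension and complement at once. The exponents xi_l are points at which suitable
    combinations of a basis of the vanishing quasi-polynomials take the values of the identity
    matrix, since exp(xi_l z) pairs with P to P(xi_l).

    Power series of entire functions are obtained in the coordinate w = log z, where circles become
    vertical segments and Goursat's theorem for rectangles suffices. *)

Lemma Rabs_le_bounds (x a : R) : Rabs x <= a -> - a <= x <= a.
Proof. unfold Rabs. destruct (Rcase_abs x); lra. Qed.

Lemma Cplx_eq (z w : Cplx) : fst z = fst w -> snd z = snd w -> z = w.
Proof. destruct z, w; simpl; intros; subst; reflexivity. Qed.

Ltac cplx_eq := apply Cplx_eq; simpl; unfold Cre, Cim; simpl.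

Lemma Cplx_sqr_pos (z : Cplx) : z <> Czero -> 0 < fst z * fst z + snd z * snd z.
Proof.
  intros Hz. destruct z as [x y]; simpl.
  destruct (Req_dec x 0) as [Hx|Hx]; [destruct (Req_dec y 0) as [Hy|Hy]|].
  - subst. exfalso; apply Hz; reflexivity.
  - nra.
  - nra.
Qed.

Lemma Cplx_field_theory :
  field_theory Czero Cone Cadd Cmul Csub Copp Cdiv Cinv (@eq Cplx).
Proof.
  split; [split| | |].
  all: try (intros; cplx_eq; ring).
  - intros H. apply (f_equal fst) in H. simpl in H. lra.
  - intros p Hp. assert (H := Cplx_sqr_pos p Hp). cplx_eq; field; lra.
Qed.
Add Field Cplx_field : Cplx_field_theory.

Lemma Cone_neq0 : Cone <> Czero.
Proof. intros H. apply (f_equal fst) in H. simpl in H. lra. Qed.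

Lemma Cmul_integral (z w : Cplx) : (z * w)%C = Czero -> z = Czero \/ w = Czero.
Proof.
  intros H. destruct (classic (z = Czero)) as [|Hz]; [now left|right].
  replace w with (Cinv z * (z * w))%C by (field; auto). rewrite H. ring.
Qed.

Lemma Cmul_neq0 (z w : Cplx) : z <> Czero -> w <> Czero -> (z * w)%C <> Czero.
Proof. intros Hz Hw H. destruct (Cmul_integral _ _ H); auto. Qed.

Lemma Csub_eq0 (z w : Cplx) : (z - w)%C = Czero -> z = w.
Proof. intros H. replace z with (z - w + w)%C by ring. rewrite H. ring. Qed.

Lemma Cnorm_sqr (z : Cplx) : Cnorm z * Cnorm z = fst z * fst z + snd z * snd z.
Proof. apply sqrt_sqrt. nra. Qed.

Lemma Cnorm_ge0 (z : Cplx) : 0 <= Cnorm z.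
Proof. apply sqrt_pos. Qed.

Lemma Cnorm_le_sqr (z : Cplx) (r : R) :
  0 <= r -> fst z * fst z + snd z * snd z <= r * r -> Cnorm z <= r.
Proof. intros Hr H. rewrite <- (sqrt_square r Hr). now apply sqrt_le_1_alt. Qed.

Lemma Cnorm_eq_sqr (z : Cplx) (r : R) :
  0 <= r -> fst z * fst z + snd z * snd z = r * r -> Cnorm z = r.
Proof. intros Hr H. rewrite <- (sqrt_square r Hr). unfold Cnorm. now rewrite H. Qed.

Lemma Cnorm_zero : Cnorm Czero = 0.
Proof. apply Cnorm_eq_sqr; simpl; lra. Qed.

Lemma Cnorm_one : Cnorm Cone = 1.
Proof. apply Cnorm_eq_sqr; simpl; lra. Qed.

Lemma Cnorm_eq0 (z : Cplx) : Cnorm z = 0 -> z = Czero.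
Proof.
  intros H. assert (H2 := Cnorm_sqr z). rewrite H in H2. cplx_eq; nra.
Qed.

Lemma Cnorm_pos (z : Cplx) : z <> Czero -> 0 < Cnorm z.
Proof.
  intros H. destruct (Cnorm_ge0 z) as [|E]; [assumption|].
  exfalso; apply H, Cnorm_eq0; auto.
Qed.

Lemma Cnorm_gt0_neq (z : Cplx) : 0 < Cnorm z -> z <> Czero.
Proof. intros H E. rewrite E, Cnorm_zero in H. lra. Qed.

Lemma Cnorm_mul (z w : Cplx) : Cnorm (z * w) = Cnorm z * Cnorm w.
Proof.
  apply Cnorm_eq_sqr. { apply Rmult_le_pos; apply Cnorm_ge0. }
  replace (Cnorm z * Cnorm w * (Cnorm z * Cnorm w))
    with ((Cnorm z * Cnorm z) * (Cnorm w * Cnorm w)) by ring.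
  rewrite !Cnorm_sqr. simpl. ring.
Qed.

Lemma Cnorm_opp (z : Cplx) : Cnorm (- z) = Cnorm z.
Proof. unfold Cnorm. f_equal. simpl. ring. Qed.

Lemma Cnorm_sub_sym (z w : Cplx) : Cnorm (z - w) = Cnorm (w - z).
Proof. rewrite <- Cnorm_opp. f_equal. ring. Qed.

Lemma Cnorm_add (z w : Cplx) : Cnorm (z + w) <= Cnorm z + Cnorm w.
Proof.
  assert (Hz := Cnorm_ge0 z). assert (Hw := Cnorm_ge0 w).
  apply Cnorm_le_sqr; [lra|].
  assert (Ez := Cnorm_sqr z). assert (Ew := Cnorm_sqr w).
  replace ((Cnorm z + Cnorm w) * (Cnorm z + Cnorm w))
    with (Cnorm z * Cnorm z + Cnorm w * Cnorm w + 2 * (Cnorm z * Cnorm w)) by ring.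
  rewrite Ez, Ew. simpl.
  assert (H : fst z * fst w + snd z * snd w <= Cnorm z * Cnorm w); [|nra].
  rewrite <- Cnorm_mul.
  apply Rsqr_incr_0_var; [|apply Cnorm_ge0].
  unfold Rsqr. rewrite Cnorm_sqr. simpl.
  (* Lagrange's identity: this square is the defect in the Cauchy-Schwarz inequality. *)
  assert (H := Rle_0_sqr (fst z * snd w - snd z * fst w)). unfold Rsqr in H. nra.
Qed.

Lemma Cnorm_sub (z w : Cplx) : Cnorm (z - w) <= Cnorm z + Cnorm w.
Proof. unfold Csub. rewrite <- (Cnorm_opp w). apply Cnorm_add. Qed.

Lemma Cnorm_sub_ge (z w : Cplx) : Cnorm z - Cnorm w <= Cnorm (z - w).
Proof.
  assert (H := Cnorm_add (z - w) w). replace (z - w + w)%C with z in H by ring. lra.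
Qed.

Lemma Cnorm_sub_trans (x y z : Cplx) : Cnorm (x - z) <= Cnorm (x - y) + Cnorm (y - z).
Proof. replace (x - z)%C with ((x - y) + (y - z))%C by ring. apply Cnorm_add. Qed.

Lemma Cinv_neq0 (z : Cplx) : z <> Czero -> Cinv z <> Czero.
Proof.
  intros Hz E. apply Cone_neq0. replace Cone with (z * Cinv z)%C by (field; auto).
  rewrite E. ring.
Qed.

Lemma Cnorm_inv (z : Cplx) : z <> Czero -> Cnorm (Cinv z) = / Cnorm z.
Proof.
  intros Hz. assert (Hp := Cnorm_pos z Hz).
  apply Rmult_eq_reg_l with (Cnorm z); [|lra].
  rewrite <- Cnorm_mul, Rinv_r by lra. rewrite <- Cnorm_one. f_equal. field; auto.
Qed.

Lemma Cnorm_div (z w : Cplx) : w <> Czero -> Cnorm (z / w) = Cnorm z / Cnorm w.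
Proof. intros Hw. unfold Cdiv. now rewrite Cnorm_mul, Cnorm_inv. Qed.

Lemma Cnorm_RtoC (r : R) : Cnorm (RtoC r) = Rabs r.
Proof.
  apply Cnorm_eq_sqr; [apply Rabs_pos|]. simpl.
  rewrite <- Rabs_mult, Rabs_pos_eq; nra.
Qed.

Lemma Cre_le_norm (z : Cplx) : Rabs (fst z) <= Cnorm z.
Proof.
  rewrite <- (Rabs_pos_eq (Cnorm z)) by apply Cnorm_ge0.
  apply Rsqr_le_abs_0. unfold Rsqr. rewrite Cnorm_sqr. nra.
Qed.

Lemma Cim_le_norm (z : Cplx) : Rabs (snd z) <= Cnorm z.
Proof.
  rewrite <- (Rabs_pos_eq (Cnorm z)) by apply Cnorm_ge0.
  apply Rsqr_le_abs_0. unfold Rsqr. rewrite Cnorm_sqr. nra.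
Qed.

Lemma Cnorm_le_abs (z : Cplx) : Cnorm z <= Rabs (fst z) + Rabs (snd z).
Proof.
  assert (H1 := Rabs_pos (fst z)). assert (H2 := Rabs_pos (snd z)).
  apply Cnorm_le_sqr; [lra|].
  assert (E1 : fst z * fst z = Rabs (fst z) * Rabs (fst z))
    by (rewrite <- Rabs_mult, Rabs_pos_eq; nra).
  assert (E2 : snd z * snd z = Rabs (snd z) * Rabs (snd z))
    by (rewrite <- Rabs_mult, Rabs_pos_eq; nra).
  rewrite E1, E2. nra.
Qed.

Lemma Cpow_add (z : Cplx) (n m : nat) : Cpow z (n + m) = (Cpow z n * Cpow z m)%C.
Proof. induction n; simpl; [ring|rewrite IHn; ring]. Qed.

Lemma Cpow_mul (z w : Cplx) (n : nat) : Cpow (z * w)%C n = (Cpow z n * Cpow w n)%C.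
Proof. induction n; simpl; [ring|rewrite IHn; ring]. Qed.

Lemma Cpow_neq0 (z : Cplx) (n : nat) : z <> Czero -> Cpow z n <> Czero.
Proof.
  intros Hz; induction n; simpl; [apply Cone_neq0|]. now apply Cmul_neq0.
Qed.

Lemma Cnorm_pow (z : Cplx) (n : nat) : Cnorm (Cpow z n) = Cnorm z ^ n.
Proof. induction n; simpl; [apply Cnorm_one|now rewrite Cnorm_mul, IHn]. Qed.

Lemma Cexp_add (z w : Cplx) : Cexp (z + w)%C = (Cexp z * Cexp w)%C.
Proof.
  unfold Cexp. cplx_eq; rewrite exp_plus, ?cos_plus, ?sin_plus; ring.
Qed.

Lemma Cnorm_Cexp (z : Cplx) : Cnorm (Cexp z) = exp (fst z).
Proof.
  apply Cnorm_eq_sqr; [left; apply exp_pos|]. unfold Cexp; simpl.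
  assert (H := sin2_cos2 (snd z)). unfold Rsqr in H.
  replace (exp (fst z) * exp (fst z)) with (exp (fst z) * exp (fst z) * 1) by ring.
  rewrite <- H. ring.
Qed.

Lemma Cexp_zero : Cexp Czero = Cone.
Proof. unfold Cexp; cplx_eq; rewrite exp_0, ?cos_0, ?sin_0; ring. Qed.

Lemma RtoC_add (x y : R) : RtoC (x + y) = (RtoC x + RtoC y)%C.
Proof. cplx_eq; ring. Qed.
Lemma RtoC_mul (x y : R) : RtoC (x * y) = (RtoC x * RtoC y)%C.
Proof. cplx_eq; ring. Qed.
Lemma RtoC_neq0 (x : R) : x <> 0 -> RtoC x <> Czero.
Proof. intros H E. apply H. now apply (f_equal fst) in E. Qed.
Lemma RtoC_inv (x : R) : x <> 0 -> RtoC (/ x) = Cinv (RtoC x).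
Proof. intros H. cplx_eq; field; auto. Qed.

Lemma Csum_ext (n : nat) (u v : nat -> Cplx) :
  (forall i, (i < n)%nat -> u i = v i) -> Csum n u = Csum n v.
Proof. intros H; induction n; simpl; [reflexivity|]. rewrite IHn, H; auto. Qed.

Lemma Csum_add (n : nat) (u v : nat -> Cplx) :
  Csum n (fun i => u i + v i)%C = (Csum n u + Csum n v)%C.
Proof. induction n; simpl; [ring|rewrite IHn; ring]. Qed.

Lemma Csum_sub (n : nat) (u v : nat -> Cplx) :
  Csum n (fun i => u i - v i)%C = (Csum n u - Csum n v)%C.
Proof. induction n; simpl; [ring|rewrite IHn; ring]. Qed.

Lemma Csum_scal (n : nat) (c : Cplx) (u : nat -> Cplx) :
  Csum n (fun i => c * u i)%C = (c * Csum n u)%C.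
Proof. induction n; simpl; [ring|rewrite IHn; ring]. Qed.

Lemma Csum_zero (n : nat) (u : nat -> Cplx) :
  (forall i, (i < n)%nat -> u i = Czero) -> Csum n u = Czero.
Proof. intros H; induction n; simpl; [reflexivity|]. rewrite IHn, H by auto. ring. Qed.

Lemma Csum_swap (n m : nat) (u : nat -> nat -> Cplx) :
  Csum n (fun i => Csum m (u i)) = Csum m (fun j => Csum n (fun i => u i j)).
Proof.
  induction n; simpl.
  - rewrite Csum_zero; auto.
  - now rewrite IHn, <- Csum_add.
Qed.

Lemma Csum_single (n k : nat) (u : nat -> Cplx) : (k < n)%nat ->
  (forall i, (i < n)%nat -> i <> k -> u i = Czero) -> Csum n u = u k.
Proof.
  induction n; intros Hk H; [lia|]. simpl.
  destruct (Nat.eq_dec n k) as [E|E].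
  - subst. rewrite Csum_zero; [ring|]. intros i Hi. apply H; lia.
  - rewrite IHn, (H n) by (try lia; intros; apply H; lia). ring.
Qed.

Lemma Csum_split (n m : nat) (u : nat -> Cplx) :
  Csum (n + m) u = (Csum n u + Csum m (fun i => u (n + i)%nat))%C.
Proof.
  induction m; simpl. { rewrite Nat.add_0_r. ring. }
  rewrite Nat.add_succ_r. simpl. rewrite IHm. ring.
Qed.

Lemma geometric_small (q K eps : R) : 0 <= q < 1 -> 0 <= K -> 0 < eps ->
  exists N, forall n, (N <= n)%nat -> K * q ^ n < eps.
Proof.
  intros Hq HK He.
  destruct (pow_lt_1_zero q ltac:(rewrite Rabs_pos_eq; lra) (eps / (K + 1))) as [N HN];
    [apply Rdiv_lt_0_compat; lra|].
  exists N. intros n Hn. specialize (HN n Hn). assert (P : 0 <= q ^ n) by (apply pow_le; lra).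
  rewrite Rabs_pos_eq in HN by assumption. apply (Rmult_lt_compat_r (K + 1)) in HN; [|lra].
  replace (eps / (K + 1) * (K + 1)) with eps in HN by (field; lra). lra.
Qed.

Fixpoint Rsum (n : nat) (b : nat -> R) : R :=
  match n with O => 0 | S n => Rsum n b + b n end.

Lemma Csum_norm_le (n : nat) (u : nat -> Cplx) (b : nat -> R) :
  (forall i, (i < n)%nat -> Cnorm (u i) <= b i) -> Cnorm (Csum n u) <= Rsum n b.
Proof.
  induction n; intros H; simpl.
  - rewrite Cnorm_zero. lra.
  - eapply Rle_trans; [apply Cnorm_add|].
    assert (H1 := IHn (fun i Hi => H i (Nat.lt_lt_succ_r _ _ Hi))).
    assert (H2 := H n (Nat.lt_succ_diag_r n)). lra.
Qed.

Lemma Rsum_scal (n : nat) (c : R) (u : nat -> R) : Rsum n (fun i => c * u i) = c * Rsum n u.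
Proof. induction n; simpl; [ring|rewrite IHn; ring]. Qed.

Lemma Rsum_pow (n : nat) (q : R) : (1 - q) * Rsum n (pow q) = 1 - q ^ n.
Proof. induction n; simpl; [ring|]. rewrite Rmult_plus_distr_l, IHn. ring. Qed.

Lemma Rsum_pow_le (n : nat) (q : R) : 0 <= q < 1 -> Rsum n (pow q) <= / (1 - q).
Proof.
  intros Hq. apply Rmult_le_reg_l with (1 - q); [lra|].
  rewrite Rsum_pow, Rinv_r by lra. assert (0 <= q ^ n) by (apply pow_le; lra). lra.
Qed.

(** * Complex differentiability *)

(** The successor function is made total by a case distinction on the invariant, so it can be chosen
    once and iterated. It drives both the bisection in Goursat's theorem and the stages of the
    interpolation. *)
Lemma dependent_choice {X : Type} (P : nat -> X -> Prop) (Q : nat -> X -> X -> Prop) (x0 : X) :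
  P O x0 -> (forall n x, P n x -> exists y, P (S n) y /\ Q n x y) ->
  exists f : nat -> X, f O = x0 /\ forall n, P n (f n) /\ Q n (f n) (f (S n)).
Proof.
  intros H0 HS.
  assert (next : forall n x, {y | P n x -> P (S n) y /\ Q n x y}).
  { intros n x. apply constructive_indefinite_description.
    destruct (classic (P n x)) as [H|H].
    - destruct (HS n x H) as [y Hy]. exists y; auto.
    - exists x. intros; contradiction. }
  set (f := fix f n := match n with O => x0 | S n => proj1_sig (next n (f n)) end).
  exists f. split; [reflexivity|].
  assert (HP : forall n, P n (f n)).
  { induction n; [assumption|]. simpl. now apply (proj2_sig (next n (f n))). }
  intros n; split; [apply HP|]. now apply (proj2_sig (next n (f n))).
Qed.

Definition Ccont (f : Cplx -> Cplx) (z : Cplx) : Prop :=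
  forall eps, 0 < eps -> exists delta, 0 < delta /\
    forall w, Cnorm (w - z) < delta -> Cnorm (f w - f z) < eps.

Lemma Ccont_const (c z : Cplx) : Ccont (fun _ => c) z.
Proof.
  intros eps He. exists 1. split; [lra|]. intros.
  replace (c - c)%C with Czero by ring. now rewrite Cnorm_zero.
Qed.

Lemma Ccont_id (z : Cplx) : Ccont (fun w => w) z.
Proof. intros eps He. exists eps. auto. Qed.

Lemma Ccont_add (f g : Cplx -> Cplx) (z : Cplx) :
  Ccont f z -> Ccont g z -> Ccont (fun w => f w + g w)%C z.
Proof.
  intros Hf Hg eps He.
  destruct (Hf (eps / 2)) as [d1 [Hd1 H1]]; [lra|].
  destruct (Hg (eps / 2)) as [d2 [Hd2 H2]]; [lra|].
  exists (Rmin d1 d2). split; [now apply Rmin_pos|]. intros w Hw.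
  assert (A1 := H1 w (Rlt_le_trans _ _ _ Hw (Rmin_l _ _))).
  assert (A2 := H2 w (Rlt_le_trans _ _ _ Hw (Rmin_r _ _))).
  replace (f w + g w - (f z + g z))%C with ((f w - f z) + (g w - g z))%C by ring.
  eapply Rle_lt_trans; [apply Cnorm_add|]. lra.
Qed.

Lemma Ccont_mul (f g : Cplx -> Cplx) (z : Cplx) :
  Ccont f z -> Ccont g z -> Ccont (fun w => f w * g w)%C z.
Proof.
  intros Hf Hg eps He.
  assert (Nf := Cnorm_ge0 (f z)). assert (Ng := Cnorm_ge0 (g z)).
  set (e := Rmin 1 (eps / (Cnorm (f z) + Cnorm (g z) + 2))).
  assert (He1 : 0 < eps / (Cnorm (f z) + Cnorm (g z) + 2)) by (apply Rdiv_lt_0_compat; lra).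
  assert (He0 : 0 < e) by (apply Rmin_pos; lra).
  destruct (Hf e He0) as [d1 [Hd1 H1]]. destruct (Hg e He0) as [d2 [Hd2 H2]].
  exists (Rmin d1 d2). split; [now apply Rmin_pos|]. intros w Hw.
  assert (A1 := H1 w (Rlt_le_trans _ _ _ Hw (Rmin_l _ _))).
  assert (A2 := H2 w (Rlt_le_trans _ _ _ Hw (Rmin_r _ _))).
  replace (f w * g w - f z * g z)%C
    with ((f w - f z) * (g w - g z) + ((f w - f z) * g z + f z * (g w - g z)))%C by ring.
  eapply Rle_lt_trans; [apply Cnorm_add|].
  eapply Rle_lt_trans; [apply Rplus_le_compat_l, Cnorm_add|]. rewrite !Cnorm_mul.
  assert (B1 := Cnorm_ge0 (f w - f z)). assert (B2 := Cnorm_ge0 (g w - g z)).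
  assert (C1 : e <= 1) by apply Rmin_l.
  assert (C2 : e * (Cnorm (f z) + Cnorm (g z) + 2) <= eps).
  { apply Rle_trans with (eps / (Cnorm (f z) + Cnorm (g z) + 2) * (Cnorm (f z) + Cnorm (g z) + 2)).
    - apply Rmult_le_compat_r; [lra|apply Rmin_r].
    - right; field; lra. }
  set (x := Cnorm (f w - f z)) in *. set (y := Cnorm (g w - g z)) in *.
  assert (x * y <= e * 1) by (apply Rmult_le_compat; lra).
  assert (x * Cnorm (g z) <= e * Cnorm (g z)) by (apply Rmult_le_compat_r; lra).
  assert (Cnorm (f z) * y <= Cnorm (f z) * e) by (apply Rmult_le_compat_l; lra).
  nra.
Qed.

Lemma Ccont_comp (f g : Cplx -> Cplx) (z : Cplx) :
  Ccont f z -> Ccont g (f z) -> Ccont (fun w => g (f w)) z.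
Proof.
  intros Hf Hg eps He. destruct (Hg eps He) as [d1 [Hd1 H1]].
  destruct (Hf d1 Hd1) as [d2 [Hd2 H2]]. exists d2; auto.
Qed.

(** Division-free form of [Cderiv]; h = 0 is allowed, which removes a case distinction from most
    later uses. *)
Definition cdiff (f : Cplx -> Cplx) (z l : Cplx) : Prop :=
  forall eps, 0 < eps -> exists delta, 0 < delta /\
    forall h, Cnorm h < delta -> Cnorm (f (z + h) - f z - l * h)%C <= eps * Cnorm h.

Lemma Cderiv_cdiff (f : Cplx -> Cplx) (z l : Cplx) : Cderiv f z l <-> cdiff f z l.
Proof.
  split; intros H eps He.
  - destruct (H eps He) as [d [Hd Hh]]. exists d; split; [assumption|]. intros h Hlt.
    destruct (classic (h = Czero)) as [E|E].
    + subst. replace (z + Czero)%C with z by ring.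
      replace (f z - f z - l * Czero)%C with Czero by ring. rewrite Cnorm_zero. lra.
    + assert (Hp := Cnorm_pos h E).
      replace (f (z + h) - f z - l * h)%C with (((f (z + h) - f z) / h - l) * h)%C
        by (field; auto).
      rewrite Cnorm_mul. apply Rmult_le_compat_r; [lra|]. left. apply Hh. lra.
  - destruct (H (eps / 2)) as [d [Hd Hh]]; [lra|]. exists d; split; [assumption|].
    intros h [Hp Hlt]. assert (E := Cnorm_gt0_neq h Hp).
    replace (Csub (Cdiv (Csub (f (Cadd z h)) (f z)) h) l)
      with ((f (z + h) - f z - l * h) / h)%C by (field; auto).
    rewrite Cnorm_div by assumption.
    apply Rmult_lt_reg_r with (Cnorm h); [assumption|].
    unfold Rdiv. rewrite Rmult_assoc, Rinv_l by lra. specialize (Hh h Hlt). nra.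
Qed.

(* Caratheodory's form of differentiability: the difference quotient extends continuously. *)
Lemma cdiff_quotient (f : Cplx -> Cplx) (z l : Cplx) :
  cdiff f z l <-> exists q, (forall h, f (z + h) = f z + q h * h)%C /\ q Czero = l /\ Ccont q Czero.
Proof.
  split.
  - intros H.
    exists (fun h => if excluded_middle_informative (h = Czero) then l
                     else ((f (z + h) - f z) / h)%C).
    split; [|split].
    + intros h. destruct (excluded_middle_informative (h = Czero)) as [E|E].
      * subst. replace (z + Czero)%C with z by ring. ring.
      * field; auto.
    + destruct (excluded_middle_informative (Czero = Czero)); congruence.
    + intros eps He. destruct (H (eps / 2)) as [d [Hd Hh]]; [lra|]. exists d; split; [assumption|].
      intros h Hlt. replace (h - Czero)%C with h in Hlt by ring.
      destruct (excluded_middle_informative (Czero = Czero)) as [_|N]; [|congruence].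
      destruct (excluded_middle_informative (h = Czero)) as [E|E].
      * replace (l - l)%C with Czero by ring. rewrite Cnorm_zero; lra.
      * replace ((f (z + h) - f z) / h - l)%C
          with ((f (z + h) - f z - l * h) / h)%C by (field; auto).
        rewrite Cnorm_div by assumption. assert (Hp := Cnorm_pos h E).
        apply Rmult_lt_reg_r with (Cnorm h); [assumption|].
        unfold Rdiv. rewrite Rmult_assoc, Rinv_l by lra. specialize (Hh h Hlt). nra.
  - intros [q [Hq [Hl Hc]]] eps He. destruct (Hc eps He) as [d [Hd Hh]].
    exists d; split; [assumption|]. intros h Hlt. rewrite Hq.
    replace (f z + q h * h - f z - l * h)%C with ((q h - l) * h)%C by ring.
    rewrite Cnorm_mul. apply Rmult_le_compat_r; [apply Cnorm_ge0|]. subst l. left. apply Hh.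
    now replace (h - Czero)%C with h by ring.
Qed.

Lemma cdiff_Ccont (f : Cplx -> Cplx) (z l : Cplx) : cdiff f z l -> Ccont f z.
Proof.
  intros H eps He. destruct (H 1) as [d [Hd Hh]]; [lra|].
  assert (Hl := Cnorm_ge0 l).
  assert (He1 : 0 < eps / (2 + Cnorm l)) by (apply Rdiv_lt_0_compat; lra).
  exists (Rmin d (eps / (2 + Cnorm l))). split; [now apply Rmin_pos|]. intros w Hw.
  specialize (Hh (w - z)%C (Rlt_le_trans _ _ _ Hw (Rmin_l _ _))).
  replace (z + (w - z))%C with w in Hh by ring.
  replace (f w - f z)%C with ((f w - f z - l * (w - z)) + l * (w - z))%C by ring.
  eapply Rle_lt_trans; [apply Cnorm_add|]. rewrite Cnorm_mul.
  assert (Hw2 := Rlt_le_trans _ _ _ Hw (Rmin_r _ _)).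
  apply (Rmult_lt_compat_r (2 + Cnorm l)) in Hw2; [|lra].
  unfold Rdiv in Hw2. rewrite Rmult_assoc, Rinv_l in Hw2 by lra.
  assert (B := Cnorm_ge0 (w - z)). nra.
Qed.

Lemma cdiff_eq (f : Cplx -> Cplx) (z l m : Cplx) : cdiff f z l -> l = m -> cdiff f z m.
Proof. intros; subst; assumption. Qed.

Lemma cdiff_const (c z : Cplx) : cdiff (fun _ => c) z Czero.
Proof.
  apply cdiff_quotient. exists (fun _ => Czero).
  split; [intros; ring|split; [reflexivity|apply Ccont_const]].
Qed.

Lemma cdiff_id (z : Cplx) : cdiff (fun w => w) z Cone.
Proof.
  apply cdiff_quotient. exists (fun _ => Cone).
  split; [intros; ring|split; [reflexivity|apply Ccont_const]].
Qed.

Lemma cdiff_add (f g : Cplx -> Cplx) (z l m : Cplx) :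
  cdiff f z l -> cdiff g z m -> cdiff (fun w => f w + g w)%C z (l + m)%C.
Proof.
  rewrite !cdiff_quotient. intros [q [Hq [Ql Qc]]] [r [Hr [Rl Rc]]].
  exists (fun h => q h + r h)%C. split; [|split].
  - intros h. rewrite Hq, Hr. ring.
  - now rewrite Ql, Rl.
  - now apply Ccont_add.
Qed.

Lemma Ccont_shift (f : Cplx -> Cplx) (z : Cplx) : Ccont f z -> Ccont (fun h => f (z + h)%C) Czero.
Proof.
  intros H eps He. destruct (H eps He) as [d [Hd Hh]]. exists d; split; [assumption|].
  intros h Hlt. replace (z + Czero)%C with z by ring. apply Hh.
  now replace (z + h - z)%C with (h - Czero)%C by ring.
Qed.

Lemma cdiff_mul (f g : Cplx -> Cplx) (z l m : Cplx) :
  cdiff f z l -> cdiff g z m -> cdiff (fun w => f w * g w)%C z (l * g z + f z * m)%C.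
Proof.
  intros Hf Hg. assert (Cg := Ccont_shift _ _ (cdiff_Ccont _ _ _ Hg)).
  revert Hf Hg. rewrite !cdiff_quotient. intros [q [Hq [Ql Qc]]] [r [Hr [Rl Rc]]].
  exists (fun h => q h * g (z + h) + f z * r h)%C. split; [|split].
  - intros h. rewrite Hq, Hr. ring.
  - rewrite Ql, Rl. now replace (z + Czero)%C with z by ring.
  - apply Ccont_add; apply Ccont_mul; auto using Ccont_const.
Qed.

Lemma cdiff_comp (f g : Cplx -> Cplx) (z l m : Cplx) :
  cdiff f z l -> cdiff g (f z) m -> cdiff (fun w => g (f w)) z (m * l)%C.
Proof.
  rewrite !cdiff_quotient. intros [q [Hq [Ql Qc]]] [r [Hr [Rl Rc]]].
  exists (fun h => r (q h * h) * q h)%C. split; [|split].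
  - intros h. rewrite Hq, Hr. ring.
  - rewrite Ql. replace (l * Czero)%C with Czero by ring. now rewrite Rl.
  - apply Ccont_mul; [|assumption]. apply (Ccont_comp (fun h => q h * h)%C r).
    + apply Ccont_mul; auto using Ccont_id.
    + now replace (q Czero * Czero)%C with Czero by ring.
Qed.

Lemma cdiff_local (f g : Cplx -> Cplx) (z l : Cplx) (d : R) : 0 < d ->
  (forall w, Cnorm (w - z) < d -> f w = g w) -> cdiff f z l -> cdiff g z l.
Proof.
  intros Hd E H eps He. destruct (H eps He) as [d2 [Hd2 H2]].
  exists (Rmin d d2). split; [now apply Rmin_pos|]. intros h Hh.
  rewrite <- !E.
  - apply H2. eapply Rlt_le_trans; [exact Hh|apply Rmin_r].
  - replace (z - z)%C with Czero by ring. now rewrite Cnorm_zero.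
  - replace (z + h - z)%C with h by ring. eapply Rlt_le_trans; [exact Hh|apply Rmin_l].
Qed.

Lemma cdiff_inv (z : Cplx) : z <> Czero -> cdiff Cinv z (- (Cinv z * Cinv z))%C.
Proof.
  intros Hz eps He. assert (Hp := Cnorm_pos z Hz). set (r := Cnorm z) in *.
  assert (H3 : 0 < r * r * r) by (repeat apply Rmult_lt_0_compat; assumption).
  assert (He1 : 0 < eps * (r * r * r) / 2) by nra.
  (* The first bound keeps |z + h| >= r / 2; the second makes the exact remainder h^2 / (z^2 (z +
     h)) at most eps |h|. *)
  exists (Rmin (r / 2) (eps * (r * r * r) / 2)). split; [apply Rmin_pos; lra|]. intros h Hh.
  assert (A1 := Rlt_le_trans _ _ _ Hh (Rmin_l _ _)).
  assert (A2 := Rlt_le_trans _ _ _ Hh (Rmin_r _ _)).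
  assert (B : r / 2 <= Cnorm (z + h)).
  { assert (B := Cnorm_sub_ge z (- h)%C). replace (z - - h)%C with (z + h)%C in B by ring.
    rewrite Cnorm_opp in B. fold r in B. lra. }
  assert (Hzh : (z + h)%C <> Czero) by (apply Cnorm_gt0_neq; lra).
  replace (Cinv (z + h) - Cinv z - - (Cinv z * Cinv z) * h)%C
    with (h * h / (z * z * (z + h)))%C by (field; auto).
  rewrite Cnorm_div by (repeat apply Cmul_neq0; assumption).
  rewrite !Cnorm_mul. fold r. assert (Nh := Cnorm_ge0 h).
  apply Rmult_le_reg_r with (r * r * Cnorm (z + h)); [nra|].
  unfold Rdiv. rewrite Rmult_assoc, Rinv_l, Rmult_1_r by nra.
  assert (D : Cnorm h <= eps * (r * r * Cnorm (z + h))).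
  { apply Rle_trans with (eps * (r * r * (r / 2))); [lra|].
    apply Rmult_le_compat_l; [lra|]. apply Rmult_le_compat_l; nra. }
  replace (eps * Cnorm h * (r * r * Cnorm (z + h)))
    with (Cnorm h * (eps * (r * r * Cnorm (z + h)))) by ring.
  apply Rmult_le_compat_l; assumption.
Qed.

Lemma cdiff_div (f g : Cplx -> Cplx) (z l m : Cplx) :
  cdiff f z l -> cdiff g z m -> g z <> Czero ->
  exists d, cdiff (fun w => f w / g w)%C z d.
Proof.
  intros Hf Hg Hz. eexists. unfold Cdiv.
  apply cdiff_mul; [exact Hf|]. apply cdiff_comp; [exact Hg|]. now apply cdiff_inv.
Qed.

Lemma derivable_at0_bound (f : R -> R) (l : R) (eps : R) :
  derivable_pt_lim f 0 l -> 0 < eps ->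
  exists d, 0 < d /\ forall x, Rabs x < d -> Rabs (f x - f 0 - l * x) <= eps * Rabs x.
Proof.
  intros H He. destruct (H eps He) as [[d Hd] Hh]. exists d; split; [assumption|].
  intros x Hx. destruct (Req_dec x 0) as [E|E].
  - subst. replace (f 0 - f 0 - l * 0) with 0 by ring. rewrite Rabs_R0. lra.
  - specialize (Hh x E Hx). rewrite Rplus_0_l in Hh.
    replace (f x - f 0 - l * x) with (((f x - f 0) / x - l) * x) by (field; auto).
    rewrite Rabs_mult. apply Rmult_le_compat_r; [apply Rabs_pos|lra].
Qed.

Lemma cdiff_Cexp0 : cdiff Cexp Czero Cone.
Proof.
  (* The final estimate collects at most six terms [e * Cnorm h]. The bound e / 4 on the increment,
     imposed below, absorbs the product of the first-order terms of exp and sin. *)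
  intros eps He. set (e := Rmin (eps / 8) 1).
  assert (He0 : 0 < e) by (apply Rmin_pos; lra).
  assert (He1 : e <= eps / 8) by apply Rmin_l. assert (He2 : e <= 1) by apply Rmin_r.
  destruct (derivable_at0_bound exp 1 e) as [d1 [Hd1 H1]]; [|assumption|].
  { assert (X := derivable_pt_lim_exp 0). now rewrite exp_0 in X. }
  destruct (derivable_at0_bound cos 0 e) as [d2 [Hd2 H2]]; [|assumption|].
  { assert (X := derivable_pt_lim_cos 0). now rewrite sin_0, Ropp_0 in X. }
  destruct (derivable_at0_bound sin 1 e) as [d3 [Hd3 H3]]; [|assumption|].
  { assert (X := derivable_pt_lim_sin 0). now rewrite cos_0 in X. }
  set (d := Rmin (Rmin d1 d2) (Rmin d3 (e / 4))).
  assert (Hd : 0 < d) by (repeat apply Rmin_pos; lra).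
  exists d; split; [assumption|]. intros h Hh.
  assert (D1 : d <= d1) by (eapply Rle_trans; apply Rmin_l).
  assert (D2 : d <= d2) by (eapply Rle_trans; [apply Rmin_l|apply Rmin_r]).
  assert (D3 : d <= d3) by (eapply Rle_trans; [apply Rmin_r|apply Rmin_l]).
  assert (D4 : d <= e / 4) by (eapply Rle_trans; apply Rmin_r).
  assert (N1 := Cre_le_norm h). assert (N2 := Cim_le_norm h).
  specialize (H1 (fst h) ltac:(lra)). specialize (H2 (snd h) ltac:(lra)).
  specialize (H3 (snd h) ltac:(lra)).
  rewrite exp_0 in H1. rewrite cos_0 in H2. rewrite sin_0 in H3.
  replace (Czero + h)%C with h by ring. rewrite Cexp_zero.
  eapply Rle_trans; [apply Cnorm_le_abs|]. unfold Cexp; simpl.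
  set (x := fst h) in *. set (y := snd h) in *.
  replace (exp x * cos y + - (1) + - (1 * x - 0 * y))
    with ((exp x - 1 - 1 * x) + (exp x - 1 - 1 * x + 1 + x) * (cos y - 1 - 0 * y)) by ring.
  replace (exp x * sin y + - 0 + - (1 * y + 0 * x))
    with ((exp x - 1 - 1 * x + x) * (sin y - 0 - 1 * y + y) + (sin y - 0 - 1 * y)) by ring.
  set (u := exp x - 1 - 1 * x) in *. set (v := cos y - 1 - 0 * y) in *.
  set (w := sin y - 0 - 1 * y) in *.
  assert (T1 := Rabs_triang u ((u + 1 + x) * v)). assert (T2 := Rabs_triang ((u + x) * (w + y)) w).
  rewrite Rabs_mult in T1, T2.
  assert (T3 := Rabs_triang (u + 1) x). assert (T4 := Rabs_triang u 1). rewrite Rabs_R1 in T4.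
  assert (T5 := Rabs_triang u x). assert (T6 := Rabs_triang w y).
  assert (X := Rabs_pos x). assert (Y := Rabs_pos y).
  assert (U := Rabs_pos u). assert (V := Rabs_pos v). assert (W := Rabs_pos w).
  assert (P1 := Rabs_pos (u + 1 + x)). assert (P2 := Rabs_pos (u + x)). assert (P3 := Rabs_pos (w + y)).
  assert (S1 : Rabs (u + 1 + x) <= 3) by nra.
  assert (S2 : Rabs (u + x) <= 2 * Rabs x) by nra.
  assert (S3 : Rabs (w + y) <= 2 * Rabs y) by nra.
  assert (M1 : Rabs (u + 1 + x) * Rabs v <= 3 * (e * Rabs y)) by (apply Rmult_le_compat; lra).
  assert (M2 : Rabs (u + x) * Rabs (w + y) <= (2 * Rabs x) * (2 * Rabs y)) by (apply Rmult_le_compat; lra).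
  assert (M3 : (2 * Rabs x) * (2 * Rabs y) <= e * Rabs y).
  { replace ((2 * Rabs x) * (2 * Rabs y)) with ((4 * Rabs x) * Rabs y) by ring.
    apply Rmult_le_compat_r; lra. }
  assert (M4 : e * Rabs x <= eps / 8 * Cnorm h) by (apply Rmult_le_compat; lra).
  assert (M5 : e * Rabs y <= eps / 8 * Cnorm h) by (apply Rmult_le_compat; lra).
  lra.
Qed.

Lemma cdiff_Cexp (z : Cplx) : cdiff Cexp z (Cexp z).
Proof.
  apply (cdiff_local (fun w => Cexp z * Cexp (w + - z))%C Cexp z (Cexp z) 1); [lra| |].
  - intros w _. rewrite <- Cexp_add. f_equal. ring.
  - apply (cdiff_eq _ _ (Czero * Cexp (z + - z) + Cexp z * (Cone * (Cone + Czero)))%C); [|ring].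
    apply (cdiff_mul (fun _ => Cexp z) (fun w => Cexp (w + - z)%C)); [apply cdiff_const|].
    apply (cdiff_comp (fun w => w + - z)%C Cexp).
    + apply cdiff_add; [apply cdiff_id|apply cdiff_const].
    + replace (z + - z)%C with Czero by ring. apply cdiff_Cexp0.
Qed.

Lemma cdiff_unique (f : Cplx -> Cplx) (z l m : Cplx) : cdiff f z l -> cdiff f z m -> l = m.
Proof.
  intros H1 H2. apply Csub_eq0. apply Cnorm_eq0.
  destruct (Req_dec (Cnorm (l - m)) 0) as [|N]; [assumption|exfalso].
  assert (P := Cnorm_ge0 (l - m)).
  destruct (H1 (Cnorm (l - m) / 4)) as [d1 [Hd1 A1]]; [lra|].
  destruct (H2 (Cnorm (l - m) / 4)) as [d2 [Hd2 A2]]; [lra|].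
  assert (Hd := Rmin_pos _ _ Hd1 Hd2).
  set (h := RtoC (Rmin d1 d2 / 2)).
  assert (Nh : Cnorm h = Rmin d1 d2 / 2).
  { unfold h. rewrite Cnorm_RtoC, Rabs_pos_eq; lra. }
  assert (M1 := Rmin_l d1 d2). assert (M2 := Rmin_r d1 d2).
  specialize (A1 h ltac:(lra)). specialize (A2 h ltac:(lra)).
  assert (B : Cnorm ((l - m) * h) <= Cnorm (f (z + h) - f z - m * h)%C + Cnorm (f (z + h) - f z - l * h)%C).
  { replace ((l - m) * h)%C with ((f (z + h) - f z - m * h) - (f (z + h) - f z - l * h))%C by ring.
    apply Cnorm_sub. }
  rewrite Cnorm_mul in B. nra.
Qed.

Lemma entire_cdiff (f : Cplx -> Cplx) : entire f <-> forall z, exists l, cdiff f z l.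
Proof.
  split; intros H z; destruct (H z) as [l Hl]; exists l; now apply Cderiv_cdiff.
Qed.

Lemma entire_Ccont (f : Cplx -> Cplx) (z : Cplx) : entire f -> Ccont f z.
Proof. intros H. destruct (H z) as [l Hl]. apply Cderiv_cdiff in Hl. eapply cdiff_Ccont; eauto. Qed.

Lemma entire_const (c : Cplx) : entire (fun _ => c).
Proof. intros z. exists Czero. apply Cderiv_cdiff, cdiff_const. Qed.

Lemma entire_id : entire (fun z => z).
Proof. intros z. exists Cone. apply Cderiv_cdiff, cdiff_id. Qed.

Lemma entire_add (f g : Cplx -> Cplx) : entire f -> entire g -> entire (fun z => f z + g z)%C.
Proof.
  rewrite !entire_cdiff. intros Hf Hg z. destruct (Hf z) as [l Hl]. destruct (Hg z) as [m Hm].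
  exists (l + m)%C. now apply cdiff_add.
Qed.

Lemma entire_mul (f g : Cplx -> Cplx) : entire f -> entire g -> entire (fun z => f z * g z)%C.
Proof.
  rewrite !entire_cdiff. intros Hf Hg z. destruct (Hf z) as [l Hl]. destruct (Hg z) as [m Hm].
  eexists. apply cdiff_mul; eassumption.
Qed.

Lemma entire_comp (f g : Cplx -> Cplx) : entire f -> entire g -> entire (fun z => g (f z)).
Proof.
  rewrite !entire_cdiff. intros Hf Hg z. destruct (Hf z) as [l Hl]. destruct (Hg (f z)) as [m Hm].
  eexists. apply cdiff_comp; eassumption.
Qed.

Lemma entire_ext (f g : Cplx -> Cplx) : (forall z, f z = g z) -> entire f -> entire g.
Proof. intros E H. now replace g with f by (apply functional_extensionality; auto). Qed.

Lemma entire_sub (f g : Cplx -> Cplx) : entire f -> entire g -> entire (fun z => f z - g z)%C.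
Proof.
  intros Hf Hg. apply (entire_ext (fun z => f z + (Copp Cone) * g z)%C).
  - intros; ring.
  - apply entire_add; [assumption|]. apply entire_mul; [apply entire_const|assumption].
Qed.

Lemma entire_Cexp : entire Cexp.
Proof. intros z. exists (Cexp z). apply Cderiv_cdiff, cdiff_Cexp. Qed.

Lemma entire_Cpow (n : nat) : entire (fun z => Cpow z n).
Proof. induction n; simpl; [apply entire_const|]. apply entire_mul; [apply entire_id|assumption]. Qed.

(** * Goursat's theorem *)

(** Integral lemmas leave equalities typed in an algebraic structure over the reals; [ring] needs
    the type [R] itself. *)
Ltac real_ring := match goal with |- ?a = ?b => change (@eq R a b) end; ring.

Definition path_cont (u : R -> Cplx) : Prop :=
  forall t eps, 0 < eps -> exists delta, 0 < delta /\
    forall s, Rabs (s - t) < delta -> Cnorm (u s - u t) < eps.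

Definition CInt (u : R -> Cplx) (a b : R) : Cplx :=
  (RInt (fun t => fst (u t)) a b, RInt (fun t => snd (u t)) a b).

Lemma path_cont_fst (u : R -> Cplx) (t : R) :
  path_cont u -> continuous (fun s => fst (u s)) t.
Proof.
  intros H. apply continuity_pt_filterlim. intros eps He.
  destruct (H t eps He) as [d [Hd Hh]]. exists d; split; [assumption|].
  intros s [_ Hs]. eapply Rle_lt_trans; [|apply Hh, Hs].
  apply (Cre_le_norm (u s - u t)%C).
Qed.

Lemma path_cont_snd (u : R -> Cplx) (t : R) :
  path_cont u -> continuous (fun s => snd (u s)) t.
Proof.
  intros H. apply continuity_pt_filterlim. intros eps He.
  destruct (H t eps He) as [d [Hd Hh]]. exists d; split; [assumption|].
  intros s [_ Hs]. eapply Rle_lt_trans; [|apply Hh, Hs].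
  apply (Cim_le_norm (u s - u t)%C).
Qed.

Lemma path_cont_int_fst (u : R -> Cplx) (a b : R) :
  path_cont u -> ex_RInt (fun s => fst (u s)) a b.
Proof. intros H. apply @ex_RInt_continuous. intros; now apply path_cont_fst. Qed.

Lemma path_cont_int_snd (u : R -> Cplx) (a b : R) :
  path_cont u -> ex_RInt (fun s => snd (u s)) a b.
Proof. intros H. apply @ex_RInt_continuous. intros; now apply path_cont_snd. Qed.

#[local] Hint Resolve path_cont_int_fst path_cont_int_snd : core.

Lemma path_cont_comp (f : Cplx -> Cplx) (p : R -> Cplx) :
  (forall z, Ccont f z) -> path_cont p -> path_cont (fun t => f (p t)).
Proof.
  intros Hf Hp t eps He. destruct (Hf (p t) eps He) as [d [Hd H]].
  destruct (Hp t d Hd) as [e [He2 H2]]. exists e; auto.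
Qed.

Lemma path_cont_hor (c : R) : path_cont (fun x => (x, c)).
Proof.
  intros t eps He. exists eps. split; [assumption|]. intros s Hs.
  eapply Rle_lt_trans; [apply Cnorm_le_abs|]. simpl.
  replace (c + - c) with 0 by ring. rewrite Rabs_R0. unfold Rminus in Hs. lra.
Qed.

Lemma path_cont_ver (c : R) : path_cont (fun y => (c, y)).
Proof.
  intros t eps He. exists eps. split; [assumption|]. intros s Hs.
  eapply Rle_lt_trans; [apply Cnorm_le_abs|]. simpl.
  replace (c + - c) with 0 by ring. rewrite Rabs_R0. unfold Rminus in Hs. lra.
Qed.

Lemma CInt_ext (u v : R -> Cplx) (a b : R) : (forall t, u t = v t) -> CInt u a b = CInt v a b.
Proof. intros H. replace v with u by (apply functional_extensionality; auto). reflexivity. Qed.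

Lemma CInt_add (u v : R -> Cplx) (a b : R) : path_cont u -> path_cont v ->
  CInt (fun t => u t + v t)%C a b = (CInt u a b + CInt v a b)%C.
Proof.
  intros Hu Hv. unfold CInt. cplx_eq.
  - apply (RInt_plus (fun t => fst (u t)) (fun t => fst (v t))); auto.
  - apply (RInt_plus (fun t => snd (u t)) (fun t => snd (v t))); auto.
Qed.

Lemma RInt_lin (f g : R -> R) (c d a b : R) : ex_RInt f a b -> ex_RInt g a b ->
  RInt (fun t => c * f t + d * g t) a b = c * RInt f a b + d * RInt g a b.
Proof.
  intros Hf Hg.
  assert (H1 := RInt_scal f a b c Hf). assert (H2 := RInt_scal g a b d Hg).
  assert (E1 := ex_RInt_scal f a b c Hf). assert (E2 := ex_RInt_scal g a b d Hg).
  assert (H3 := RInt_plus _ _ _ _ E1 E2). unfold plus, scal in *; simpl in *.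
  unfold mult in *; simpl in *. rewrite H3. now rewrite <- H1, <- H2.
Qed.

Lemma CInt_scal (c : Cplx) (u : R -> Cplx) (a b : R) : path_cont u ->
  CInt (fun t => c * u t)%C a b = (c * CInt u a b)%C.
Proof.
  intros Hu. unfold CInt. cplx_eq.
  - rewrite <- (Rplus_0_r (fst c * _ - _)).
    replace (fst c * RInt (fun t => fst (u t)) a b - snd c * RInt (fun t => snd (u t)) a b + 0)
      with (fst c * RInt (fun t => fst (u t)) a b + (- snd c) * RInt (fun t => snd (u t)) a b) by ring.
    rewrite <- RInt_lin by auto. apply RInt_ext. intros; real_ring.
  - rewrite <- RInt_lin by auto. apply RInt_ext. intros; real_ring.
Qed.

Lemma CInt_Chasles (u : R -> Cplx) (a b c : R) : path_cont u ->
  (CInt u a b + CInt u b c)%C = CInt u a c.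
Proof.
  intros Hu. unfold CInt. cplx_eq.
  - apply (RInt_Chasles (fun t => fst (u t))); auto.
  - apply (RInt_Chasles (fun t => snd (u t))); auto.
Qed.

(** The factor 2 comes from bounding the real and imaginary parts separately; it propagates
    harmlessly to Cauchy's estimates. *)
Lemma CInt_bound (u : R -> Cplx) (a b M : R) : path_cont u -> a <= b ->
  (forall t, a <= t <= b -> Cnorm (u t) <= M) -> Cnorm (CInt u a b) <= 2 * ((b - a) * M).
Proof.
  intros Hu Hab HM. eapply Rle_trans; [apply Cnorm_le_abs|]. unfold CInt; simpl.
  assert (H1 : Rabs (RInt (fun t => fst (u t)) a b) <= (b - a) * M).
  { apply abs_RInt_le_const; auto. intros t Ht. eapply Rle_trans; [apply Cre_le_norm|auto]. }
  assert (H2 : Rabs (RInt (fun t => snd (u t)) a b) <= (b - a) * M).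
  { apply abs_RInt_le_const; auto. intros t Ht. eapply Rle_trans; [apply Cim_le_norm|auto]. }
  lra.
Qed.

Lemma CInt_const (c : Cplx) (a b : R) : CInt (fun _ => c) a b = (RtoC (b - a) * c)%C.
Proof.
  unfold CInt. cplx_eq; rewrite RInt_const; unfold scal; simpl; unfold mult; simpl; ring.
Qed.

Lemma RInt_id (a b : R) : RInt (fun t => t) a b = (b * b - a * a) / 2.
Proof.
  apply is_RInt_unique.
  replace ((b * b - a * a) / 2) with (minus (b * b / 2) (a * a / 2))
    by (unfold minus, plus, opp; simpl; field).
  apply (is_RInt_derive (fun t => t * t / 2) (fun t => t)).
  - intros x _. apply is_derive_Reals.
    assert (D := derivable_pt_lim_mult _ (fun _ => / 2) x _ _
      (derivable_pt_lim_mult id id x _ _ (derivable_pt_lim_id x) (derivable_pt_lim_id x))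
      (derivable_pt_lim_const (/ 2) x)).
    unfold mult_fct, id in D. replace ((1 * x + x * 1) * / 2 + x * x * 0) with x in D by field.
    exact D.
  - intros x _. apply continuous_id.
Qed.

Definition Ci : Cplx := (0, 1).

(** Integral of F dz along the boundary of [a, b] x [c, d], counterclockwise; dz = [Ci] dy on the
    vertical sides. *)
Definition rect_int (F : Cplx -> Cplx) (a b c d : R) : Cplx :=
  (CInt (fun x => F (x, c)) a b - CInt (fun x => F (x, d)) a b
   + Ci * (CInt (fun y => F (b, y)) c d - CInt (fun y => F (a, y)) c d))%C.

Lemma hor_cont (F : Cplx -> Cplx) (c : R) : (forall z, Ccont F z) -> path_cont (fun x => F (x, c)).
Proof. intros H. apply (path_cont_comp F); [assumption|apply path_cont_hor]. Qed.
Lemma ver_cont (F : Cplx -> Cplx) (c : R) : (forall z, Ccont F z) -> path_cont (fun y => F (c, y)).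
Proof. intros H. apply (path_cont_comp F); [assumption|apply path_cont_ver]. Qed.
#[local] Hint Resolve hor_cont ver_cont : core.

Lemma rect_int_split_x (F : Cplx -> Cplx) (a m b c d : R) : (forall z, Ccont F z) ->
  rect_int F a b c d = (rect_int F a m c d + rect_int F m b c d)%C.
Proof.
  intros HF. unfold rect_int.
  rewrite <- (CInt_Chasles (fun x => F (x, c)) a m b), <- (CInt_Chasles (fun x => F (x, d)) a m b) by auto.
  ring.
Qed.

Lemma rect_int_split_y (F : Cplx -> Cplx) (a b c m d : R) : (forall z, Ccont F z) ->
  rect_int F a b c d = (rect_int F a b c m + rect_int F a b m d)%C.
Proof.
  intros HF. unfold rect_int.
  rewrite <- (CInt_Chasles (fun y => F (b, y)) c m d), <- (CInt_Chasles (fun y => F (a, y)) c m d) by auto.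
  ring.
Qed.

Lemma rect_int_add (F G : Cplx -> Cplx) (a b c d : R) :
  (forall z, Ccont F z) -> (forall z, Ccont G z) ->
  rect_int (fun z => F z + G z)%C a b c d = (rect_int F a b c d + rect_int G a b c d)%C.
Proof. intros HF HG. unfold rect_int. rewrite !CInt_add by auto. ring. Qed.

Lemma rect_int_scal (k : Cplx) (F : Cplx -> Cplx) (a b c d : R) :
  (forall z, Ccont F z) -> rect_int (fun z => k * F z)%C a b c d = (k * rect_int F a b c d)%C.
Proof. intros HF. unfold rect_int. rewrite !CInt_scal by auto. ring. Qed.

Lemma rect_int_const (k : Cplx) (a b c d : R) : rect_int (fun _ => k) a b c d = Czero.
Proof. unfold rect_int. rewrite !CInt_const. ring. Qed.

Lemma rect_int_id (a b c d : R) : rect_int (fun z => z) a b c d = Czero.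
Proof.
  unfold rect_int, CInt. simpl. rewrite !RInt_id, !RInt_const.
  unfold scal; simpl; unfold mult; simpl. cplx_eq; field.
Qed.

Lemma rect_int_bound (F : Cplx -> Cplx) (a b c d M : R) : (forall z, Ccont F z) ->
  a <= b -> c <= d ->
  (forall x y, a <= x <= b -> c <= y <= d -> Cnorm (F (x, y)) <= M) ->
  Cnorm (rect_int F a b c d) <= 4 * (((b - a) + (d - c)) * M).
Proof.
  intros HF Hab Hcd HM. unfold rect_int.
  assert (H1 := CInt_bound (fun x => F (x, c)) a b M (hor_cont F c HF) Hab ltac:(intros; apply HM; lra)).
  assert (H2 := CInt_bound (fun x => F (x, d)) a b M (hor_cont F d HF) Hab ltac:(intros; apply HM; lra)).
  assert (H3 := CInt_bound (fun y => F (b, y)) c d M (ver_cont F b HF) Hcd ltac:(intros; apply HM; lra)).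
  assert (H4 := CInt_bound (fun y => F (a, y)) c d M (ver_cont F a HF) Hcd ltac:(intros; apply HM; lra)).
  eapply Rle_trans; [apply Cnorm_add|]. rewrite Cnorm_mul.
  assert (Ni : Cnorm Ci = 1) by (apply Cnorm_eq_sqr; simpl; lra). rewrite Ni.
  eapply Rle_trans; [apply Rplus_le_compat; [apply Cnorm_sub|apply Rmult_le_compat_l; [lra|apply Cnorm_sub]]|].
  lra.
Qed.

(** The intervals are nested, so every right end bounds all left ends and the supremum of the left
    ends is the common point. *)
Lemma nested_point (a : nat -> R) (w : R) : 0 < w ->
  (forall n, a n <= a (S n) <= a n + w / 2 ^ S n) ->
  exists l, forall n, a n <= l <= a n + w / 2 ^ n.
Proof.
  intros Hw H.
  assert (P : forall n, 0 < 2 ^ n) by (intros; apply pow_lt; lra).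
  assert (E : forall n, w / 2 ^ S n = w / 2 ^ n / 2).
  { intros n. specialize (P n). simpl. field. lra. }
  assert (U : forall n k, a (n + k)%nat + w / 2 ^ (n + k) <= a n + w / 2 ^ n).
  { intros n k; induction k; [rewrite Nat.add_0_r; lra|].
    rewrite Nat.add_succ_r. specialize (H (n + k)%nat). rewrite E in *. lra. }
  assert (L : forall n k, a n <= a (n + k)%nat).
  { intros n k; induction k; [rewrite Nat.add_0_r; lra|].
    rewrite Nat.add_succ_r. specialize (H (n + k)%nat). lra. }
  assert (Q : forall n, 0 < w / 2 ^ n) by (intros; apply Rdiv_lt_0_compat; auto).
  assert (B : forall n m, a m <= a n + w / 2 ^ n).
  { intros n m. destruct (Nat.le_ge_cases n m) as [Hnm|Hnm].
    - replace m with (n + (m - n))%nat by lia. specialize (U n (m - n)%nat).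
      specialize (Q (n + (m - n))%nat). lra.
    - replace n with (m + (n - m))%nat by lia. specialize (L m (n - m)%nat).
      specialize (Q (m + (n - m))%nat). lra. }
  destruct (completeness (fun x => exists n, x = a n)) as [l [Hub Hlub]].
  - exists (a 0%nat + w / 2 ^ 0). intros x [n ->]. apply B.
  - exists (a 0%nat). now exists 0%nat.
  - exists l. intros n; split.
    + apply Hub. now exists n.
    + apply Hlub. intros x [m ->]. apply B.
Qed.

(** Continuity is assumed everywhere but differentiability only on the rectangle: the functions of
    interest are built from difference quotients, which are known to be differentiable only away
    from one point. *)
Theorem Goursat (F : Cplx -> Cplx) (a b c d : R) : a < b -> c < d ->
  (forall z, Ccont F z) ->
  (forall x y, a <= x <= b -> c <= y <= d -> exists l, cdiff F (x, y) l) ->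
  rect_int F a b c d = Czero.
Proof.
  intros Hab Hcd HF HD. apply Cnorm_eq0.
  destruct (Cnorm_ge0 (rect_int F a b c d)) as [Hpos|E]; [exfalso|auto].
  set (w := b - a). set (h := d - c).
  assert (Hw : 0 < w) by (unfold w; lra). assert (Hh : 0 < h) by (unfold h; lra).
  assert (Hwh : 0 < w * h) by (apply Rmult_lt_0_compat; lra).
  (* Half the ratio of the integral to the area. The strict inequality thus holds for the full
     rectangle and, being relative to the area, is inherited by one of the four quarters. *)
  set (eta := Cnorm (rect_int F a b c d) / (2 * (w * h))).
  assert (Heta : 0 < eta) by (apply Rdiv_lt_0_compat; lra).
  assert (P : forall n, 0 < 2 ^ n) by (intros; apply pow_lt; lra).
  set (Q := fun n (p : Cplx) =>
    rect_int F (fst p) (fst p + w / 2 ^ n) (snd p) (snd p + h / 2 ^ n)).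
  set (bad := fun n (p : Cplx) => eta * (w / 2 ^ n * (h / 2 ^ n)) < Cnorm (Q n p)).
  destruct (dependent_choice bad
    (fun n p q => (fst p <= fst q <= fst p + w / 2 ^ S n) /\
                  (snd p <= snd q <= snd p + h / 2 ^ S n)) (a, c)) as [p [Hp0 Hp]].
  - unfold bad, Q; simpl.
    replace (a + w / 1) with b by (unfold w; field). replace (c + h / 1) with d by (unfold h; field).
    unfold eta. replace (Cnorm (rect_int F a b c d) / (2 * (w * h)) * (w / 1 * (h / 1)))
      with (Cnorm (rect_int F a b c d) / 2) by (field; lra). lra.
  - intros n p Hbad. specialize (P n).
    assert (Ew : w / 2 ^ n = w / 2 ^ S n + w / 2 ^ S n) by (simpl; field; lra).
    assert (Eh : h / 2 ^ n = h / 2 ^ S n + h / 2 ^ S n) by (simpl; field; lra).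
    assert (PS : 0 < 2 ^ S n) by (simpl; lra).
    assert (Qw : 0 < w / 2 ^ S n) by (apply Rdiv_lt_0_compat; lra).
    assert (Qh : 0 < h / 2 ^ S n) by (apply Rdiv_lt_0_compat; lra).
    apply NNPP. intros Hno.
    assert (G : forall q, (fst p <= fst q <= fst p + w / 2 ^ S n) ->
      (snd p <= snd q <= snd p + h / 2 ^ S n) ->
      Cnorm (Q (S n) q) <= eta * (w / 2 ^ S n * (h / 2 ^ S n))).
    { intros q H1 H2. apply Rnot_lt_le. intros H3. apply Hno. exists q. auto. }
    set (w' := w / 2 ^ S n) in *. set (h' := h / 2 ^ S n) in *.
    unfold bad, Q in Hbad. rewrite Ew, Eh in Hbad.
    rewrite (rect_int_split_x F _ (fst p + w')) in Hbad by auto.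
    rewrite (rect_int_split_y F (fst p) _ _ (snd p + h')) in Hbad by auto.
    rewrite (rect_int_split_y F (fst p + w') _ _ (snd p + h')) in Hbad by auto.
    assert (G1 := G p ltac:(lra) ltac:(lra)).
    assert (G2 := G (fst p, snd p + h') ltac:(simpl; lra) ltac:(simpl; lra)).
    assert (G3 := G (fst p + w', snd p) ltac:(simpl; lra) ltac:(simpl; lra)).
    assert (G4 := G (fst p + w', snd p + h') ltac:(simpl; lra) ltac:(simpl; lra)).
    unfold Q in G1, G2, G3, G4. fold w' h' in G1, G2, G3, G4. cbn [fst snd] in G1, G2, G3, G4.
    rewrite <- !Rplus_assoc in Hbad.
    match type of Hbad with _ < Cnorm ((?A + ?B) + (?X + ?D))%C =>
      assert (T1 := Cnorm_add (A + B) (X + D)); assert (T2 := Cnorm_add A B);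
      assert (T3 := Cnorm_add X D) end.
    lra.
  - destruct (nested_point (fun n => fst (p n)) w Hw) as [x Hx]; [intros; apply Hp|].
    destruct (nested_point (fun n => snd (p n)) h Hh) as [y Hy]; [intros; apply Hp|].
    assert (Hx0 := Hx 0%nat). assert (Hy0 := Hy 0%nat). rewrite Hp0 in Hx0, Hy0. simpl in Hx0, Hy0.
    destruct (HD x y) as [l Hl]; [unfold w in *; lra|unfold h in *; lra|].
    (* Chosen so that the linear approximation bounds the integral over the n-th rectangle by half
       of the lower bound expressed by [bad]. *)
    set (e := eta * (w * h) / (8 * ((w + h) * (w + h)))).
    assert (He : 0 < e) by (apply Rdiv_lt_0_compat; nra).
    destruct (Hl e He) as [dl [Hdl Hlin]].
    destruct (pow_lt_1_zero (/ 2) ltac:(rewrite Rabs_pos_eq; lra) (dl / (w + h))) as [n Hn];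
      [apply Rdiv_lt_0_compat; lra|].
    specialize (Hn n (le_n n)). specialize (Hx n). specialize (Hy n).
    destruct (Hp n) as [Hbad _]. specialize (P n).
    rewrite pow_inv, Rabs_pos_eq in Hn by (left; apply Rinv_0_lt_compat; lra).
    set (s := / 2 ^ n) in *. assert (Hs : 0 < s) by (apply Rinv_0_lt_compat; lra).
    unfold bad, Q, Rdiv in Hbad. fold s in Hbad. unfold Rdiv in Hx, Hy. fold s in Hx, Hy.
    apply (Rmult_lt_compat_r (w + h)) in Hn; [|lra].
    unfold Rdiv in Hn. rewrite Rmult_assoc, Rinv_l, Rmult_1_r in Hn by lra.
    (* F minus its affine approximation at (x, y). Affine functions have zero boundary integral, so
       F may be replaced by this error. *)
    set (E := fun z => (F z + ((l * (x, y) - F (x, y)) + Copp l * z))%C).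
    assert (HE : forall z, Ccont E z).
    { intros z. apply Ccont_add; [auto|]. apply Ccont_add; [apply Ccont_const|].
      apply Ccont_mul; [apply Ccont_const|apply Ccont_id]. }
    assert (EQ : forall a b c d, rect_int F a b c d = rect_int E a b c d).
    { intros a' b' c' d'. unfold E. 
      rewrite (rect_int_add F (fun z => (l * (x, y) - F (x, y)) + Copp l * z)%C).
      - rewrite (rect_int_add (fun _ => l * (x, y) - F (x, y))%C (fun z => Copp l * z)%C).
        + rewrite rect_int_const, (rect_int_scal (Copp l) (fun z => z)), rect_int_id; [ring|].
          intros; apply Ccont_id.
        + intros; apply Ccont_const.
        + intros z; apply Ccont_mul; [apply Ccont_const|apply Ccont_id].
      - auto.
      - intros z. apply Ccont_add; [apply Ccont_const|].
        apply Ccont_mul; [apply Ccont_const|apply Ccont_id]. }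
    rewrite EQ in Hbad.
    assert (Hws : 0 < w * s) by nra. assert (Hhs : 0 < h * s) by nra.
    assert (HB := rect_int_bound E (fst (p n)) (fst (p n) + w * s) (snd (p n)) (snd (p n) + h * s)
       (e * (s * (w + h))) HE ltac:(lra) ltac:(lra)).
    assert (HB2 : Cnorm (rect_int E (fst (p n)) (fst (p n) + w * s) (snd (p n)) (snd (p n) + h * s))
       <= 4 * (((w * s) + (h * s)) * (e * (s * (w + h))))).
    { replace (w * s + h * s) with (fst (p n) + w * s - fst (p n) + (snd (p n) + h * s - snd (p n))) by ring.
      apply HB. intros u v Hu Hv.
      assert (N : Cnorm ((u, v) - (x, y))%C <= s * (w + h)).
      { eapply Rle_trans; [apply Cnorm_le_abs|]. simpl.
        assert (Rabs (u + - x) <= w * s) by (apply Rabs_le; lra).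
        assert (Rabs (v + - y) <= h * s) by (apply Rabs_le; lra). lra. }
      specialize (Hlin ((u, v) - (x, y))%C ltac:(lra)).
      replace ((x, y) + ((u, v) - (x, y)))%C with ((u, v) : Cplx) in Hlin by (cplx_eq; ring).
      unfold E. replace (F (u, v) + (l * (x, y) - F (x, y) + - l * (u, v)))%C
        with (F (u, v) - F (x, y) - l * ((u, v) - (x, y)))%C by ring.
      eapply Rle_trans; [exact Hlin|]. apply Rmult_le_compat_l; lra. }
    assert (X : 4 * (((w * s) + (h * s)) * (e * (s * (w + h)))) = eta * (w * s * (h * s)) / 2).
    { unfold e. field. lra. }
    assert (0 < eta * (w * s * (h * s))) by (apply Rmult_lt_0_compat; [|apply Rmult_lt_0_compat]; assumption).
    lra.
Qed.

(** * Power series of entire functions *)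

(** In the coordinate w = log z the circle of radius exp x is a vertical segment of length 2 PI.
    Moving the radius means moving a side of a rectangle, the horizontal sides cancelling by
    periodicity. *)
Definition strip_int (F : Cplx -> Cplx) (x : R) : Cplx := CInt (fun y => F (x, y)) 0 (2 * PI).

Lemma strip_int_const (F : Cplx -> Cplx) (a b : R) : a < b ->
  (forall z, Ccont F z) -> (forall x, F (x, 2 * PI) = F (x, 0)) ->
  (forall x y, a <= x <= b -> exists l, cdiff F (x, y) l) ->
  strip_int F a = strip_int F b.
Proof.
  intros Hab HF Hper HD. assert (Hpi := PI_RGT_0).
  assert (G := Goursat F a b 0 (2 * PI) Hab ltac:(lra) HF (fun x y Hx _ => HD x y Hx)).
  unfold rect_int in G. rewrite (CInt_ext (fun x => F (x, 2 * PI)) (fun x => F (x, 0))) in G by auto.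
  fold (strip_int F a) (strip_int F b) in G.
  symmetry. apply Csub_eq0.
  destruct (Cmul_integral Ci (strip_int F b - strip_int F a)%C) as [E|E]; [|exfalso|exact E].
  - rewrite <- G. ring.
  - apply (f_equal snd) in E. simpl in E. lra.
Qed.

Lemma Cexp_period (x : R) : Cexp (x, 2 * PI) = Cexp (x, 0).
Proof.
  unfold Cexp; simpl. rewrite cos_2PI, sin_2PI, cos_0, sin_0. reflexivity.
Qed.

Lemma Cexp_opp_period (x : R) : Cexp (- (x, (2 * PI)%R))%C = Cexp (- (x, 0%R))%C.
Proof.
  unfold Cexp; simpl. rewrite cos_neg, sin_neg, cos_2PI, sin_2PI, Ropp_0, cos_0, sin_0.
  cplx_eq; ring.
Qed.

Lemma Cexp_opp_mul (w : Cplx) : (Cexp (- w) * Cexp w)%C = Cone.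
Proof. rewrite <- Cexp_add. replace (- w + w)%C with Czero by ring. apply Cexp_zero. Qed.

Lemma path_bounded (u : R -> Cplx) (a b : R) : a <= b -> path_cont u ->
  exists M, forall t, a <= t <= b -> Cnorm (u t) <= M.
Proof.
  intros Hab Hu.
  destruct (continuity_ab_maj (fun t => Cnorm (u t)) a b Hab) as [m [Hm _]].
  - intros t _ eps He. destruct (Hu t eps He) as [d [Hd H]]. exists d; split; [assumption|].
    intros s [_ Hs]. specialize (H s Hs). simpl. unfold Rdist.
    eapply Rle_lt_trans; [|exact H]. apply Rabs_le.
    assert (A := Cnorm_sub_ge (u s) (u t)). assert (B := Cnorm_sub_ge (u t) (u s)).
    rewrite (Cnorm_sub_sym (u t)) in B. lra.
  - exists (Cnorm (u m)). auto.
Qed.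

Lemma entire_Cexp_opp_pow (j : nat) : entire (fun w => Cpow (Cexp (- w)) j).
Proof.
  apply (entire_comp (fun w => Cexp (- w)) (fun z => Cpow z j)); [|apply entire_Cpow].
  apply (entire_comp Copp Cexp); [|apply entire_Cexp].
  apply (entire_ext (fun w => (Copp Cone) * w)%C); [intros; ring|].
  apply entire_mul; [apply entire_const|apply entire_id].
Qed.

(** Integrand of the j-th Laurent coefficient of f in the logarithmic coordinate: the factor exp(-j
    w) already includes the change of variable dz = z dw. *)
Definition laurent (f : Cplx -> Cplx) (j : nat) (w : Cplx) : Cplx :=
  (f (Cexp w) * Cpow (Cexp (- w)) j)%C.

Lemma entire_laurent (f : Cplx -> Cplx) (j : nat) : entire f -> entire (laurent f j).
Proof.
  intros Hf. apply entire_mul; [|apply entire_Cexp_opp_pow].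
  apply (entire_comp Cexp f); [apply entire_Cexp|assumption].
Qed.

Lemma strip_entire_const (F : Cplx -> Cplx) (a b : R) :
  entire F -> (forall x, F (x, 2 * PI) = F (x, 0)) -> strip_int F a = strip_int F b.
Proof.
  intros HF Hper.
  assert (A : forall a b, a < b -> strip_int F a = strip_int F b).
  { intros a' b' Hab. apply strip_int_const; auto.
    - intros z. now apply entire_Ccont.
    - intros x y _. rewrite entire_cdiff in HF. auto. }
  destruct (Rtotal_order a b) as [H|[H|H]]; [auto|subst; auto|symmetry; auto].
Qed.

Lemma laurent_const (f : Cplx -> Cplx) (j : nat) (a b : R) : entire f ->
  strip_int (laurent f j) a = strip_int (laurent f j) b.
Proof.
  intros Hf. apply strip_entire_const; [now apply entire_laurent|].
  intros x. unfold laurent. now rewrite Cexp_period, Cexp_opp_period.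
Qed.

Lemma strip_int_bound (F : Cplx -> Cplx) (x M : R) : (forall z, Ccont F z) ->
  (forall y, 0 <= y <= 2 * PI -> Cnorm (F (x, y)) <= M) ->
  Cnorm (strip_int F x) <= 4 * PI * M.
Proof.
  intros HF HM. assert (Hpi := PI_RGT_0).
  eapply Rle_trans; [apply (CInt_bound _ 0 (2 * PI) M)|lra]; [now apply ver_cont|lra|exact HM].
Qed.

Lemma exp_opp_pow (x : R) (j : nat) : exp (- x) ^ j = / exp x ^ j.
Proof. rewrite exp_Ropp, pow_inv. reflexivity. Qed.

Lemma Cnorm_laurent (f : Cplx -> Cplx) (j : nat) (x y : R) :
  Cnorm (laurent f j (x, y)) = Cnorm (f (Cexp (x, y))) * / exp x ^ j.
Proof.
  unfold laurent. rewrite Cnorm_mul, Cnorm_pow, Cnorm_Cexp. simpl. now rewrite exp_opp_pow.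
Qed.

(* The negative Fourier modes of a constant vanish since they do not depend on the radius
   but tend to zero as the radius grows. *)
Lemma strip_int_one (j : nat) (x : R) :
  strip_int (laurent (fun _ => Cone) j) x = match j with O => RtoC (2 * PI) | S _ => Czero end.
Proof.
  destruct j as [|j].
  - unfold strip_int, laurent. simpl.
    rewrite (CInt_ext _ (fun _ => Cone)) by (intros; ring). rewrite CInt_const.
    cplx_eq; ring.
  - apply Cnorm_eq0. apply Rle_antisym; [|apply Cnorm_ge0].
    apply le_epsilon. intros eps He. rewrite Rplus_0_l.
    assert (Hpi := PI_RGT_0).
    set (X := 4 * PI / eps).
    assert (HX : 0 < X) by (apply Rdiv_lt_0_compat; lra).
    rewrite (laurent_const _ (S j) x X) by apply entire_const.
    assert (EX : X <= exp X) by (assert (1 + X <= exp X) by (apply exp_ineq1_le); lra).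
    eapply Rle_trans.
    + apply strip_int_bound with (M := / X).
      * intros z. apply entire_Ccont, entire_laurent, entire_const.
      * intros y _. rewrite Cnorm_laurent, Cnorm_one, Rmult_1_l.
        apply Rinv_le_contravar; [assumption|].
        assert (H1 : 1 <= exp X) by (assert (1 + X <= exp X) by (apply exp_ineq1_le); lra).
        assert (1 <= exp X ^ j) by (apply pow_R1_Rle; assumption). simpl. nra.
    + unfold X. right. field. lra.
Qed.

(** Continuity of the integral in the abscissa, needed to cross the one vertical line on which the
    integrand may fail to be differentiable. It follows from uniform continuity of both components
    on a compact rectangle. *)
Lemma Ccont_strip_continuous (G : Cplx -> Cplx) (L eps : R) : (forall z, Ccont G z) -> 0 < eps ->
  exists d, 0 < d /\ forall a b, Rabs (a - L) < d -> Rabs (b - L) < d ->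
    Cnorm (strip_int G a - strip_int G b) <= eps.
Proof.
  intros HG He. assert (Hpi := PI_RGT_0).
  set (e := eps / (16 * PI)). assert (He0 : 0 < e) by (apply Rdiv_lt_0_compat; lra).
  assert (H2 : forall pr : Cplx -> R, (forall z w, Rabs (pr z - pr w) <= Cnorm (z - w)) ->
    forall x y, continuity_2d_pt (fun u v => pr (G (u, v))) x y).
  { intros pr Hpr x y ep. destruct (HG (x, y) ep (cond_pos ep)) as [d [Hd H]].
    assert (Hd2 : 0 < d / 2) by lra. exists (mkposreal _ Hd2). simpl. intros u v Hu Hv.
    eapply Rle_lt_trans; [apply Hpr|]. apply H.
    eapply Rle_lt_trans; [apply Cnorm_le_abs|]. simpl. unfold Rminus in *. lra. }
  destruct (uniform_continuity_2d (fun u v => fst (G (u, v))) (L - 1) (L + 1) 0 (2 * PI)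
    ltac:(intros; apply H2; intros z w; apply (Cre_le_norm (z - w)%C)) (mkposreal _ He0)) as [d1 Hd1].
  destruct (uniform_continuity_2d (fun u v => snd (G (u, v))) (L - 1) (L + 1) 0 (2 * PI)
    ltac:(intros; apply H2; intros z w; apply (Cim_le_norm (z - w)%C)) (mkposreal _ He0)) as [d2 Hd2].
  simpl in Hd1, Hd2.
  set (d := Rmin 1 (Rmin (d1 / 2) (d2 / 2))).
  assert (P1 := cond_pos d1). assert (P2 := cond_pos d2).
  assert (Q1 : d <= 1) by apply Rmin_l.
  assert (Q2 : d <= d1 / 2) by (eapply Rle_trans; [apply Rmin_r|apply Rmin_l]).
  assert (Q3 : d <= d2 / 2) by (eapply Rle_trans; [apply Rmin_r|apply Rmin_r]).
  exists d. split; [repeat apply Rmin_pos; lra|].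
  intros a b Ha Hb. apply Rabs_def2 in Ha. apply Rabs_def2 in Hb.
  unfold strip_int.
  replace (CInt (fun y => G (a, y)) 0 (2 * PI) - CInt (fun y => G (b, y)) 0 (2 * PI))%C
    with (CInt (fun y => G (a, y) + (- Cone) * G (b, y))%C 0 (2 * PI)).
  2:{ rewrite CInt_add, CInt_scal.
      - ring.
      - now apply ver_cont.
      - now apply ver_cont.
      - apply (path_cont_comp (fun z => (- Cone) * G z)%C (fun y => (b, y))); [|apply path_cont_ver].
        intros z; apply Ccont_mul; [apply Ccont_const|auto]. }
  eapply Rle_trans.
  - apply CInt_bound with (M := 2 * e); [|lra|].
    + assert (X : path_cont (fun y => G (a, y) + (- Cone) * G (b, y))%C); [|exact X].
      intros t ep Hep.
      destruct (ver_cont G a HG t (ep / 2)) as [r1 [Hr1 R1]]; [lra|].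
      destruct (ver_cont G b HG t (ep / 2)) as [r2 [Hr2 R2]]; [lra|].
      exists (Rmin r1 r2). split; [now apply Rmin_pos|]. intros s Hs.
      specialize (R1 s (Rlt_le_trans _ _ _ Hs (Rmin_l _ _))).
      specialize (R2 s (Rlt_le_trans _ _ _ Hs (Rmin_r _ _))).
      replace (G (a, s) + - Cone * G (b, s) - (G (a, t) + - Cone * G (b, t)))%C
        with ((G (a, s) - G (a, t)) - (G (b, s) - G (b, t)))%C by ring.
      eapply Rle_lt_trans; [apply Cnorm_sub|]. lra.
    + intros t Ht.
      specialize (Hd1 b t a t ltac:(lra) ltac:(lra) ltac:(lra) ltac:(lra)
        ltac:(apply Rabs_def1; lra) ltac:(replace (t - t) with 0 by ring; rewrite Rabs_R0; lra)).
      specialize (Hd2 b t a t ltac:(lra) ltac:(lra) ltac:(lra) ltac:(lra)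
        ltac:(apply Rabs_def1; lra) ltac:(replace (t - t) with 0 by ring; rewrite Rabs_R0; lra)).
      replace (G (a, t) + - Cone * G (b, t))%C with (G (a, t) - G (b, t))%C by ring.
      eapply Rle_trans; [apply Cnorm_le_abs|]. simpl. unfold Rminus in *. lra.
  - replace (2 * ((2 * PI - 0) * (2 * e))) with (eps / 2) by (unfold e; field; lra). lra.
Qed.

(** At z the quotient is completed by the derivative. Differentiability at z itself is deliberately
    left open: proving it would already require the power series. *)
Lemma difference_quotient (f : Cplx -> Cplx) (z : Cplx) : entire f ->
  exists g, (forall w, (w - z) * g w = f w - f z)%C /\ (forall w, Ccont g w) /\
    (forall w, w <> z -> exists l, cdiff g w l).
Proof.
  intros Hf. assert (HD := Hf). rewrite entire_cdiff in HD. destruct (HD z) as [l Hl].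
  apply cdiff_quotient in Hl. destruct Hl as [q [Hq [_ Qc]]].
  exists (fun w => q (w - z)%C).
  assert (E : forall w, ((w - z) * q (w - z) = f w - f z)%C).
  { intros w. specialize (Hq (w - z)%C). replace (z + (w - z))%C with w in Hq by ring.
    rewrite Hq. ring. }
  assert (D : forall w, w <> z -> exists l, cdiff (fun w => q (w - z)%C) w l).
  { intros w Hw.
    assert (Hwz : (w + - z)%C <> Czero) by (intros X; apply Hw, Csub_eq0; exact X).
    destruct (HD w) as [l1 Hl1].
    destruct (cdiff_div (fun w => f w + - f z)%C (fun w => w + - z)%C w _ _
      (cdiff_add _ _ _ _ _ Hl1 (cdiff_const (- f z)%C w))
      (cdiff_add _ _ _ _ _ (cdiff_id w) (cdiff_const (- z)%C w)) Hwz) as [l2 Hl2].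
    exists l2. eapply cdiff_local; [apply (Cnorm_pos _ Hwz)| |exact Hl2].
    intros v Hv. simpl.
    assert (Hvz : (v - z)%C <> Czero).
    { intros X. apply Csub_eq0 in X. subst v. rewrite Cnorm_sub_sym in Hv.
      unfold Csub in Hv. lra. }
    change (v + - z)%C with (v - z)%C. change (f v + - f z)%C with (f v - f z)%C.
    rewrite <- E. field. exact Hvz. }
  split; [exact E|]. split; [|exact D].
  intros w. destruct (classic (w = z)) as [->|N].
  - intros eps He. replace (z - z)%C with Czero by ring.
    destruct (Qc eps He) as [d [Hd H]]. exists d; split; [assumption|].
    intros v Hv. apply H. now replace (v - z - Czero)%C with (v - z)%C by ring.
  - destruct (D w N) as [l2 Hl2]. eapply cdiff_Ccont; eauto.
Qed.

(** On either side of the line exp u = |z| the integral is constant in u. It tends to 0 as u tends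
    to minus infinity because of the factor exp w, and continuity in u carries the value 0 across
    the line. For z = 0 there is no line to cross. *)
Lemma Cauchy_difference_quotient (g : Cplx -> Cplx) (z : Cplx) (x : R) :
  (forall w, Ccont g w) -> (forall w, w <> z -> exists l, cdiff g w l) -> Cnorm z < exp x ->
  strip_int (fun w => g (Cexp w) * Cexp w)%C x = Czero.
Proof.
  intros Hc Hd Hx. set (G := fun w => (g (Cexp w) * Cexp w)%C).
  assert (HG : forall w, Ccont G w).
  { intros w. apply Ccont_mul.
    - apply (Ccont_comp Cexp g); [|auto]. apply entire_Ccont, entire_Cexp.
    - apply entire_Ccont, entire_Cexp. }
  assert (Gper : forall u, G (u, 2 * PI) = G (u, 0)).
  { intros u. unfold G. now rewrite Cexp_period. }
  assert (GD : forall u y, exp u <> Cnorm z -> exists l, cdiff G (u, y) l).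
  { intros u y Hu. destruct (Hd (Cexp (u, y))) as [l Hl].
    - intros E. apply Hu. rewrite <- E, Cnorm_Cexp. reflexivity.
    - eexists. apply (cdiff_mul (fun w => g (Cexp w)) Cexp).
      + apply (cdiff_comp Cexp g); [apply cdiff_Cexp|exact Hl].
      + apply cdiff_Cexp. }
  assert (Hpi := PI_RGT_0).
  assert (Hsmall : forall eps v, 0 < eps -> exists u, u < v /\ Cnorm (strip_int G u) <= eps).
  { intros eps v He. destruct (Hc Czero 1 ltac:(lra)) as [d [Hd0 Hg]].
    set (K := Cnorm (g Czero) + 1). assert (N := Cnorm_ge0 (g Czero)).
    assert (HK : 0 < K) by (unfold K; lra).
    (* The three bounds respectively give |g| <= K on the circle of radius m / 2, make the integral
       at most eps, and place the circle to the left of v. *)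
    set (m := Rmin (Rmin d (eps / (4 * PI * K))) (exp v)).
    assert (HM0 : 0 < eps / (4 * PI * K)) by (apply Rdiv_lt_0_compat; nra).
    assert (Hm : 0 < m) by (repeat apply Rmin_pos; auto using exp_pos).
    assert (M1 : m <= d) by (eapply Rle_trans; [apply Rmin_l|apply Rmin_l]).
    assert (M2 : m <= eps / (4 * PI * K)) by (eapply Rle_trans; [apply Rmin_l|apply Rmin_r]).
    assert (M3 : m <= exp v) by apply Rmin_r.
    exists (ln (m / 2)).
    assert (Em : exp (ln (m / 2)) = m / 2) by (apply exp_ln; lra).
    split.
    - apply exp_lt_inv. rewrite Em. lra.
    - eapply Rle_trans; [apply strip_int_bound with (M := K * m); [assumption|]|].
      + intros y _. unfold G. rewrite Cnorm_mul.
        assert (Ne : Cnorm (Cexp (ln (m / 2), y)) = m / 2) by (rewrite Cnorm_Cexp; exact Em).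
        rewrite Ne. apply Rmult_le_compat; [apply Cnorm_ge0|lra| |lra].
        specialize (Hg (Cexp (ln (m / 2), y))).
        replace (Cexp (ln (m / 2), y) - Czero)%C with (Cexp (ln (m / 2), y)) in Hg by ring.
        rewrite Ne in Hg. specialize (Hg ltac:(lra)).
        assert (A := Cnorm_sub_ge (g (Cexp (ln (m / 2), y))) (g Czero)). unfold K. lra.
      + apply (Rmult_le_compat_l (4 * PI * K)) in M2; [|nra].
        replace (4 * PI * K * (eps / (4 * PI * K))) with eps in M2 by (field; lra). lra. }
  assert (Hbelow : forall v, (forall u, u <= v -> exp u <> Cnorm z) -> strip_int G v = Czero).
  { intros v Hv. apply Cnorm_eq0, Rle_antisym; [|apply Cnorm_ge0].
    apply le_epsilon. intros eps He. destruct (Hsmall eps v He) as [u [Huv Hu]].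
    rewrite <- (strip_int_const G u v Huv HG Gper); [lra|].
    intros t y Ht. apply GD, Hv. lra. }
  destruct (classic (z = Czero)) as [Ez|Nz].
  - apply Hbelow. intros u _. rewrite Ez, Cnorm_zero. assert (P := exp_pos u). lra.
  - assert (Pz := Cnorm_pos z Nz). set (L := ln (Cnorm z)).
    assert (EL : exp L = Cnorm z) by (now apply exp_ln).
    assert (HLx : L < x) by (apply exp_lt_inv; lra).
    apply Cnorm_eq0, Rle_antisym; [|apply Cnorm_ge0].
    apply le_epsilon. intros eps He. rewrite Rplus_0_l.
    destruct (Ccont_strip_continuous G L eps HG He) as [d [Hd0 HJ]].
    set (s := Rmin (d / 2) ((x - L) / 2)).
    assert (Hs : 0 < s) by (apply Rmin_pos; lra).
    assert (S1 : s <= d / 2) by apply Rmin_l. assert (S2 : s <= (x - L) / 2) by apply Rmin_r.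
    specialize (HJ (L + s) (L - s) ltac:(apply Rabs_def1; lra) ltac:(apply Rabs_def1; lra)).
    rewrite (Hbelow (L - s)) in HJ.
    + rewrite <- (strip_int_const G (L + s) x ltac:(lra) HG Gper).
      * now replace (strip_int G (L + s) - Czero)%C with (strip_int G (L + s)) in HJ by ring.
      * intros t y Ht. apply GD. rewrite <- EL. apply Rgt_not_eq, exp_increasing. lra.
    + intros u Hu. rewrite <- EL. apply Rlt_not_eq, exp_increasing. lra.
Qed.

Lemma strip_int_ext (F G : Cplx -> Cplx) (x : R) : (forall w, F w = G w) ->
  strip_int F x = strip_int G x.
Proof. intros H. apply CInt_ext. auto. Qed.

Lemma strip_int_add (F G : Cplx -> Cplx) (x : R) : (forall w, Ccont F w) -> (forall w, Ccont G w) ->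
  strip_int (fun w => F w + G w)%C x = (strip_int F x + strip_int G x)%C.
Proof. intros HF HG. apply (CInt_add (fun y => F (x, y)) (fun y => G (x, y))); now apply ver_cont. Qed.

Lemma strip_int_scal (c : Cplx) (F : Cplx -> Cplx) (x : R) : (forall w, Ccont F w) ->
  strip_int (fun w => c * F w)%C x = (c * strip_int F x)%C.
Proof. intros HF. apply (CInt_scal c (fun y => F (x, y))); now apply ver_cont. Qed.

(** Cauchy's integral over the unit circle; by [laurent_const] any other radius gives the same
    value. *)
Definition taylor_coef (f : Cplx -> Cplx) (j : nat) : Cplx :=
  (RtoC (/ (2 * PI)) * strip_int (laurent f j) 0)%C.

(* Iterating [g(w) w = (f(w) - f(z)) + (z / w) g(w) w] under the integral sign. *)
Lemma cauchy_expansion (f g : Cplx -> Cplx) (z : Cplx) (x : R) (n : nat) : entire f ->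
  (forall w, (w - z) * g w = f w - f z)%C -> (forall w, Ccont g w) ->
  strip_int (fun w => g (Cexp w) * Cexp w)%C x =
  (Csum n (fun j => Cpow z j * (strip_int (laurent f j) x
                     - f z * strip_int (laurent (fun _ => Cone) j) x))
   + Cpow z n * strip_int (fun w => Cpow (Cexp (- w)) n * (g (Cexp w) * Cexp w)) x)%C.
Proof.
  intros Hf Hg Hc.
  assert (HG : forall n w, Ccont (fun w => Cpow (Cexp (- w)) n * (g (Cexp w) * Cexp w))%C w).
  { intros k w. apply Ccont_mul; [apply entire_Ccont, entire_Cexp_opp_pow|].
    apply Ccont_mul; [|apply entire_Ccont, entire_Cexp].
    apply (Ccont_comp Cexp g); [|auto]. apply entire_Ccont, entire_Cexp. }
  induction n; simpl Csum; simpl Cpow at 1.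
  - rewrite (strip_int_ext (fun w => Cone * (g (Cexp w) * Cexp w))%C
      (fun w => g (Cexp w) * Cexp w)%C) by (intros; ring). ring.
  - rewrite IHn. 
    assert (E : strip_int (fun w => Cpow (Cexp (- w)) n * (g (Cexp w) * Cexp w))%C x =
      ((strip_int (laurent f n) x - f z * strip_int (laurent (fun _ => Cone) n) x)
       + z * strip_int (fun w => Cpow (Cexp (- w)) (S n) * (g (Cexp w) * Cexp w)) x)%C).
    { rewrite (strip_int_ext _ (fun w => (laurent f n w + (- f z) * laurent (fun _ => Cone) n w)
        + z * (Cpow (Cexp (- w)) (S n) * (g (Cexp w) * Cexp w)))%C).
      - rewrite strip_int_add, strip_int_add, strip_int_scal, strip_int_scal; [ring|..].
        + intros; apply HG.
        + intros; apply entire_Ccont, entire_laurent, entire_const.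
        + intros; apply entire_Ccont, entire_laurent; assumption.
        + intros; apply Ccont_mul; [apply Ccont_const|].
          apply entire_Ccont, entire_laurent, entire_const.
        + intros; apply Ccont_add; [apply entire_Ccont, entire_laurent; assumption|].
          apply Ccont_mul; [apply Ccont_const|]. apply entire_Ccont, entire_laurent, entire_const.
        + intros; apply Ccont_mul; [apply Ccont_const|apply HG].
      - intros w. unfold laurent. simpl Cpow at 4.
        replace (z * (Cexp (- w) * Cpow (Cexp (- w)) n * (g (Cexp w) * Cexp w)))%C
          with (z * (Cexp (- w) * Cexp w) * (Cpow (Cexp (- w)) n * g (Cexp w)))%C by ring.
        rewrite Cexp_opp_mul.
        replace (g (Cexp w) * Cexp w)%C with ((Cexp w - z) * g (Cexp w) + z * g (Cexp w))%C by ring.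
        rewrite Hg. ring. }
    rewrite E. simpl Cpow. ring.
Qed.

Theorem entire_power_series (f : Cplx -> Cplx) (z : Cplx) : entire f ->
  Cseries (fun j => taylor_coef f j * Cpow z j)%C (f z).
Proof.
  intros Hf. assert (Hpi := PI_RGT_0).
  destruct (difference_quotient f z Hf) as [g [Hg [Hc Hd]]].
  (* With this radius the ratio |z| / exp x is at most 1/2, so the remainder decays
     geometrically. *)
  set (x := ln (2 * Cnorm z + 1)). assert (Nz := Cnorm_ge0 z).
  assert (Ex : exp x = 2 * Cnorm z + 1) by (apply exp_ln; lra).
  assert (HJ := Cauchy_difference_quotient g z x Hc Hd ltac:(lra)).
  assert (HG : forall w, Ccont (fun w => (g (Cexp w) * Cexp w))%C w).
  { intros w. apply Ccont_mul; [|apply entire_Ccont, entire_Cexp].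
    apply (Ccont_comp Cexp g); [|auto]. apply entire_Ccont, entire_Cexp. }
  destruct (path_bounded (fun y => (g (Cexp (x, y)) * Cexp (x, y))%C) 0 (2 * PI) ltac:(lra)) as [M HM].
  { now apply (ver_cont (fun w => (g (Cexp w) * Cexp w))%C). }
  assert (HM0 : 0 <= M) by (eapply Rle_trans; [apply Cnorm_ge0|apply (HM 0); lra]).
  (* Expanding the vanishing integral gives Taylor's formula with remainder. The term f z stems from
     the zeroth mode of the constant, hence is absent when the sum is empty. *)
  assert (key : forall n, (Csum n (fun j => taylor_coef f j * Cpow z j)
      - match n with O => Czero | S _ => f z end
      = - (RtoC (/ (2 * PI)) *
       (Cpow z n * strip_int (fun w => Cpow (Cexp (- w)) n * (g (Cexp w) * Cexp w)) x)))%C).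
  { intros n. assert (E := cauchy_expansion f g z x n Hf Hg Hc). rewrite HJ in E.
    set (T := (Cpow z n * _)%C) in *.
    assert (E2 : Csum n (fun j => Cpow z j * (strip_int (laurent f j) x
                     - f z * strip_int (laurent (fun _ => Cone) j) x))%C =
       (RtoC (2 * PI) * (Csum n (fun j => taylor_coef f j * Cpow z j)
      - match n with O => Czero | S _ => f z end))%C).
    { clear E T. induction n.
      - simpl. ring.
      - simpl Csum. rewrite IHn, strip_int_one. unfold taylor_coef.
        rewrite (laurent_const f n x 0 Hf), RtoC_inv by lra. destruct n.
        + simpl. field. apply RtoC_neq0. lra.
        + field. apply RtoC_neq0. lra. }
    rewrite E2 in E. rewrite RtoC_inv by lra.
    set (D := (Csum n _ - _)%C) in *.
    replace T with (- (RtoC (2 * PI) * D))%C.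
    - field. apply RtoC_neq0. lra.
    - replace T with (RtoC (2 * PI) * D + T - RtoC (2 * PI) * D)%C by ring. rewrite <- E. ring. }
  assert (bound : forall n, (1 <= n)%nat ->
     Cnorm (Csum n (fun j => taylor_coef f j * Cpow z j)%C - f z) <= 2 * M * (/ 2) ^ n).
  { intros n Hn. specialize (key n). destruct n; [lia|]. rewrite key, Cnorm_opp.
    rewrite !Cnorm_mul, Cnorm_RtoC, Cnorm_pow.
    assert (B := strip_int_bound (fun w => Cpow (Cexp (- w)) (S n) * (g (Cexp w) * Cexp w))%C x
      (/ exp x ^ S n * M)). 
    assert (B2 : Cnorm (strip_int (fun w => Cpow (Cexp (- w)) (S n) * (g (Cexp w) * Cexp w))%C x)
      <= 4 * PI * (/ exp x ^ S n * M)).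
    { apply B.
      - intros w. apply Ccont_mul; [apply entire_Ccont, entire_Cexp_opp_pow|apply HG].
      - intros y Hy. rewrite Cnorm_mul, Cnorm_pow, Cnorm_Cexp.
        change (fst (- (x, y))%C) with (- x). rewrite exp_opp_pow.
        apply Rmult_le_compat_l; [|now apply HM].
        left. apply Rinv_0_lt_compat, pow_lt, exp_pos. }
    rewrite Rabs_pos_eq by (left; apply Rinv_0_lt_compat; lra).
    apply Rle_trans with (/ (2 * PI) * (Cnorm z ^ S n * (4 * PI * (/ exp x ^ S n * M)))).
    - apply Rmult_le_compat_l; [left; apply Rinv_0_lt_compat; lra|].
      apply Rmult_le_compat_l; [apply pow_le; lra|assumption].
    - replace (/ (2 * PI) * (Cnorm z ^ S n * (4 * PI * (/ exp x ^ S n * M))))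
        with (2 * M * (Cnorm z * / exp x) ^ S n).
      + apply Rmult_le_compat_l; [lra|]. apply pow_incr. split.
        * apply Rmult_le_pos; [lra|]. left. apply Rinv_0_lt_compat, exp_pos.
        * apply Rmult_le_reg_r with (exp x); [apply exp_pos|].
          rewrite Rmult_assoc, Rinv_l, Ex by (apply Rgt_not_eq, exp_pos). lra.
      + rewrite Rpow_mult_distr, pow_inv. field. split; [|lra].
        apply pow_nonzero, Rgt_not_eq, exp_pos. }
  intros eps He.
  destruct (geometric_small (/ 2) (2 * M) eps) as [N HN]; [lra|lra|assumption|].
  exists (S N). intros n Hn. eapply Rle_lt_trans; [apply bound; lia|]. apply HN. lia.
Qed.

Lemma taylor_coef_bound_circle (f : Cplx -> Cplx) (r B : R) (j : nat) : entire f -> 0 < r ->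
  (forall y, 0 <= y <= 2 * PI -> Cnorm (f (Cexp (ln r, y))) <= B) ->
  Cnorm (taylor_coef f j) * r ^ j <= 2 * B.
Proof.
  intros Hf Hr HB. assert (Hpi := PI_RGT_0). unfold taylor_coef.
  rewrite (laurent_const f j 0 (ln r) Hf), Cnorm_mul, Cnorm_RtoC.
  rewrite Rabs_pos_eq by (left; apply Rinv_0_lt_compat; lra).
  assert (Pj : 0 < r ^ j) by (now apply pow_lt).
  assert (S := strip_int_bound (laurent f j) (ln r) (B * / r ^ j)).
  assert (S2 : Cnorm (strip_int (laurent f j) (ln r)) <= 4 * PI * (B * / r ^ j)).
  { apply S.
    - intros z. now apply entire_Ccont, entire_laurent.
    - intros y Hy. rewrite Cnorm_laurent, exp_ln by assumption.
      apply Rmult_le_compat_r; [left; now apply Rinv_0_lt_compat|auto]. }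
  apply Rle_trans with (/ (2 * PI) * (4 * PI * (B * / r ^ j)) * r ^ j).
  - apply Rmult_le_compat_r; [lra|]. apply Rmult_le_compat_l; [|assumption].
    left; apply Rinv_0_lt_compat; lra.
  - right. field. lra.
Qed.

Lemma taylor_coef_bound (f : Cplx -> Cplx) (r B : R) (j : nat) : entire f -> 0 < r ->
  (forall z, Cnorm z <= r -> Cnorm (f z) <= B) -> Cnorm (taylor_coef f j) * r ^ j <= 2 * B.
Proof.
  intros Hf Hr HB. apply taylor_coef_bound_circle; auto.
  intros y _. apply HB. rewrite Cnorm_Cexp. simpl. rewrite exp_ln; lra.
Qed.

Lemma taylor_coef_decay (f : Cplx -> Cplx) (r : R) : entire f -> 0 < r ->
  exists K, forall j, Cnorm (taylor_coef f j) * r ^ j <= K.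
Proof.
  intros Hf Hr. assert (Hpi := PI_RGT_0).
  destruct (path_bounded (fun y => f (Cexp (ln r, y))) 0 (2 * PI) ltac:(lra)) as [M HM].
  - apply (ver_cont (fun w => f (Cexp w))). intros z. apply entire_Ccont.
    apply (entire_comp Cexp f); [apply entire_Cexp|assumption].
  - exists (2 * M). intros j. now apply taylor_coef_bound_circle.
Qed.

(** * Derivatives at the origin and their pairing *)

Lemma Ccv_unique (u : nat -> Cplx) (l m : Cplx) : Ccv u l -> Ccv u m -> l = m.
Proof.
  intros H1 H2. apply Csub_eq0, Cnorm_eq0, Rle_antisym; [|apply Cnorm_ge0].
  apply le_epsilon. intros eps He.
  destruct (H1 (eps / 2)) as [N1 A1]; [lra|]. destruct (H2 (eps / 2)) as [N2 A2]; [lra|].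
  specialize (A1 (Nat.max N1 N2) ltac:(lia)). specialize (A2 (Nat.max N1 N2) ltac:(lia)).
  rewrite Cnorm_sub_sym in A1.
  assert (T := Cnorm_sub_trans l (u (Nat.max N1 N2)) m). lra.
Qed.

Lemma Ccv_ext (u v : nat -> Cplx) (l : Cplx) : (forall n, u n = v n) -> Ccv u l -> Ccv v l.
Proof. intros E. now replace v with u by (apply functional_extensionality; auto). Qed.

Lemma Ccv_const (c : Cplx) : Ccv (fun _ => c) c.
Proof.
  intros eps He. exists 0%nat. intros. replace (c - c)%C with Czero by ring. now rewrite Cnorm_zero.
Qed.

Lemma Ccv_add (u v : nat -> Cplx) (l m : Cplx) :
  Ccv u l -> Ccv v m -> Ccv (fun n => u n + v n)%C (l + m)%C.
Proof.
  intros H1 H2 eps He.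
  destruct (H1 (eps / 2)) as [N1 A1]; [lra|]. destruct (H2 (eps / 2)) as [N2 A2]; [lra|].
  exists (Nat.max N1 N2). intros n Hn. specialize (A1 n ltac:(lia)). specialize (A2 n ltac:(lia)).
  replace (u n + v n - (l + m))%C with ((u n - l) + (v n - m))%C by ring.
  eapply Rle_lt_trans; [apply Cnorm_add|]. lra.
Qed.

Lemma Ccv_scal (c : Cplx) (u : nat -> Cplx) (l : Cplx) :
  Ccv u l -> Ccv (fun n => c * u n)%C (c * l)%C.
Proof.
  intros H eps He. assert (N := Cnorm_ge0 c).
  destruct (H (eps / (Cnorm c + 1))) as [n0 A]; [apply Rdiv_lt_0_compat; lra|].
  exists n0. intros n Hn. specialize (A n Hn).
  replace (c * u n - c * l)%C with (c * (u n - l))%C by ring. rewrite Cnorm_mul.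
  apply (Rmult_lt_compat_r (Cnorm c + 1)) in A; [|lra].
  unfold Rdiv in A. rewrite Rmult_assoc, Rinv_l in A by lra.
  assert (P := Cnorm_ge0 (u n - l)). nra.
Qed.

Lemma Ccv_shift (u : nat -> Cplx) (l : Cplx) : Ccv (fun n => u (S n)) l -> Ccv u l.
Proof.
  intros H eps He. destruct (H eps He) as [N A]. exists (S N). intros n Hn.
  destruct n; [lia|]. apply A. lia.
Qed.

Lemma Ccv_norm_le (u : nat -> Cplx) (l : Cplx) (B : R) (N : nat) :
  Ccv u l -> (forall n, (N <= n)%nat -> Cnorm (u n) <= B) -> Cnorm l <= B.
Proof.
  intros H HB. apply le_epsilon. intros eps He. destruct (H eps He) as [N1 A].
  specialize (A (Nat.max N N1) ltac:(lia)). specialize (HB (Nat.max N N1) ltac:(lia)).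
  assert (T := Cnorm_sub_ge l (u (Nat.max N N1))). rewrite Cnorm_sub_sym in T. lra.
Qed.

Lemma Ccv_squeeze (u : nat -> Cplx) (l : Cplx) (C q : R) : 0 <= q < 1 ->
  (forall n, Cnorm (u n - l) <= C * q ^ n) -> Ccv u l.
Proof.
  intros Hq H eps He.
  assert (HC : 0 <= C).
  { specialize (H 0%nat). simpl in H. assert (P := Cnorm_ge0 (u 0%nat - l)). lra. }
  destruct (geometric_small q C eps Hq HC He) as [N HN].
  exists N. intros n Hn. eapply Rle_lt_trans; [apply H|auto].
Qed.

Lemma C_complete (u : nat -> Cplx) :
  (forall eps, 0 < eps -> exists N, forall n m, (N <= n)%nat -> (N <= m)%nat -> Cnorm (u n - u m) < eps) ->
  exists l, Ccv u l.
Proof.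
  intros H.
  destruct (R_complete (fun n => fst (u n))) as [x Hx].
  { intros eps He. destruct (H eps He) as [N HN]. exists N. intros n m Hn Hm.
    eapply Rle_lt_trans; [|apply (HN n m); lia]. apply (Cre_le_norm (u n - u m)%C). }
  destruct (R_complete (fun n => snd (u n))) as [y Hy].
  { intros eps He. destruct (H eps He) as [N HN]. exists N. intros n m Hn Hm.
    eapply Rle_lt_trans; [|apply (HN n m); lia]. apply (Cim_le_norm (u n - u m)%C). }
  exists (x, y). intros eps He.
  destruct (Hx (eps / 2)) as [N1 A1]; [lra|]. destruct (Hy (eps / 2)) as [N2 A2]; [lra|].
  exists (Nat.max N1 N2). intros n Hn. specialize (A1 n ltac:(lia)). specialize (A2 n ltac:(lia)).
  eapply Rle_lt_trans; [apply Cnorm_le_abs|]. unfold Rdist, Rminus in *. simpl. lra.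
Qed.

Lemma Csum_geo_tail (s : nat -> Cplx) (C q : R) (n k : nat) : 0 <= q < 1 ->
  (forall i, Cnorm (s i) <= C * q ^ i) ->
  Cnorm (Csum (n + k) s - Csum n s) <= C * q ^ n * / (1 - q).
Proof.
  intros Hq H.
  assert (HC : 0 <= C).
  { specialize (H 0%nat). simpl in H. assert (P := Cnorm_ge0 (s 0%nat)). lra. }
  replace (Csum (n + k) s - Csum n s)%C with (Csum k (fun i => s (n + i)%nat))
    by (rewrite Csum_split; ring).
  eapply Rle_trans; [apply (Csum_norm_le _ _ (fun i => C * q ^ n * q ^ i))|].
  - intros i _. rewrite Rmult_assoc, <- pow_add. apply H.
  - rewrite Rsum_scal. apply Rmult_le_compat_l; [|now apply Rsum_pow_le].
    apply Rmult_le_pos; [assumption|]. apply pow_le; lra.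
Qed.

(** A total sum, meaningful only for convergent series, so that pairings can be written down without
    carrying convergence proofs. *)
Definition csum (s : nat -> Cplx) : Cplx := epsilon (inhabits Czero) (fun l => Cseries s l).

Lemma csum_eq (s : nat -> Cplx) (l : Cplx) : Cseries s l -> csum s = l.
Proof.
  intros H. assert (E : Cseries s (csum s)) by (apply (epsilon_spec (inhabits Czero) (fun l => Cseries s l)); now exists l).
  eapply Ccv_unique; eauto.
Qed.

Lemma csum_geo (s : nat -> Cplx) (C q : R) : 0 <= q < 1 ->
  (forall i, Cnorm (s i) <= C * q ^ i) -> Cseries s (csum s).
Proof.
  intros Hq H. apply (epsilon_spec (inhabits Czero) (fun l => Cseries s l)).
  assert (HC : 0 <= C).
  { specialize (H 0%nat). simpl in H. assert (P := Cnorm_ge0 (s 0%nat)). lra. }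
  apply C_complete. intros eps He.
  assert (Hq1 : 0 < / (1 - q)) by (apply Rinv_0_lt_compat; lra).
  destruct (geometric_small q (C * / (1 - q)) eps Hq) as [N HN];
    [apply Rmult_le_pos; lra|assumption|].
  assert (W : forall n, (N <= n)%nat -> forall k, Cnorm (Csum (n + k) s - Csum n s) < eps).
  { intros n Hn k. eapply Rle_lt_trans; [now apply Csum_geo_tail|].
    specialize (HN n Hn). lra. }
  exists N. intros n m Hn Hm. destruct (Nat.le_ge_cases n m) as [L|L].
  - rewrite Cnorm_sub_sym. replace m with (n + (m - n))%nat by lia. now apply W.
  - replace n with (m + (n - m))%nat by lia. now apply W.
Qed.

Lemma csum_tail (s : nat -> Cplx) (C q : R) (n : nat) : 0 <= q < 1 ->
  (forall i, Cnorm (s i) <= C * q ^ i) ->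
  Cnorm (csum s - Csum n s) <= C * q ^ n * / (1 - q).
Proof.
  intros Hq H.
  assert (HS := csum_geo s C q Hq H).
  apply (Ccv_norm_le (fun m => Csum m s - Csum n s)%C _ _ n).
  - apply (Ccv_add _ (fun _ => - Csum n s)%C); [exact HS|apply Ccv_const].
  - intros m Hm. replace m with (n + (m - n))%nat by lia. now apply Csum_geo_tail.
Qed.

Notation factR i := (INR (fact i)).

Lemma factR_pos (i : nat) : 0 < factR i.
Proof. apply INR_fact_lt_0. Qed.

Definition expo_bound (C A : R) (u : nat -> Cplx) : Prop := forall i, Cnorm (u i) <= C * A ^ i.
Definition fact_bound (K e : R) (v : nat -> Cplx) : Prop :=
  forall i, Cnorm (v i) <= K * e ^ i * factR i.
(* Derivatives at the origin of functions of exponential type and of entire functions. *)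
Definition expo_type (u : nat -> Cplx) : Prop := exists C A, 0 < A /\ expo_bound C A u.
Definition entire_type (v : nat -> Cplx) : Prop := forall e, 0 < e -> exists K, fact_bound K e v.

Definition pterm (u v : nat -> Cplx) (i : nat) : Cplx := (RtoC (/ factR i) * (u i * v i))%C.
Definition pairing (u v : nat -> Cplx) : Cplx := csum (pterm u v).
(** Derivatives at the origin of x |-> exp(z x). As this sequence has both exponential and entire
    type, [ev] serves twice: it evaluates an entire function, and it gives the value of a functional
    on an exponential. *)
Definition geo (z : Cplx) : nat -> Cplx := Cpow z.
Definition ev (v : nat -> Cplx) (z : Cplx) : Cplx := pairing (geo z) v.
Definition shiftn (k : nat) (v : nat -> Cplx) : nat -> Cplx := fun i => v (k + i)%nat.
(* Multiplication by the variable, on derivatives at the origin. *)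
Definition mulz (u : nat -> Cplx) (i : nat) : Cplx :=
  match i with O => Czero | S i' => (RtoC (INR i) * u i')%C end.

Lemma expo_bound_pos (C A : R) (u : nat -> Cplx) : expo_bound C A u -> 0 <= C.
Proof. intros H. specialize (H 0%nat). simpl in H. assert (P := Cnorm_ge0 (u 0%nat)). lra. Qed.

Lemma fact_bound_pos (K e : R) (v : nat -> Cplx) : fact_bound K e v -> 0 <= K.
Proof. intros H. specialize (H 0%nat). simpl in H. assert (P := Cnorm_ge0 (v 0%nat)). lra. Qed.

(** The factorials cancel and leave (A e)^i. The constants such as / 2 * / A chosen in later
    estimates serve to meet A * e <= / 2. *)
Lemma pterm_bound (C A K e : R) (u v : nat -> Cplx) (i : nat) : 0 < A -> 0 < e -> A * e <= / 2 ->
  expo_bound C A u -> fact_bound K e v -> Cnorm (pterm u v i) <= C * K * (/ 2) ^ i.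
Proof.
  intros HA He HAe Hu Hv. assert (HC := expo_bound_pos _ _ _ Hu). assert (HK := fact_bound_pos _ _ _ Hv).
  unfold pterm. rewrite !Cnorm_mul, Cnorm_RtoC.
  assert (F := factR_pos i).
  rewrite Rabs_pos_eq by (left; now apply Rinv_0_lt_compat).
  apply Rle_trans with (/ factR i * ((C * A ^ i) * (K * e ^ i * factR i))).
  - apply Rmult_le_compat_l; [left; now apply Rinv_0_lt_compat|].
    apply Rmult_le_compat; auto using Cnorm_ge0.
  - replace (/ factR i * (C * A ^ i * (K * e ^ i * factR i))) with (C * K * (A * e) ^ i)
      by (rewrite Rpow_mult_distr; field; lra).
    apply Rmult_le_compat_l; [now apply Rmult_le_pos|]. apply pow_incr. split; [nra|assumption].
Qed.

Lemma pairing_bound (C A K e : R) (u v : nat -> Cplx) : 0 < A -> 0 < e -> A * e <= / 2 ->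
  expo_bound C A u -> fact_bound K e v ->
  Cnorm (pairing u v) <= 2 * (C * K).
Proof.
  intros HA He HAe Hu Hv.
  assert (T := csum_tail (pterm u v) (C * K) (/ 2) 0 ltac:(lra)
    (fun i => pterm_bound C A K e u v i HA He HAe Hu Hv)).
  simpl in T. fold (pairing u v) in T. replace (pairing u v - Czero)%C with (pairing u v) in T by ring.
  lra.
Qed.

Lemma pairing_bounds (u v : nat -> Cplx) : expo_type u -> entire_type v ->
  exists C A K e, 0 < A /\ 0 < e /\ A * e <= / 2 /\ expo_bound C A u /\ fact_bound K e v.
Proof.
  intros [C [A [HA Hu]]] Hv. 
  assert (He : 0 < / 2 * / A) by (assert (0 < / A) by (now apply Rinv_0_lt_compat); lra).
  destruct (Hv _ He) as [K HK]. exists C, A, K, (/ 2 * / A). repeat split; auto.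
  right. field. lra.
Qed.

Lemma pairing_series (u v : nat -> Cplx) : expo_type u -> entire_type v ->
  Cseries (pterm u v) (pairing u v).
Proof.
  intros Hu Hv. destruct (pairing_bounds u v Hu Hv) as [C [A [K [e [HA [He [HAe [Bu Bv]]]]]]]].
  apply (csum_geo _ (C * K) (/ 2)); [lra|]. intros i. now apply (pterm_bound C A K e).
Qed.

Lemma Cseries_ext (s t : nat -> Cplx) (l : Cplx) : (forall i, s i = t i) -> Cseries s l -> Cseries t l.
Proof. intros E. now replace t with s by (apply functional_extensionality; auto). Qed.

Lemma Cseries_add (s t : nat -> Cplx) (l m : Cplx) :
  Cseries s l -> Cseries t m -> Cseries (fun i => s i + t i)%C (l + m)%C.
Proof.
  intros H1 H2. apply (Ccv_ext (fun n => Csum n s + Csum n t)%C).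
  - intros n. now rewrite Csum_add.
  - now apply Ccv_add.
Qed.

Lemma Cseries_scal (c : Cplx) (s : nat -> Cplx) (l : Cplx) :
  Cseries s l -> Cseries (fun i => c * s i)%C (c * l)%C.
Proof.
  intros H. apply (Ccv_ext (fun n => c * Csum n s)%C).
  - intros n. now rewrite Csum_scal.
  - now apply Ccv_scal.
Qed.

Lemma pairing_lin_l (c : Cplx) (u u' v : nat -> Cplx) :
  expo_type u -> expo_type u' -> entire_type v ->
  pairing (fun i => u i + c * u' i)%C v = (pairing u v + c * pairing u' v)%C.
Proof.
  intros Hu Hu' Hv. apply csum_eq.
  apply (Cseries_ext (fun i => pterm u v i + c * pterm u' v i)%C).
  - intros i. unfold pterm. ring.
  - apply Cseries_add; [|apply Cseries_scal]; now apply pairing_series.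
Qed.

Lemma pairing_lin_r (c : Cplx) (u v v' : nat -> Cplx) :
  expo_type u -> entire_type v -> entire_type v' ->
  pairing u (fun i => v i + c * v' i)%C = (pairing u v + c * pairing u v')%C.
Proof.
  intros Hu Hv Hv'. apply csum_eq.
  apply (Cseries_ext (fun i => pterm u v i + c * pterm u v' i)%C).
  - intros i. unfold pterm. ring.
  - apply Cseries_add; [|apply Cseries_scal]; now apply pairing_series.
Qed.

Lemma expo_type_lin (c : Cplx) (u u' : nat -> Cplx) :
  expo_type u -> expo_type u' -> expo_type (fun i => u i + c * u' i)%C.
Proof.
  intros [C [A [HA Hu]]] [C' [A' [HA' Hu']]].
  assert (P := expo_bound_pos _ _ _ Hu). assert (P' := expo_bound_pos _ _ _ Hu').
  assert (Nc := Cnorm_ge0 c).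
  exists (C + Cnorm c * C'), (Rmax A A'). split; [eapply Rlt_le_trans; [exact HA|apply Rmax_l]|].
  intros i. eapply Rle_trans; [apply Cnorm_add|]. rewrite Cnorm_mul.
  specialize (Hu i). specialize (Hu' i).
  assert (A ^ i <= Rmax A A' ^ i) by (apply pow_incr; split; [lra|apply Rmax_l]).
  assert (A' ^ i <= Rmax A A' ^ i) by (apply pow_incr; split; [lra|apply Rmax_r]).
  assert (C * A ^ i <= C * Rmax A A' ^ i) by (now apply Rmult_le_compat_l).
  assert (C' * A' ^ i <= C' * Rmax A A' ^ i) by (now apply Rmult_le_compat_l).
  assert (Cnorm c * Cnorm (u' i) <= Cnorm c * (C' * Rmax A A' ^ i)) by (apply Rmult_le_compat_l; lra).
  lra.
Qed.

Lemma entire_type_lin (c : Cplx) (u u' : nat -> Cplx) :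
  entire_type u -> entire_type u' -> entire_type (fun i => u i + c * u' i)%C.
Proof.
  intros Hu Hu' e He. destruct (Hu e He) as [K HK]. destruct (Hu' e He) as [K' HK'].
  exists (K + Cnorm c * K'). intros i. eapply Rle_trans; [apply Cnorm_add|]. rewrite Cnorm_mul.
  specialize (HK i). specialize (HK' i). assert (Nc := Cnorm_ge0 c).
  assert (Cnorm c * Cnorm (u' i) <= Cnorm c * (K' * e ^ i * factR i)) by (now apply Rmult_le_compat_l).
  lra.
Qed.

Lemma pairing_zero (u : nat -> Cplx) : pairing u (fun _ => Czero) = Czero.
Proof.
  apply csum_eq. apply (Cseries_ext (fun _ => Czero)).
  - intros; unfold pterm; ring.
  - apply (Ccv_ext (fun _ => Czero)); [|apply Ccv_const]. intros m. now rewrite Csum_zero.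
Qed.

Lemma entire_type_ext (u v : nat -> Cplx) : (forall i, u i = v i) -> entire_type u -> entire_type v.
Proof. intros E. now replace v with u by (apply functional_extensionality; auto). Qed.
Lemma expo_type_ext (u v : nat -> Cplx) : (forall i, u i = v i) -> expo_type u -> expo_type v.
Proof. intros E. now replace v with u by (apply functional_extensionality; auto). Qed.

Lemma expo_type_zero : expo_type (fun _ => Czero).
Proof. exists 0, 1. split; [lra|]. intros i. rewrite Cnorm_zero. lra. Qed.

Lemma entire_type_zero : entire_type (fun _ => Czero).
Proof. intros e He. exists 0. intros i. rewrite Cnorm_zero. lra. Qed.

Lemma pow_le_fact_exp (x : R) (i : nat) : 0 <= x -> x ^ i <= factR i * exp x.
Proof.
  intros Hx. assert (F := factR_pos i). unfold exp. destruct (exist_exp x) as [l Hl]; simpl.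
  assert (P : forall j, 0 <= / factR j * x ^ j).
  { intros j. apply Rmult_le_pos; [left; apply Rinv_0_lt_compat, factR_pos|now apply pow_le]. }
  assert (H := sum_incr (fun j => / factR j * x ^ j) i l Hl P).
  assert (H2 : / factR i * x ^ i <= sum_f_R0 (fun j => / factR j * x ^ j) i).
  { destruct i; simpl; [lra|].
    assert (0 <= sum_f_R0 (fun j => / factR j * x ^ j) i) by (apply cond_pos_sum; auto). 
    simpl in *. lra. }
  apply Rmult_le_reg_l with (/ factR i); [now apply Rinv_0_lt_compat|].
  rewrite <- Rmult_assoc, Rinv_l by lra. lra.
Qed.

Lemma expo_type_entire_type (u : nat -> Cplx) : expo_type u -> entire_type u.
Proof.
  intros [C [A [HA Hu]]] e He. assert (HC := expo_bound_pos _ _ _ Hu).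
  exists (C * exp (A * / e)). intros i. eapply Rle_trans; [apply Hu|].
  assert (Ie : 0 < / e) by (now apply Rinv_0_lt_compat).
  assert (H := pow_le_fact_exp (A * / e) i ltac:(nra)).
  replace (A ^ i) with ((A * / e) ^ i * e ^ i).
  - assert (0 < e ^ i) by (now apply pow_lt).
    replace (C * exp (A * / e) * e ^ i * factR i) with (C * ((factR i * exp (A * / e)) * e ^ i)) by ring.
    apply Rmult_le_compat_l; [assumption|]. apply Rmult_le_compat_r; lra.
  - rewrite <- Rpow_mult_distr. f_equal. field. lra.
Qed.

Lemma expo_type_geo (z : Cplx) : expo_type (geo z).
Proof.
  exists 1, (Cnorm z + 1). assert (N := Cnorm_ge0 z). split; [lra|]. intros i.
  unfold geo. rewrite Cnorm_pow, Rmult_1_l. apply pow_incr. lra.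
Qed.

Lemma entire_type_geo (z : Cplx) : entire_type (geo z).
Proof. apply expo_type_entire_type, expo_type_geo. Qed.

(** Binomial coefficients are at most 2^n, by Pascal's rule. This is the cost of differentiating k
    times and explains the doubled e in [fact_bound_shiftn]. *)
Lemma fact_add_le (k i : nat) : (fact (k + i) <= 2 ^ (k + i) * (fact k * fact i))%nat.
Proof.
  assert (H : forall n k i, (k + i = n)%nat -> (fact n <= 2 ^ n * (fact k * fact i))%nat);
    [|now apply H].
  clear. induction n; intros k i E.
  - assert (k = 0%nat) by lia. assert (i = 0%nat) by lia. subst. simpl. lia.
  - destruct k as [|k]; [|destruct i as [|i]].
    + simpl Nat.add in E. subst i. change (fact 0) with 1%nat.
      assert (1 <= 2 ^ S n)%nat by (apply Nat.neq_0_lt_0, Nat.pow_nonzero; lia). nia.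
    + replace (S k) with (S n) by lia. change (fact 0) with 1%nat.
      assert (1 <= 2 ^ S n)%nat by (apply Nat.neq_0_lt_0, Nat.pow_nonzero; lia). nia.
    + assert (H1 := IHn k (S i) ltac:(lia)). assert (H2 := IHn (S k) i ltac:(lia)).
      change (fact (S n)) with (S n * fact n)%nat.
      change (2 ^ S n)%nat with (2 * 2 ^ n)%nat.
      replace (S n) with (S k + S i)%nat by lia.
      assert (E1 : (S k * (fact k * fact (S i)) = fact (S k) * fact (S i))%nat)
        by (change (fact (S k)) with (S k * fact k)%nat; ring).
      assert (E2 : (S i * (fact (S k) * fact i) = fact (S k) * fact (S i))%nat)
        by (change (fact (S i)) with (S i * fact i)%nat; ring).
      rewrite Nat.mul_add_distr_r.
      assert (S k * fact n <= 2 ^ n * (fact (S k) * fact (S i)))%nat by (rewrite <- E1; nia).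
      assert (S i * fact n <= 2 ^ n * (fact (S k) * fact (S i)))%nat by (rewrite <- E2; nia).
      lia.
Qed.

Lemma factR_add_le (k i : nat) : factR (k + i) <= 2 ^ k * factR k * (2 ^ i * factR i).
Proof.
  assert (H := le_INR _ _ (fact_add_le k i)). rewrite !mult_INR, pow_INR, pow_add in H.
  replace (INR 2) with 2 in H by (simpl; ring). lra.
Qed.

Lemma fact_bound_shiftn (K e : R) (k : nat) (v : nat -> Cplx) : 0 < e ->
  fact_bound K e v -> fact_bound (K * (2 * e) ^ k * factR k) (2 * e) (shiftn k v).
Proof.
  intros He H i. assert (HK := fact_bound_pos _ _ _ H). unfold shiftn.
  eapply Rle_trans; [apply H|].
  replace (K * (2 * e) ^ k * factR k * (2 * e) ^ i * factR i)
    with (K * e ^ (k + i) * (2 ^ k * factR k * (2 ^ i * factR i)))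
    by (rewrite !Rpow_mult_distr, pow_add; ring).
  apply Rmult_le_compat_l; [|apply factR_add_le].
  apply Rmult_le_pos; [assumption|]. apply pow_le; lra.
Qed.

Lemma entire_type_shiftn (k : nat) (v : nat -> Cplx) : entire_type v -> entire_type (shiftn k v).
Proof.
  intros H e He. destruct (H (e / 2)) as [K HK]; [lra|].
  assert (B := fact_bound_shiftn K (e / 2) k v ltac:(lra) HK).
  replace (2 * (e / 2)) with e in B by field. eexists; exact B.
Qed.

Lemma expo_type_mulz (u : nat -> Cplx) : expo_type u -> expo_type (mulz u).
Proof.
  intros [C [A [HA Hu]]]. assert (HC := expo_bound_pos _ _ _ Hu).
  exists (C * / A), (2 * A). split; [lra|]. assert (IA : 0 < / A) by (now apply Rinv_0_lt_compat).
  intros [|i].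
  - simpl. rewrite Cnorm_zero. nra.
  - unfold mulz. rewrite Cnorm_mul, Cnorm_RtoC, Rabs_pos_eq by apply pos_INR.
    replace (C * / A * (2 * A) ^ S i) with (2 ^ S i * (C * A ^ i))
      by (rewrite Rpow_mult_distr; simpl; field; lra).
    apply Rmult_le_compat; [apply pos_INR|apply Cnorm_ge0| |apply Hu].
    assert (H : (S i <= 2 ^ S i)%nat) by (apply Nat.lt_le_incl, Nat.pow_gt_lin_r; lia).
    apply le_INR in H. now rewrite pow_INR in H.
Qed.

(** Multiplication by the variable on functionals is adjoint to differentiation of entire
    functions. *)
Lemma pairing_mulz (u v : nat -> Cplx) : expo_type u -> entire_type v ->
  pairing (mulz u) v = pairing u (shiftn 1 v).
Proof.
  intros Hu Hv. apply csum_eq. apply Ccv_shift.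
  apply (Ccv_ext (fun n => Csum n (pterm u (shiftn 1 v)))).
  - intros n. induction n.
    + simpl. unfold pterm, mulz. ring.
    + change (Csum (S (S n)) (pterm (mulz u) v))
        with (Csum (S n) (pterm (mulz u) v) + pterm (mulz u) v (S n))%C.
      rewrite <- IHn. simpl Csum. f_equal. unfold pterm, mulz, shiftn.
      change (1 + n)%nat with (S n).
      assert (F := factR_pos n). assert (F2 := pos_INR n).
      assert (E : RtoC (/ factR n) = (RtoC (/ factR (S n)) * RtoC (INR (S n)))%C).
      { rewrite <- RtoC_mul. f_equal. change (fact (S n)) with (S n * fact n)%nat.
        rewrite mult_INR, S_INR. field. lra. }
      rewrite E. ring.
  - apply pairing_series; [assumption|now apply entire_type_shiftn].
Qed.

Lemma ev_zero (v : nat -> Cplx) : entire_type v -> ev v Czero = v 0%nat.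
Proof.
  intros Hv. apply csum_eq. apply Ccv_shift. apply (Ccv_ext (fun _ => v 0%nat)); [|apply Ccv_const].
  intros n. rewrite (Csum_single (S n) 0).
  - unfold pterm, geo. simpl. rewrite Rinv_1. change (RtoC 1) with Cone. ring.
  - lia.
  - intros i _ Hi. unfold pterm, geo. destruct i; [lia|]. simpl. ring.
Qed.

(** The remainder R_i satisfies R_(i+1) = (z + h) R_i + h^2 (i z^(i-1)). Both terms are at most r (2
    r)^i |h|^2, and together they give the base 2 r. *)
Lemma geo_second_difference (z h : Cplx) (r : R) (i : nat) : 1 <= r -> Cnorm (z + h) <= r -> Cnorm z <= r ->
  Cnorm (geo (z + h) i - geo z i - h * mulz (geo z) i)%C
    <= Cnorm h * Cnorm h * (2 * r) ^ i.
Proof.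
  intros Hr1 Hzh Hz. unfold geo. assert (Nh := Cnorm_ge0 h).
  induction i.
  - simpl. replace (Cone - Cone - h * Czero)%C with Czero by ring. rewrite Cnorm_zero. nra.
  - replace (Cpow (z + h) (S i) - Cpow z (S i) - h * mulz (Cpow z) (S i))%C
      with ((z + h) * (Cpow (z + h) i - Cpow z i - h * mulz (Cpow z) i)
            + h * h * mulz (Cpow z) i)%C.
    + eapply Rle_trans; [apply Cnorm_add|]. rewrite !Cnorm_mul.
      assert (M : Cnorm (mulz (Cpow z) i) <= 2 ^ i * r ^ S i).
      { destruct i; simpl.
        - rewrite Cnorm_zero. lra.
        - rewrite Cnorm_mul, Cnorm_RtoC, Cnorm_pow.
          rewrite Rabs_pos_eq by apply (pos_INR (S i)).
          apply Rmult_le_compat; [apply (pos_INR (S i))|apply pow_le, Cnorm_ge0| |].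
          + assert (H : (S i <= 2 ^ S i)%nat) by (apply Nat.lt_le_incl, Nat.pow_gt_lin_r; lia).
            apply le_INR in H. now rewrite pow_INR in H.
          + assert (Cnorm z ^ i <= r ^ i) by (apply pow_incr; split; [apply Cnorm_ge0|assumption]).
            assert (0 <= r ^ i) by (apply pow_le; lra).
            assert (r ^ i <= r * r ^ i) by nra. nra. }
      assert (T1 : Cnorm (z + h) * Cnorm (Cpow (z + h) i - Cpow z i - h * mulz (Cpow z) i)%C
         <= r * (Cnorm h * Cnorm h * (2 * r) ^ i)).
      { apply Rmult_le_compat; auto using Cnorm_ge0. }
      assert (T2 : Cnorm h * Cnorm h * Cnorm (mulz (Cpow z) i) <= Cnorm h * Cnorm h * (2 ^ i * r ^ S i)).
      { apply Rmult_le_compat_l; [nra|assumption]. }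
      eapply Rle_trans; [apply Rplus_le_compat; [exact T1|exact T2]|].
      right. rewrite !Rpow_mult_distr. simpl. ring.
    + destruct i.
      * simpl. replace (RtoC 1) with Cone by reflexivity. ring.
      * unfold mulz. rewrite (S_INR (S i)), RtoC_add. change (RtoC 1) with Cone. simpl Cpow. ring.
Qed.

(** Termwise differentiation is read off from one pairing: the first-order remainder of [ev v] pairs
    [v] with the remainders of geometric sequences, which have rate 2 r and size |h|^2. Hence the
    bound on [v] with e = 1 / (4 r). *)
Lemma cdiff_ev (v : nat -> Cplx) (z : Cplx) : entire_type v -> cdiff (ev v) z (ev (shiftn 1 v) z).
Proof.
  intros Hv. set (r := Cnorm z + 1). assert (Nz := Cnorm_ge0 z). assert (Hr : 1 <= r) by (unfold r; lra).
  assert (He0 : 0 < / 4 * / r) by (assert (0 < / r) by (apply Rinv_0_lt_compat; lra); lra).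
  destruct (Hv _ He0) as [K HK]. assert (PK := fact_bound_pos _ _ _ HK).
  intros eps He. exists (Rmin 1 (eps / (2 * K + 1))).
  split; [apply Rmin_pos; [lra|apply Rdiv_lt_0_compat; lra]|]. intros h Hh.
  assert (H1 := Rlt_le_trans _ _ _ Hh (Rmin_l _ _)). assert (H2 := Rlt_le_trans _ _ _ Hh (Rmin_r _ _)).
  assert (E : (ev v (z + h) - ev v z - ev (shiftn 1 v) z * h)%C
    = pairing (fun i => (geo (z + h) i + (- Cone) * geo z i) + (- h) * mulz (geo z) i)%C v).
  { rewrite pairing_lin_l, pairing_lin_l, pairing_mulz; auto using expo_type_geo, expo_type_mulz, expo_type_lin.
    unfold ev. ring. }
  rewrite E.
  assert (B : Cnorm (pairing (fun i => (geo (z + h) i + (- Cone) * geo z i) + (- h) * mulz (geo z) i)%C v)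
     <= 2 * (Cnorm h * Cnorm h * K)).
  { apply (pairing_bound _ (2 * r) K (/ 4 * / r)); [lra|assumption| | |assumption].
    - right. field. lra.
    - intros i.
      replace (geo (z + h) i + - Cone * geo z i + - h * mulz (geo z) i)%C
        with (geo (z + h) i - geo z i - h * mulz (geo z) i)%C by ring.
      apply geo_second_difference; [assumption| |unfold r; lra].
      eapply Rle_trans; [apply Cnorm_add|]. unfold r. lra. }
  eapply Rle_trans; [exact B|].
  apply (Rmult_lt_compat_r (2 * K + 1)) in H2; [|lra].
  unfold Rdiv in H2. rewrite Rmult_assoc, Rinv_l in H2 by lra.
  assert (Nh := Cnorm_ge0 h). nra.
Qed.

Lemma shiftn_shiftn (j k : nat) (v : nat -> Cplx) : shiftn j (shiftn k v) = shiftn (k + j) v.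
Proof. apply functional_extensionality. intros i. unfold shiftn. f_equal. lia. Qed.

Lemma entire_ev (v : nat -> Cplx) : entire_type v -> entire (ev v).
Proof. intros Hv z. eexists. apply Cderiv_cdiff, cdiff_ev, Hv. Qed.

Lemma ev_chain (v : nat -> Cplx) : entire_type v -> deriv_chain (ev v) (fun j => ev (shiftn j v)).
Proof.
  intros Hv. split; [reflexivity|]. intros j z. apply Cderiv_cdiff.
  replace (shiftn (S j) v) with (shiftn 1 (shiftn j v)).
  - now apply cdiff_ev, entire_type_shiftn.
  - rewrite shiftn_shiftn. f_equal. lia.
Qed.

Lemma deriv_chain_unique (f g : Cplx -> Cplx) (D E : nat -> Cplx -> Cplx) : (forall z, f z = g z) ->
  deriv_chain f D -> deriv_chain g E -> forall j z, D j z = E j z.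
Proof.
  intros Hfg [D0 DS] [E0 ES]. induction j; intros z; [now rewrite D0, E0|].
  assert (X : D j = E j) by (apply functional_extensionality; auto).
  apply (cdiff_unique (D j) z); [apply Cderiv_cdiff, DS|]. rewrite X. apply Cderiv_cdiff, ES.
Qed.

(** The last clause, Cauchy's estimate, turns uniform smallness on a disc into smallness of the
    derivative sequence; closedness of the annihilated subspace rests on it. *)
Theorem entire_as_ev (f : Cplx -> Cplx) : entire f ->
  exists v, entire_type v /\ (forall z, f z = ev v z) /\
    forall r B, 0 < r -> (forall z, Cnorm z <= r -> Cnorm (f z) <= B) -> fact_bound (2 * B) (/ r) v.
Proof.
  intros Hf. exists (fun j => RtoC (factR j) * taylor_coef f j)%C.
  assert (W : forall r B, 0 < r -> (forall j, Cnorm (taylor_coef f j) * r ^ j <= B) ->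
    fact_bound B (/ r) (fun j => RtoC (factR j) * taylor_coef f j)%C).
  { intros r B Hr HB j. assert (F := factR_pos j). assert (P : 0 < r ^ j) by (now apply pow_lt).
    rewrite Cnorm_mul, Cnorm_RtoC, Rabs_pos_eq, pow_inv, (Rmult_comm _ (factR j)) by lra.
    apply Rmult_le_compat_l; [lra|]. apply Rmult_le_reg_r with (r ^ j); [assumption|].
    rewrite Rmult_assoc, Rinv_l, Rmult_1_r by lra. apply HB. }
  split; [|split].
  - intros e He. assert (Ie : 0 < / e) by (now apply Rinv_0_lt_compat).
    destruct (taylor_coef_decay f (/ e) Hf Ie) as [K HK]. exists K.
    rewrite <- (Rinv_inv e). now apply W.
  - intros z. symmetry. apply csum_eq.
    apply (Cseries_ext (fun j => taylor_coef f j * Cpow z j)%C); [|now apply entire_power_series].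
    intros i. unfold pterm, geo. assert (F := factR_pos i).
    rewrite RtoC_inv by lra. field. apply RtoC_neq0. lra.
  - intros r B Hr HB. apply W; [assumption|]. intros j. now apply taylor_coef_bound.
Qed.

Theorem ev_injective (v : nat -> Cplx) : entire_type v -> (forall z, ev v z = Czero) ->
  forall i, v i = Czero.
Proof.
  intros Hv H. destruct (Hv 1 ltac:(lra)) as [K HK]. assert (PK := fact_bound_pos _ _ _ HK).
  intros n. induction n as [n IH] using (well_founded_induction Wf_nat.lt_wf).
  apply Cnorm_eq0, Rle_antisym; [|apply Cnorm_ge0]. apply le_epsilon. intros eps He. rewrite Rplus_0_l.
  assert (F := factR_pos n).
  (* At the real point t the terms below n vanish by induction and the tail above n is at most 2 K
     t^(n+1), which leaves |v n| <= 2 K t n! <= eps. *)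
  set (t := Rmin (/ 2) (eps / (2 * K * factR n + 1))).
  assert (PKF : 0 <= K * factR n) by (apply Rmult_le_pos; lra).
  assert (Q : 0 < eps / (2 * K * factR n + 1)) by (apply Rdiv_lt_0_compat; lra).
  assert (Ht : 0 < t) by (apply Rmin_pos; lra).
  assert (T1 : t <= / 2) by apply Rmin_l. assert (T2 : t <= eps / (2 * K * factR n + 1)) by apply Rmin_r.
  assert (Htail : Cnorm (csum (pterm (geo (RtoC t)) v) - Csum (S n) (pterm (geo (RtoC t)) v))
     <= K * t ^ S n * / (1 - t)).
  { apply csum_tail; [lra|]. intros i. unfold pterm, geo.
    rewrite !Cnorm_mul, Cnorm_pow, !Cnorm_RtoC, (Rabs_pos_eq t) by lra.
    assert (Fi := factR_pos i). rewrite Rabs_pos_eq by (left; now apply Rinv_0_lt_compat).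
    specialize (HK i). rewrite pow1 in HK.
    assert (Pi : 0 < t ^ i) by (now apply pow_lt).
    apply Rle_trans with (/ factR i * (t ^ i * (K * 1 * factR i))).
    - apply Rmult_le_compat_l; [left; now apply Rinv_0_lt_compat|]. apply Rmult_le_compat_l; lra.
    - right. field. lra. }
  change (csum (pterm (geo (RtoC t)) v)) with (ev v (RtoC t)) in Htail. rewrite H in Htail.
  rewrite (Csum_single _ n) in Htail; [|lia|].
  - replace (Czero - pterm (geo (RtoC t)) v n)%C with (- pterm (geo (RtoC t)) v n)%C in Htail by ring.
    rewrite Cnorm_opp in Htail. unfold pterm, geo in Htail.
    rewrite !Cnorm_mul, Cnorm_pow, !Cnorm_RtoC, (Rabs_pos_eq t) in Htail by lra.
    rewrite Rabs_pos_eq in Htail by (left; now apply Rinv_0_lt_compat).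
    assert (Pn : 0 < t ^ n) by (now apply pow_lt).
    assert (I1 : / (1 - t) <= 2).
    { rewrite <- (Rinv_inv 2). apply Rinv_le_contravar; lra. }
    assert (B : Cnorm (v n) <= factR n * (K * t * 2)).
    { apply Rmult_le_reg_l with (/ factR n * t ^ n).
      - apply Rmult_lt_0_compat; [now apply Rinv_0_lt_compat|assumption].
      - replace (/ factR n * t ^ n * (factR n * (K * t * 2))) with (K * t ^ S n * 2)
          by (simpl; field; lra).
        rewrite Rmult_assoc. eapply Rle_trans; [exact Htail|].
        apply Rmult_le_compat_l; [|assumption]. apply Rmult_le_pos; [assumption|].
        left; now apply pow_lt. }
    apply (Rmult_le_compat_r (2 * K * factR n + 1)) in T2; [|lra].
    replace (eps / (2 * K * factR n + 1) * (2 * K * factR n + 1)) with eps in T2 by (field; lra). lra.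
  - intros i Hi Hin. unfold pterm. rewrite (IH i) by lia. ring.
Qed.

Lemma ev_lin (c : Cplx) (v v' : nat -> Cplx) (z : Cplx) : entire_type v -> entire_type v' ->
  ev (fun i => v i + c * v' i)%C z = (ev v z + c * ev v' z)%C.
Proof. intros. apply pairing_lin_r; auto using expo_type_geo. Qed.

Lemma ev_inj (v w : nat -> Cplx) : entire_type v -> entire_type w -> (forall z, ev v z = ev w z) ->
  forall i, v i = w i.
Proof.
  intros Hv Hw H i. apply Csub_eq0.
  replace (v i - w i)%C with (v i + (- Cone) * w i)%C by ring.
  apply (ev_injective (fun i => v i + (- Cone) * w i)%C).
  - now apply entire_type_lin.
  - intros z. rewrite ev_lin, H by assumption. ring.
Qed.

Definition translate (z : Cplx) (v : nat -> Cplx) : nat -> Cplx := fun j => ev (shiftn j v) z.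

Lemma cdiff_translate (f : Cplx -> Cplx) (a z l : Cplx) :
  cdiff f (a + z)%C l -> cdiff (fun w => f (a + w)%C) z l.
Proof.
  intros H. apply (cdiff_eq _ _ (l * (Czero + Cone))%C); [|ring].
  apply (cdiff_comp (fun w => a + w)%C f); [|assumption].
  apply cdiff_add; [apply cdiff_const|apply cdiff_id].
Qed.

Lemma entire_translate (f : Cplx -> Cplx) (a : Cplx) : entire f -> entire (fun z => f (a + z)%C).
Proof. intros H. apply (entire_comp (fun z => a + z)%C f); [apply entire_add; [apply entire_const|apply entire_id]|assumption]. Qed.

(** The translate is entire, hence equal to [ev w] for some w, and uniqueness of derivative chains
    identifies w with the derivatives at a. No double series has to be rearranged. *)
Lemma translate_spec (v : nat -> Cplx) (a : Cplx) : entire_type v ->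
  entire_type (translate a v) /\ forall z, ev v (a + z)%C = ev (translate a v) z.
Proof.
  intros Hv.
  destruct (entire_as_ev (fun z => ev v (a + z)%C)) as [w [Hw [Ew _]]].
  { now apply entire_translate, entire_ev. }
  assert (E : translate a v = w); [|now subst].
  apply functional_extensionality. intros j. unfold translate.
  assert (X := deriv_chain_unique (fun z => ev v (a + z)%C) (ev w)
    (fun j z => ev (shiftn j v) (a + z)%C) (fun j => ev (shiftn j w)) Ew).
  specialize (X ltac:(split; [reflexivity|]; intros i z; apply Cderiv_cdiff, cdiff_translate,
     Cderiv_cdiff, (proj2 (ev_chain v Hv)))).
  specialize (X (ev_chain w Hw) j Czero). simpl in X.
  replace (a + Czero)%C with a in X by ring. rewrite X, ev_zero by now apply entire_type_shiftn.
  unfold shiftn. f_equal. lia.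
Qed.

Lemma entire_type_pairing_shiftn (A v : nat -> Cplx) : expo_type A -> entire_type v ->
  entire_type (fun l => pairing A (shiftn l v)).
Proof.
  intros [C [a [Ha HA]]] Hv e He. assert (HC := expo_bound_pos _ _ _ HA).
  assert (Ia : 0 < / a) by (now apply Rinv_0_lt_compat).
  set (e' := Rmin e (/ 2 * / a)). assert (He' : 0 < e') by (apply Rmin_pos; lra).
  destruct (Hv (e' / 2)) as [K HK]; [lra|]. exists (2 * (C * K)). intros l.
  assert (B := fact_bound_shiftn K (e' / 2) l v ltac:(lra) HK).
  replace (2 * (e' / 2)) with e' in B by field.
  assert (PK := fact_bound_pos _ _ _ HK).
  eapply Rle_trans; [apply (pairing_bound C a (K * e' ^ l * factR l) e' A (shiftn l v) Ha He')|]; [|exact HA|exact B|].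
  - apply Rle_trans with (a * (/ 2 * / a)); [apply Rmult_le_compat_l; [lra|apply Rmin_r]|].
    right. field. lra.
  - assert (P : e' ^ l <= e ^ l) by (apply pow_incr; split; [lra|apply Rmin_l]).
    assert (F := factR_pos l).
    replace (2 * (C * (K * e' ^ l * factR l))) with (2 * (C * K) * factR l * e' ^ l) by ring.
    replace (2 * (C * K) * e ^ l * factR l) with (2 * (C * K) * factR l * e ^ l) by ring.
    apply Rmult_le_compat_l; [|assumption]. repeat apply Rmult_le_pos; lra.
Qed.

Lemma pairing_Csum (n : nat) (c : nat -> Cplx) (u : nat -> Cplx) (v : nat -> nat -> Cplx) :
  expo_type u -> (forall j, entire_type (v j)) ->
  entire_type (fun l => Csum n (fun j => c j * v j l)%C) /\
  pairing u (fun l => Csum n (fun j => c j * v j l)%C) = Csum n (fun j => c j * pairing u (v j))%C.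
Proof.
  intros Hu H. induction n; simpl.
  - split; [apply entire_type_zero|]. apply pairing_zero.
  - destruct IHn as [T E]. split; [now apply entire_type_lin|].
    now rewrite pairing_lin_r, E.
Qed.

(** A functional applied to the translates of an entire function is a convolution operator, and its
    derivatives at the origin are obtained by shifting. The interchange of the two series is a
    finite interchange plus a tail bounded by 2^(-n) relative to every derivative order. *)
Lemma pairing_translate (A v : nat -> Cplx) (z : Cplx) : expo_type A -> entire_type v ->
  pairing A (translate z v) = ev (fun l => pairing A (shiftn l v)) z.
Proof.
  intros HAt Hv. destruct (translate_spec v z Hv) as [Ht _].
  apply csum_eq. 
  assert (HAt2 := HAt). destruct HAt2 as [C [a [Ha HA]]]. assert (HC := expo_bound_pos _ _ _ HA).
  (* [b] dominates both the rate of A and |z|. Starting from 1 / (4 b) leaves room for the doubling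
     caused by shifts and still meets the condition of both pairings. *)
  assert (Nz := Cnorm_ge0 z). set (b := a + Cnorm z). assert (Hb : 0 < b) by (unfold b; lra).
  assert (Ib : 0 < / b) by (now apply Rinv_0_lt_compat).
  assert (Eb : b * (/ 2 * / b) = / 2) by (field; lra).
  destruct (Hv (/ 4 * / b)) as [K HK]; [lra|]. assert (PK := fact_bound_pos _ _ _ HK).
  apply (Ccv_squeeze _ _ (4 * (C * K)) (/ 2)); [lra|]. intros n.
  assert (TB : forall l i, Cnorm (pterm A (shiftn l v) i)
      <= (C * (K * (2 * (/ 4 * / b)) ^ l * factR l)) * (/ 2) ^ i).
  { intros l i. apply (pterm_bound _ a _ (2 * (/ 4 * / b))); [assumption|lra| |exact HA|].
    - apply Rle_trans with (b * (/ 2 * / b)); [|lra].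
      replace (2 * (/ 4 * / b)) with (/ 2 * / b) by (field; lra).
      apply Rmult_le_compat_r; [lra|unfold b; lra].
    - apply fact_bound_shiftn; [lra|exact HK]. }
  assert (E : Csum n (pterm A (translate z v)) = ev (fun l => Csum n (pterm A (shiftn l v))) z).
  { destruct (pairing_Csum n (fun j => RtoC (/ factR j) * A j)%C (geo z) (fun j => shiftn j v) (expo_type_geo z)) as [_ X].
    - intros; now apply entire_type_shiftn.
    - transitivity (ev (fun l => Csum n (fun j => (RtoC (/ factR j) * A j) * shiftn j v l)%C) z).
      + unfold ev at 1. rewrite X. apply Csum_ext. intros i _. unfold pterm, translate, ev. ring.
      + f_equal. apply functional_extensionality. intros l. apply Csum_ext. intros i _.
        unfold pterm, shiftn. rewrite (Nat.add_comm l i). ring. }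
  rewrite E.
  assert (T1 : entire_type (fun l => Csum n (pterm A (shiftn l v)))).
  { destruct (pairing_Csum n (fun j => RtoC (/ factR j) * A j)%C (geo z) (fun j => shiftn j v) (expo_type_geo z)) as [X _].
    - intros; now apply entire_type_shiftn.
    - eapply entire_type_ext; [|exact X]. intros l. apply Csum_ext. intros i _.
      unfold pterm, shiftn. rewrite (Nat.add_comm l i). ring. }
  assert (T2 := entire_type_pairing_shiftn A v HAt Hv).
  replace (ev (fun l => Csum n (pterm A (shiftn l v))) z - ev (fun l => pairing A (shiftn l v)) z)%C
    with (ev (fun l => Csum n (pterm A (shiftn l v)) + (- Cone) * pairing A (shiftn l v))%C z)
    by (rewrite ev_lin by assumption; ring).
  replace (4 * (C * K) * (/ 2) ^ n) with (2 * (1 * (2 * (C * K) * (/ 2) ^ n))) by ring.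
  apply (pairing_bound 1 b _ (/ 2 * / b)); [assumption|lra|lra| |].
  - intros i. unfold geo. rewrite Cnorm_pow, Rmult_1_l. apply pow_incr. unfold b. lra.
  - intros l. 
    replace (Csum n (pterm A (shiftn l v)) + - Cone * pairing A (shiftn l v))%C
      with (- (pairing A (shiftn l v) - Csum n (pterm A (shiftn l v))))%C by ring.
    rewrite Cnorm_opp. eapply Rle_trans; [apply csum_tail with (q := / 2); [lra|apply TB]|].
    right. replace (2 * (/ 4 * / b)) with (/ 2 * / b) by (field; lra). field.
Qed.

(** * Interpolation by small vectors *)

Definition Lsum {I : Type} (L : list I) (f : I -> Cplx) : Cplx :=
  fold_right (fun i acc => f i + acc)%C Czero L.

Lemma Lsum_ext {I : Type} (L : list I) (f g : I -> Cplx) :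
  (forall i, In i L -> f i = g i) -> Lsum L f = Lsum L g.
Proof.
  induction L; intros H; simpl; [reflexivity|].
  rewrite H by (now left). rewrite IHL; [reflexivity|]. intros; apply H; now right.
Qed.

Lemma Lsum_add {I : Type} (L : list I) (f g : I -> Cplx) :
  Lsum L (fun i => f i + g i)%C = (Lsum L f + Lsum L g)%C.
Proof. induction L; simpl; [ring|rewrite IHL; ring]. Qed.

Lemma Lsum_scal {I : Type} (L : list I) (c : Cplx) (f : I -> Cplx) :
  Lsum L (fun i => c * f i)%C = (c * Lsum L f)%C.
Proof. induction L; simpl; [ring|rewrite IHL; ring]. Qed.

Lemma Lsum_zero {I : Type} (L : list I) (f : I -> Cplx) :
  (forall i, In i L -> f i = Czero) -> Lsum L f = Czero.
Proof.
  induction L; intros H; simpl; [reflexivity|].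
  rewrite H by (now left). rewrite IHL; [ring|]. intros; apply H; now right.
Qed.

Lemma Lsum_app {I : Type} (L L' : list I) (f : I -> Cplx) :
  Lsum (L ++ L') f = (Lsum L f + Lsum L' f)%C.
Proof. induction L; simpl; [ring|rewrite IHL; ring]. Qed.

Definition update {I : Type} (a : I -> Cplx) (i : I) (c : Cplx) : I -> Cplx :=
  fun k => if excluded_middle_informative (k = i) then c else a k.

Lemma Lsum_update {I : Type} (L : list I) (a : I -> Cplx) (i : I) (c : Cplx) (f : I -> Cplx) :
  ~ In i L -> Lsum (i :: L) (fun k => update a i c k * f k)%C
    = (c * f i + Lsum L (fun k => a k * f k))%C.
Proof.
  intros Hi. simpl. f_equal.
  - unfold update. destruct (excluded_middle_informative (i = i)); congruence.
  - apply Lsum_ext. intros k Hk. unfold update.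
    destruct (excluded_middle_informative (k = i)); [subst; contradiction|reflexivity].
Qed.

Section FunctionalAlternative.
Variables (E I : Type) (zero : E) (add : E -> E -> E) (scal : Cplx -> E -> E).

(** No vector space axioms are imposed on [E]: lists of terms under concatenation, to which this is
    applied, have no additive inverses. The arguments only look at values of functionals and of the
    seminorm. *)
Definition linear_fun (h : E -> Cplx) : Prop :=
  h zero = Czero /\ (forall x y, h (add x y) = h x + h y)%C /\ (forall c x, h (scal c x) = c * h x)%C.
Definition seminorm (p : E -> R) : Prop :=
  p zero = 0 /\ (forall x, 0 <= p x) /\ (forall x y, p (add x y) <= p x + p y) /\
  (forall c x, p (scal c x) <= Cnorm c * p x).
Definition subspace (D : E -> Prop) : Prop :=
  D zero /\ (forall x y, D x -> D y -> D (add x y)) /\ (forall c x, D x -> D (scal c x)).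
Definition dominated_on (D : E -> Prop) (p : E -> R) (h : E -> Cplx) : Prop :=
  exists C, 0 <= C /\ forall x, D x -> Cnorm (h x) <= C * p x.

Variable (p : E -> R).
Hypothesis (Hp : seminorm p).

Let p_zero := proj1 Hp.
Let p_pos := proj1 (proj2 Hp).
Let p_add := proj1 (proj2 (proj2 Hp)).
Let p_scal := proj2 (proj2 (proj2 Hp)).

(** Failure of domination with constant 1 / eps provides a vector whose value exceeds its seminorm
    divided by eps; dividing by the value normalizes it. *)
Lemma small_normalized (D : E -> Prop) (e : E -> Cplx) (eps : R) : subspace D -> linear_fun e ->
  ~ dominated_on D p e -> 0 < eps -> exists v, D v /\ e v = Cone /\ p v < eps.
Proof.
  intros [_ [_ DS]] [_ [_ eS]] Hno He.
  assert (Ie : 0 < / eps) by (now apply Rinv_0_lt_compat).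
  destruct (classic (exists x, D x /\ / eps * p x < Cnorm (e x))) as [[x [Dx Hx]]|Hn].
  - assert (P := p_pos x). assert (Pe : 0 < Cnorm (e x)) by nra.
    assert (Nx := Cnorm_gt0_neq _ Pe).
    exists (scal (Cinv (e x)) x). split; [auto|]. split.
    + rewrite eS. field. exact Nx.
    + eapply Rle_lt_trans; [apply p_scal|]. rewrite Cnorm_inv by assumption.
      apply Rmult_lt_reg_l with (/ eps * Cnorm (e x)); [nra|].
      replace (/ eps * Cnorm (e x) * (/ Cnorm (e x) * p x)) with (/ eps * p x) by (field; lra).
      replace (/ eps * Cnorm (e x) * eps) with (Cnorm (e x)) by (field; lra). assumption.
  - exfalso. apply Hno. exists (/ eps). split; [lra|]. intros x Dx.
    apply Rnot_lt_le. intros H. apply Hn. now exists x.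
Qed.

(* A functional dominated by [p] on a hyperplane is, up to a multiple of the functional
   defining it, dominated everywhere: the multiple is the value at a normalized vector, or
   its limit along normalized vectors that are small for [p]. *)
Lemma dominated_hyperplane (D : E -> Prop) (h e : E -> Cplx) :
  subspace D -> linear_fun h -> linear_fun e ->
  dominated_on (fun x => D x /\ e x = Czero) p h ->
  exists a, dominated_on D p (fun x => h x + a * e x)%C.
Proof.
  intros HD Hh He [C [HC Hdom]]. assert (HD' := HD). destruct HD' as [D0 [DA DS]].
  assert (Hh' := Hh). destruct Hh' as [h0 [hA hS]]. assert (He' := He). destruct He' as [e0 [eA eS]].
  assert (key : forall v x, D v -> e v = Cone -> D x ->
     Cnorm (h x + - h v * e x)%C <= C * (p x + Cnorm (e x) * p v)).
  { intros v x Dv Ev Dx.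
    replace (h x + - h v * e x)%C with (h (add x (scal (- e x)%C v))) by (rewrite hA, hS; ring).
    eapply Rle_trans; [apply Hdom|].
    - split; [auto|]. rewrite eA, eS, Ev. ring.
    - apply Rmult_le_compat_l; [assumption|]. eapply Rle_trans; [apply p_add|].
      apply Rplus_le_compat_l. eapply Rle_trans; [apply p_scal|]. rewrite Cnorm_opp. lra. }
  destruct (classic (dominated_on D p e)) as [[B [HB Hb]]|Hno].
  - destruct (classic (exists v, D v /\ e v <> Czero)) as [[v [Dv Nv]]|Hz].
    + set (w := scal (Cinv (e v)) v).
      assert (Ew : e w = Cone) by (unfold w; rewrite eS; field; exact Nv).
      assert (Dw : D w) by (unfold w; auto).
      exists (- h w)%C, (C * (1 + B * p w)). assert (Pw := p_pos w).
      split; [apply Rmult_le_pos; [assumption|]; nra|]. intros x Dx.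
      eapply Rle_trans; [apply key; assumption|]. specialize (Hb x Dx).
      rewrite Rmult_assoc. apply Rmult_le_compat_l; [assumption|].
      assert (Cnorm (e x) * p w <= B * p x * p w) by (apply Rmult_le_compat_r; assumption). lra.
    + exists Czero, C. split; [assumption|]. intros x Dx.
      replace (h x + Czero * e x)%C with (h x) by ring. apply Hdom. split; [assumption|].
      apply NNPP. intros N. apply Hz. now exists x.
  - assert (V : forall n : nat, {v | D v /\ e v = Cone /\ p v < / INR (S n)}).
    { intros n. apply constructive_indefinite_description. apply small_normalized; auto.
      apply Rinv_0_lt_compat, lt_0_INR. lia. }
    set (v := fun n => proj1_sig (V n)).
    assert (Hv : forall n, D (v n) /\ e (v n) = Cone /\ p (v n) < / INR (S n))
      by (intros n; apply (proj2_sig (V n))).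
    assert (small : forall eps, 0 < eps -> exists N, forall n, (N <= n)%nat -> p (v n) < eps).
    { intros eps Heps. destruct (archimed_cor1 eps Heps) as [N [HN PN]]. exists N. intros n Hn.
      destruct (Hv n) as [_ [_ H]]. eapply Rlt_trans; [exact H|].
      eapply Rle_lt_trans; [|exact HN]. apply Rinv_le_contravar; [now apply lt_0_INR|].
      apply le_INR. lia. }
    destruct (C_complete (fun n => h (v n))) as [l Hl].
    { intros eps Heps. destruct (small (eps / (2 * (C + 1)))) as [N HN];
        [apply Rdiv_lt_0_compat; lra|].
      exists N. intros n m Hn Hm. destruct (Hv n) as [Dn [En _]]. destruct (Hv m) as [Dm [Em _]].
      assert (K := key (v m) (v n) Dm Em Dn). rewrite En, Cnorm_one in K.
      replace (h (v n) - h (v m))%C with (h (v n) + - h (v m) * Cone)%C by ring.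
      eapply Rle_lt_trans; [exact K|]. assert (A1 := HN n Hn). assert (A2 := HN m Hm).
      assert (Q : p (v n) + 1 * p (v m) < eps / (C + 1)).
      { replace (eps / (C + 1)) with (eps / (2 * (C + 1)) + eps / (2 * (C + 1))) by (field; lra). lra. }
      assert (P1 := p_pos (v n)). assert (P2 := p_pos (v m)).
      apply Rle_lt_trans with ((C + 1) * (p (v n) + 1 * p (v m)) - (p (v n) + 1 * p (v m))); [lra|].
      apply (Rmult_lt_compat_l (C + 1)) in Q; [|lra].
      replace ((C + 1) * (eps / (C + 1))) with eps in Q by (field; lra). lra. }
    exists (- l)%C, C. split; [assumption|]. intros x Dx. apply le_epsilon. intros eps Heps.
    assert (Nx := Cnorm_ge0 (e x)).
    destruct (small (eps / (2 * (C * Cnorm (e x) + 1)))) as [N1 H1];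
      [apply Rdiv_lt_0_compat; nra|].
    destruct (Hl (eps / (2 * (Cnorm (e x) + 1)))) as [N2 H2]; [apply Rdiv_lt_0_compat; lra|].
    specialize (H1 (Nat.max N1 N2) ltac:(lia)). specialize (H2 (Nat.max N1 N2) ltac:(lia)).
    set (n := Nat.max N1 N2) in *. destruct (Hv n) as [Dn [En _]].
    replace (h x + - l * e x)%C with ((h x + - h (v n) * e x) + (h (v n) - l) * e x)%C by ring.
    eapply Rle_trans; [apply Cnorm_add|]. rewrite Cnorm_mul.
    assert (K := key (v n) x Dn En Dx).
    assert (Q1 : C * Cnorm (e x) * p (v n) <= eps / 2).
    { assert (P := p_pos (v n)). apply Rle_trans with ((C * Cnorm (e x) + 1) * p (v n)); [lra|].
      apply Rlt_le in H1. apply (Rmult_le_compat_l (C * Cnorm (e x) + 1)) in H1; [|nra].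
      replace ((C * Cnorm (e x) + 1) * (eps / (2 * (C * Cnorm (e x) + 1)))) with (eps / 2) in H1
        by (field; nra). lra. }
    assert (Q2 : Cnorm (h (v n) - l)%C * Cnorm (e x) <= eps / 2).
    { assert (P := Cnorm_ge0 (h (v n) - l)%C).
      apply Rle_trans with (Cnorm (h (v n) - l)%C * (Cnorm (e x) + 1)); [nra|].
      apply Rlt_le in H2. apply (Rmult_le_compat_r (Cnorm (e x) + 1)) in H2; [|lra].
      replace (eps / (2 * (Cnorm (e x) + 1)) * (Cnorm (e x) + 1)) with (eps / 2) in H2
        by (field; lra). lra. }
    lra.
Qed.

Variable (e : I -> E -> Cplx).
Hypothesis (He : forall i, linear_fun (e i)).

Definition kernel_of (L : list I) (x : E) : Prop := forall i, In i L -> e i x = Czero.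

Lemma linear_comb (L : list I) (a : I -> Cplx) (h : E -> Cplx) : linear_fun h ->
  linear_fun (fun x => h x + Lsum L (fun i => a i * e i x))%C.
Proof.
  intros [h0 [hA hS]]. split; [|split].
  - rewrite h0, Lsum_zero; [ring|]. intros i _. rewrite (proj1 (He i)). ring.
  - intros x y. rewrite hA, (Lsum_ext _ _ (fun i => a i * e i x + a i * e i y)%C), Lsum_add; [ring|].
    intros i _. rewrite (proj1 (proj2 (He i))). ring.
  - intros c x. rewrite hS, (Lsum_ext _ _ (fun i => c * (a i * e i x))%C), Lsum_scal; [ring|].
    intros i _. rewrite (proj2 (proj2 (He i))). ring.
Qed.

(** The constraints are released one hyperplane at a time. The subspace D is general so that the
    remaining constraints can be released inside the kernel of the current one. *)
Lemma dominated_kernel (L : list I) (D : E -> Prop) (h : E -> Cplx) : NoDup L ->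
  subspace D -> linear_fun h -> dominated_on (fun x => D x /\ kernel_of L x) p h ->
  exists a, dominated_on D p (fun x => h x + Lsum L (fun i => a i * e i x))%C.
Proof.
  revert D. induction L as [|i L IH]; intros D ND HD Hh [C [HC Hdom]].
  - exists (fun _ => Czero), C. split; [assumption|]. intros x Dx. simpl.
    replace (h x + Czero)%C with (h x) by ring. apply Hdom. split; [assumption|]. intros j [].
  - inversion ND as [|? ? Hi NDL]; subst. destruct HD as [D0 [DA DS]]. destruct (He i) as [e0 [eA eS]].
    destruct (IH (fun x => D x /\ e i x = Czero) NDL) as [a Ha].
    + split; [auto|]. split.
      * intros x y [Dx Ex] [Dy Ey]. split; [auto|]. rewrite eA, Ex, Ey. ring.
      * intros c x [Dx Ex]. split; [auto|]. rewrite eS, Ex. ring.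
    + assumption.
    + exists C. split; [assumption|]. intros x [[Dx Ex] Kx]. apply Hdom. split; [assumption|].
      intros j [->|Hj]; auto.
    + destruct (dominated_hyperplane D _ (e i) (conj D0 (conj DA DS)) (linear_comb L a h Hh) (He i) Ha)
        as [c [C2 [HC2 H2]]].
      exists (update a i c), C2. split; [assumption|]. intros x Dx.
      rewrite (Lsum_update L a i c (fun k => e k x) Hi).
      replace (h x + (c * e i x + Lsum L (fun k => a k * e k x)))%C
        with (h x + Lsum L (fun i0 => a i0 * e i0 x) + c * e i x)%C by ring. auto.
Qed.

(** Induction on the equations, as a finite substitute for Hahn-Banach. A functional not dominated
    on the kernel of the others is adjusted by vectors of small seminorm. A dominated one becomes
    dominated everywhere after adding a combination of the others: if the data violate this
    relation, it is the obstruction; otherwise the residual of a small solution is itself small. *)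
Theorem interpolation_alternative (L : list I) (y : I -> Cplx) : NoDup L ->
  (forall eps, 0 < eps -> exists x, (forall i, In i L -> e i x = y i) /\ p x < eps) \/
  (exists a, dominated_on (fun _ => True) p (fun x => Lsum L (fun i => a i * e i x)%C) /\
             Lsum L (fun i => a i * y i)%C <> Czero).
Proof.
  intros ND. induction L as [|i L IH].
  - left. intros eps Heps. exists zero. split; [intros i []|]. now rewrite p_zero.
  - inversion ND as [|? ? Hi NDL]; subst. destruct (He i) as [e0 [eA eS]].
    destruct (IH NDL) as [A1|[a [[C [HC Ha]] Hy]]].
    2:{ right. exists (update a i Czero). split.
        - exists C. split; [assumption|]. intros x Dx. 
          rewrite (Lsum_update L a i Czero (fun k => e k x) Hi).
          replace (Czero * e i x + Lsum L (fun k => a k * e k x))%C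
            with (Lsum L (fun k => a k * e k x)%C) by ring. auto.
        - rewrite (Lsum_update L a i Czero y Hi).
          replace (Czero * y i + Lsum L (fun k => a k * y k))%C
            with (Lsum L (fun k => a k * y k)%C) by ring. auto. }
    assert (KS : subspace (kernel_of L)).
    { split; [|split].
      - intros j _. apply He.
      - intros x z Hx Hz j Hj. rewrite (proj1 (proj2 (He j))), Hx, Hz by assumption. ring.
      - intros c x Hx j Hj. rewrite (proj2 (proj2 (He j))), Hx by assumption. ring. }
    assert (correct : forall x w, (forall j, In j L -> e j x = y j) -> kernel_of L w -> e i w = Cone ->
      (forall j, In j (i :: L) -> e j (add x (scal (y i - e i x)%C w)) = y j) /\
      p (add x (scal (y i - e i x)%C w)) <= p x + Cnorm (y i - e i x) * p w).
    { intros x w Hx Kw Ew. split.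
      - intros j Hj. rewrite (proj1 (proj2 (He j))), (proj2 (proj2 (He j))). destruct Hj as [->|Hj].
        + rewrite Ew. ring.
        + rewrite Hx, (Kw j) by assumption. ring.
      - eapply Rle_trans; [apply p_add|]. apply Rplus_le_compat_l, p_scal. }
    destruct (classic (dominated_on (kernel_of L) p (e i))) as [Hb|Hu].
    + destruct (dominated_kernel L (fun _ => True) (e i) NDL) as [a [C [HC Ha]]].
      { repeat split. }
      { apply He. }
      { destruct Hb as [C [HC H]]. exists C. split; [assumption|]. intros x [_ Kx]. auto. }
      destruct (classic (y i + Lsum L (fun k => a k * y k) = Czero)%C) as [Es|Ns].
      * left. 
        assert (near : forall x, (forall j, In j L -> e j x = y j) -> Cnorm (y i - e i x) <= C * p x).
        { intros x Hx. specialize (Ha x Logic.I).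
          rewrite (Lsum_ext _ _ (fun k => a k * y k)%C) in Ha by (intros k Hk; now rewrite Hx).
          rewrite Cnorm_sub_sym.
          replace (e i x - y i)%C with (e i x + Lsum L (fun k => a k * y k)
             - (y i + Lsum L (fun k => a k * y k)))%C by ring.
          rewrite Es. now replace (e i x + Lsum L (fun k => a k * y k) - Czero)%C
            with (e i x + Lsum L (fun k => a k * y k))%C by ring. }
        intros eps Heps.
        destruct (classic (exists w, kernel_of L w /\ e i w <> Czero)) as [[w0 [Kw0 Nw0]]|Hz].
        -- set (w := scal (Cinv (e i w0)) w0).
           assert (Kw : kernel_of L w) by (apply KS; assumption).
           assert (Ew : e i w = Cone) by (unfold w; rewrite eS; field; exact Nw0).
           assert (Pw := p_pos w).
           assert (PC : 0 <= C * p w) by (now apply Rmult_le_pos).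
           destruct (A1 (eps / (1 + C * p w))) as [x [Hx Px]]; [apply Rdiv_lt_0_compat; lra|].
           destruct (correct x w Hx Kw Ew) as [S1 S2].
           exists (add x (scal (y i - e i x)%C w)). split; [exact S1|].
           eapply Rle_lt_trans; [exact S2|].
           apply Rle_lt_trans with ((1 + C * p w) * p x).
           ++ assert (T : Cnorm (y i - e i x) * p w <= C * p x * p w)
                by (apply Rmult_le_compat_r; auto). lra.
           ++ apply (Rmult_lt_compat_l (1 + C * p w)) in Px; [|lra].
              replace ((1 + C * p w) * (eps / (1 + C * p w))) with eps in Px by (field; lra). lra.
        (* Here the new functional vanishes on the kernel of the others, so its value is common to
           all their solutions. Comparison with solutions of arbitrarily small seminorm forces this
           value to be the prescribed one. *)
        -- destruct (A1 eps Heps) as [x [Hx Px]]. exists x. split; [|assumption].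
           intros j [->|Hj]; [|auto]. symmetry. apply Csub_eq0, Cnorm_eq0, Rle_antisym; [|apply Cnorm_ge0].
           apply le_epsilon. intros d Hd. rewrite Rplus_0_l.
           destruct (A1 (d / (C + 1))) as [x2 [Hx2 Px2]]; [apply Rdiv_lt_0_compat; lra|].
           assert (Ex : e j (add x (scal (- Cone)%C x2)) = Czero).
           { apply NNPP. intros N. apply Hz. exists (add x (scal (- Cone)%C x2)). split; [|assumption].
             intros k Hk. rewrite (proj1 (proj2 (He k))), (proj2 (proj2 (He k))), Hx, Hx2 by assumption.
             ring. }
           rewrite eA, eS in Ex.
           replace (y j - e j x)%C with (y j - e j x2 - (e j x + - Cone * e j x2))%C by ring.
           rewrite Ex. replace (y j - e j x2 - Czero)%C with (y j - e j x2)%C by ring.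
           eapply Rle_trans; [apply near; assumption|].
           apply (Rmult_lt_compat_l (C + 1)) in Px2; [|lra].
           replace ((C + 1) * (d / (C + 1))) with d in Px2 by (field; lra).
           assert (P2 := p_pos x2). lra.
      * right. exists (update a i Cone). split.
        -- exists C. split; [assumption|]. intros x _.
           rewrite (Lsum_update L a i Cone (fun k => e k x) Hi).
           replace (Cone * e i x)%C with (e i x) by ring. now apply Ha.
        -- rewrite (Lsum_update L a i Cone y Hi).
           now replace (Cone * y i)%C with (y i) by ring.
    + left. intros eps Heps. destruct (A1 (eps / 2)) as [x [Hx Px]]; [lra|].
      assert (Nd := Cnorm_ge0 (y i - e i x)).
      destruct (small_normalized (kernel_of L) (e i) (eps / (2 * (Cnorm (y i - e i x) + 1))) KS (He i) Hu)
        as [w [Kw [Ew Pw]]]; [apply Rdiv_lt_0_compat; lra|].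
      destruct (correct x w Hx Kw Ew) as [S1 S2].
      exists (add x (scal (y i - e i x)%C w)). split; [exact S1|].
      eapply Rle_lt_trans; [exact S2|]. assert (P := p_pos w).
      apply (Rmult_lt_compat_l (Cnorm (y i - e i x) + 1)) in Pw; [|lra].
      replace ((Cnorm (y i - e i x) + 1) * (eps / (2 * (Cnorm (y i - e i x) + 1))))
        with (eps / 2) in Pw by (field; lra). lra.
Qed.

End FunctionalAlternative.
Arguments interpolation_alternative {E I}.

(** * Exponents of quasi-polynomials bounded on a sequence *)

Definition quasi (mu : nat -> Cplx) (m : nat -> nat) (N : nat) (a : nat -> nat -> Cplx) (z : Cplx) : Cplx :=
  Csum N (fun k => Csum (m k) (fun j => a k j * (Cpow z j * Cexp (mu k * z)))%C).

(** The highest non-zero term is eventually at least twice the rest; in degree zero the constant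
    itself is the bound. *)
Lemma polynomial_lower_bound (m : nat) (a : nat -> Cplx) :
  (exists j, (j < m)%nat /\ a j <> Czero) ->
  exists d A, 0 < d /\ forall z, A <= Cnorm z -> d <= Cnorm (Csum m (fun j => a j * Cpow z j)%C).
Proof.
  induction m; intros [j [Hj Haj]]; [lia|].
  destruct (classic (a m = Czero)) as [E|N].
  - destruct IHm as [d [A [Hd H]]].
    + exists j. split; [|assumption]. assert (j <> m) by congruence. lia.
    + exists d, A. split; [assumption|]. intros z Hz. simpl. rewrite E.
      replace (Csum m (fun j => a j * Cpow z j) + Czero * Cpow z m)%C
        with (Csum m (fun j => a j * Cpow z j)%C) by ring. auto.
  - assert (Pa := Cnorm_pos _ N). destruct m as [|m].
    + exists (Cnorm (a 0%nat)), 0. split; [assumption|]. intros z _. simpl.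
      replace (Czero + a 0%nat * Cone)%C with (a 0%nat) by ring. lra.
    + set (total := Rsum (S m) (fun j => Cnorm (a j))).
      assert (Htotal : 0 <= total).
      { unfold total. clear. induction (S m); simpl; [lra|].
        assert (P := Cnorm_ge0 (a n)). lra. }
      set (b := Cnorm (a (S m))) in *.
      exists (b / 2), (Rmax 1 (2 * total / b)). split; [lra|]. intros z Hz.
      assert (Z1 := Rle_trans _ _ _ (Rmax_l _ _) Hz). assert (Z2 := Rle_trans _ _ _ (Rmax_r _ _) Hz).
      set (T := Csum (S m) (fun j => a j * Cpow z j)%C).
      assert (HT : Cnorm T <= total * Cnorm z ^ m).
      { unfold T, total. rewrite Rmult_comm, <- Rsum_scal.
        apply Csum_norm_le. intros i Hi. rewrite Cnorm_mul, Cnorm_pow, Rmult_comm.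
        apply Rmult_le_compat_r; [apply Cnorm_ge0|]. apply Rle_pow; [assumption|lia]. }
      change (Csum (S (S m)) (fun j => a j * Cpow z j)%C)
        with (T + a (S m) * Cpow z (S m))%C.
      replace (T + a (S m) * Cpow z (S m))%C
        with (a (S m) * Cpow z (S m) - - T)%C by ring.
      eapply Rle_trans; [|apply Cnorm_sub_ge]. rewrite Cnorm_opp, Cnorm_mul, Cnorm_pow. fold b.
      assert (P1 : 1 <= Cnorm z ^ m) by (now apply pow_R1_Rle).
      assert (Q : 2 * total <= b * Cnorm z).
      { apply (Rmult_le_compat_l b) in Z2; [|lra].
        replace (b * (2 * total / b)) with (2 * total) in Z2 by (field; lra). lra. }
      simpl pow. nra.
Qed.

Lemma finite_maximum (N : nat) (Q : nat -> Prop) (f : nat -> R) :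
  (exists k, (k < N)%nat /\ Q k) ->
  exists k, (k < N)%nat /\ Q k /\ forall k', (k' < N)%nat -> Q k' -> f k' <= f k.
Proof.
  induction N; intros [k [Hk Qk]]; [lia|].
  destruct (classic (exists k, (k < N)%nat /\ Q k)) as [H|H].
  - destruct (IHN H) as [k1 [Hk1 [Qk1 M]]].
    destruct (classic (Q N /\ f k1 < f N)) as [[QN Hlt]|Hn].
    + exists N. split; [lia|]. split; [assumption|]. intros k' Hk' Qk'.
      destruct (Nat.eq_dec k' N) as [->|D]; [lra|]. specialize (M k' ltac:(lia) Qk'). lra.
    + exists k1. split; [lia|]. split; [assumption|]. intros k' Hk' Qk'.
      destruct (Nat.eq_dec k' N) as [->|D]; [|apply M; [lia|assumption]].
      apply Rnot_lt_le. intros L. apply Hn. auto.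
  - assert (k = N). { destruct (Nat.eq_dec k N); [assumption|]. exfalso. apply H. exists k. split; [lia|assumption]. }
    subst. exists N. split; [lia|]. split; [assumption|]. intros k' Hk' Qk'.
    destruct (Nat.eq_dec k' N) as [->|D]; [lra|]. exfalso. apply H. exists k'. split; [lia|assumption].
Qed.

Lemma finite_gap (N : nat) (Q : nat -> Prop) (f : nat -> R) (c : R) :
  (forall k, (k < N)%nat -> Q k -> f k < c) ->
  exists d, 0 < d /\ forall k, (k < N)%nat -> Q k -> f k <= c - d.
Proof.
  induction N; intros H.
  - exists 1. split; [lra|]. intros; lia.
  - destruct IHN as [d [Hd HN]]; [intros; apply H; auto|].
    destruct (classic (Q N)) as [QN|QN].
    + assert (HfN := H N ltac:(lia) QN). exists (Rmin d (c - f N)). split; [apply Rmin_pos; lra|].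
      intros k Hk Qk. destruct (Nat.eq_dec k N) as [->|D].
      * assert (B := Rmin_r d (c - f N)). lra.
      * specialize (HN k ltac:(lia) Qk). assert (B := Rmin_l d (c - f N)). lra.
    + exists d. split; [assumption|]. intros k Hk Qk. destruct (Nat.eq_dec k N) as [->|D]; [contradiction|].
      apply HN; [lia|assumption].
Qed.

Lemma Csum_extract (n k : nat) (u : nat -> Cplx) : (k < n)%nat ->
  Csum n u = (u k + Csum n (fun i => if Nat.eq_dec i k then Czero else u i))%C.
Proof.
  intros Hk.
  assert (E : u k = Csum n (fun i => if Nat.eq_dec i k then u i else Czero)).
  { rewrite (Csum_single n k); [|assumption|].
    - destruct (Nat.eq_dec k k); congruence.
    - intros i _ Hi. destruct (Nat.eq_dec i k); congruence. }
  rewrite E, <- Csum_add. apply Csum_ext. intros i _. destruct (Nat.eq_dec i k); ring.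
Qed.

(** The power z^j is absorbed in exp(eta |z|) at the price j! eta^(-j). Leaving w free makes K
    independent of the exponent. *)
Lemma quasi_block_bound (m : nat) (a : nat -> Cplx) (eta : R) : 0 < eta ->
  exists K, 0 <= K /\ forall (z w : Cplx),
    Cnorm (Csum m (fun j => a j * (Cpow z j * Cexp w))%C) <= K * exp (eta * Cnorm z + fst w).
Proof.
  intros Heta. assert (Ie : 0 < / eta) by (now apply Rinv_0_lt_compat).
  exists (Rsum m (fun j => Cnorm (a j) * (factR j * (/ eta) ^ j))). split.
  - induction m; simpl; [lra|].
    assert (0 <= Cnorm (a m) * (factR m * (/ eta) ^ m)); [|lra].
    assert (F := factR_pos m). assert (0 <= (/ eta) ^ m) by (apply pow_le; lra).
    apply Rmult_le_pos; [apply Cnorm_ge0|]. apply Rmult_le_pos; lra.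
  - intros z w. rewrite Rmult_comm, <- Rsum_scal. apply Csum_norm_le. intros j _.
    rewrite !Cnorm_mul, Cnorm_pow, Cnorm_Cexp, exp_plus. assert (Nz := Cnorm_ge0 z).
    assert (H := pow_le_fact_exp (eta * Cnorm z) j ltac:(nra)).
    assert (Ex := exp_pos (fst w)). assert (P : 0 < (/ eta) ^ j) by (now apply pow_lt).
    assert (E : Cnorm z ^ j = (/ eta) ^ j * (eta * Cnorm z) ^ j).
    { rewrite <- Rpow_mult_distr. f_equal. field. lra. }
    replace (exp (eta * Cnorm z) * exp (fst w) * (Cnorm (a j) * (factR j * (/ eta) ^ j)))
      with (Cnorm (a j) * ((/ eta) ^ j * (factR j * exp (eta * Cnorm z)) * exp (fst w))) by ring.
    apply Rmult_le_compat_l; [apply Cnorm_ge0|]. apply Rmult_le_compat_r; [lra|].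
    rewrite E. apply Rmult_le_compat_l; lra.
Qed.

Lemma dir_spec (x : Cplx) : x <> Czero -> x = (RtoC (Cnorm x) * dir x)%C.
Proof.
  intros H. assert (P := Cnorm_pos x H). unfold dir.
  replace (RtoC (Cnorm x) * (RtoC (/ Cnorm x) * x))%C with (RtoC (Cnorm x * / Cnorm x) * x)%C
    by (rewrite RtoC_mul; ring).
  rewrite Rinv_r by lra. change (RtoC 1) with Cone. ring.
Qed.

Lemma Re_mul_dir (s x : Cplx) : x <> Czero -> Cre (s * x)%C = Cnorm x * Cre (s * dir x)%C.
Proof.
  intros H. rewrite (dir_spec x H) at 1. unfold Cre. simpl. ring.
Qed.

Lemma Cnorm_dir (x : Cplx) : x <> Czero -> Cnorm (dir x) = 1.
Proof.
  intros H. assert (P := Cnorm_pos x H). unfold dir. rewrite Cnorm_mul, Cnorm_RtoC.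
  rewrite Rabs_pos_eq by (left; now apply Rinv_0_lt_compat). field. lra.
Qed.

Theorem dominant_exponent (mu : nat -> Cplx) (m : nat -> nat) (N : nat) (a : nat -> nat -> Cplx)
  (sw : Cplx) (kap C R0 : R) (x : nat -> Cplx) :
  (forall c, kap < c -> at_most_one_node mu sw c) ->
  Cto_infty x -> Ccv (fun l => dir (x l)) sw ->
  (forall l, Cnorm (quasi mu m N a (x l)) <= C * exp (R0 * Cnorm (x l))) ->
  forall k, (k < N)%nat -> (exists j, (j < m k)%nat /\ a k j <> Czero) ->
    Cre (sw * mu k)%C <= Rmax kap R0.
Proof.
  intros Huniq Hinf Hdir HP k0 Hk0 Hsup0. apply Rnot_lt_le. intros Hbig.
  set (Q := fun k => exists j, (j < m k)%nat /\ a k j <> Czero).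
  destruct (finite_maximum N Q (fun k => Cre (sw * mu k)%C)) as [ks [Hks [Qks Hmax]]]; [now exists k0|].
  set (c := Cre (sw * mu ks)%C) in *.
  assert (Hc : Rmax kap R0 < c).
  { eapply Rlt_le_trans; [exact Hbig|]. now apply (Hmax k0). }
  assert (Hck := Rle_lt_trans _ _ _ (Rmax_l _ _) Hc). assert (HcR := Rle_lt_trans _ _ _ (Rmax_r _ _) Hc).
  destruct (finite_gap N (fun k => Q k /\ k <> ks) (fun k => Cre (sw * mu k)%C) c) as [g [Hg Hgap]].
  { intros k Hk [Qk Nk]. destruct (Rle_lt_or_eq_dec _ _ (Hmax k Hk Qk)) as [L|E]; [assumption|].
    exfalso. apply Nk. apply (Huniq c Hck); [exact E|reflexivity]. }
  (* All other exponents lie below c - 3 eta. A loss of eta for the direction and eta / 2 for the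
     polynomial factors leaves them at c - eta - eta / 2, still below the c - eta guaranteed for the
     dominant one; c - R0 >= 3 eta treats the assumed bound likewise. *)
  set (eta := Rmin (g / 3) ((c - R0) / 3)). assert (Heta : 0 < eta) by (apply Rmin_pos; lra).
  assert (E1 : eta <= g / 3) by apply Rmin_l. assert (E2 : eta <= (c - R0) / 3) by apply Rmin_r.
  destruct (polynomial_lower_bound (m ks) (a ks) Qks) as [d [A [Hd Hlow]]].
  assert (HB : exists B, 0 < B /\ forall k, (k < N)%nat -> Cnorm (mu k) <= B).
  { clear. induction N as [|N [B [PB HB]]].
    - exists 1. split; [lra|]. intros; lia.
    - exists (Rmax B (Cnorm (mu N))). split; [eapply Rlt_le_trans; [exact PB|apply Rmax_l]|].
      intros k Hk. destruct (Nat.eq_dec k N) as [->|D]; [apply Rmax_r|].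
      eapply Rle_trans; [apply HB; lia|apply Rmax_l]. }
  destruct HB as [B [PB HB]].
  assert (HK : exists K, 0 <= K /\ forall k, (k < N)%nat -> forall z w : Cplx,
     Cnorm (Csum (m k) (fun j => a k j * (Cpow z j * Cexp w))%C) <= K * exp (eta / 2 * Cnorm z + fst w)).
  { clear - Heta. induction N as [|N [K [PK HK]]].
    - exists 0. split; [lra|]. intros; lia.
    - destruct (quasi_block_bound (m N) (a N) (eta / 2)) as [K2 [PK2 HK2]]; [lra|].
      exists (Rmax K K2). split; [eapply Rle_trans; [exact PK|apply Rmax_l]|].
      intros k Hk z w. assert (P := exp_pos (eta / 2 * Cnorm z + fst w)).
      destruct (Nat.eq_dec k N) as [->|D].
      + eapply Rle_trans; [apply HK2|]. apply Rmult_le_compat_r; [lra|apply Rmax_r].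
      + eapply Rle_trans; [apply HK; lia|]. apply Rmult_le_compat_r; [lra|apply Rmax_l]. }
  destruct HK as [K [PK HK]].
  set (KK := INR N * K + Rabs C + 1). assert (PKK : 0 < KK).
  { unfold KK. assert (P1 := pos_INR N). assert (P2 := Rabs_pos C). nra. }
  (* Directions within eta / B of [sw] change the real parts of the N exponents by at most eta
     |x|. *)
  destruct (Hdir (eta / B)) as [n1 Hn1]; [apply Rdiv_lt_0_compat; lra|].
  (* Beyond the last radius d exp(r eta / 2) exceeds KK, because exp t >= 1 + t. *)
  destruct (Hinf (Rmax (Rmax A 1) (2 / eta * (KK / d)))) as [n2 Hn2].
  set (n := Nat.max n1 n2). specialize (Hn1 n ltac:(unfold n; lia)). specialize (Hn2 n ltac:(unfold n; lia)).
  specialize (HP n). set (X := x n) in *. set (r := Cnorm X) in *.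
  assert (R1 : A < r) by (eapply Rle_lt_trans; [|exact Hn2]; eapply Rle_trans; [apply Rmax_l|apply Rmax_l]).
  assert (R2 : 1 < r) by (eapply Rle_lt_trans; [|exact Hn2]; eapply Rle_trans; [apply Rmax_r|apply Rmax_l]).
  assert (R3 : 2 / eta * (KK / d) < r) by (eapply Rle_lt_trans; [|exact Hn2]; apply Rmax_r).
  assert (NX : X <> Czero) by (apply Cnorm_gt0_neq; fold r; lra).
  assert (close : forall k, (k < N)%nat ->
     r * (Cre (sw * mu k)%C - eta) <= fst (mu k * X)%C <= r * (Cre (sw * mu k)%C + eta)).
  { intros k Hk. change (fst (mu k * X)%C) with (Cre (mu k * X)%C). rewrite (Re_mul_dir (mu k) X NX). fold r.
    assert (D : Rabs (Cre (mu k * dir X)%C - Cre (sw * mu k)%C) <= eta).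
    { replace (Cre (mu k * dir X)%C - Cre (sw * mu k)%C) with (fst (mu k * (dir X - sw))%C)
        by (unfold Cre; simpl; ring).
      eapply Rle_trans; [apply Cre_le_norm|]. rewrite Cnorm_mul.
      apply Rle_trans with (B * (eta / B)).
      - apply Rmult_le_compat; auto using Cnorm_ge0. lra.
      - right. field. lra. }
    apply Rabs_le_bounds in D. split; apply Rmult_le_compat_l; lra. }
  unfold quasi in HP. rewrite (Csum_extract N ks) in HP by assumption.
  set (main := Csum (m ks) (fun j => a ks j * (Cpow X j * Cexp (mu ks * X)))%C) in HP.
  set (rest := Csum N _) in HP.
  assert (Hmain : d * exp (r * (c - eta)) <= Cnorm main).
  { assert (E : main = (Cexp (mu ks * X) * Csum (m ks) (fun j => a ks j * Cpow X j))%C).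
    { unfold main. rewrite <- Csum_scal. apply Csum_ext. intros; ring. }
    rewrite E, Cnorm_mul, Cnorm_Cexp, Rmult_comm.
    apply Rmult_le_compat; [left; apply exp_pos|lra| |apply Hlow; fold r; lra].
    destruct (close ks Hks) as [L _]. fold c in L.
    destruct L as [L|L]; [left; now apply exp_increasing|right; now f_equal]. }
  assert (Hrest : Cnorm rest <= INR N * (K * exp (r * (c - eta) - r * (eta / 2)))).
  { assert (G : forall M, Rsum M (fun _ => K * exp (r * (c - eta) - r * (eta / 2)))
        = INR M * (K * exp (r * (c - eta) - r * (eta / 2)))).
    { induction M; simpl Rsum; [simpl; ring|]. rewrite IHM, S_INR. ring. }
    rewrite <- G. apply Csum_norm_le. intros k Hk.
    assert (PE := exp_pos (r * (c - eta) - r * (eta / 2))).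
    destruct (Nat.eq_dec k ks) as [_|Nk]; [rewrite Cnorm_zero; nra|].
    destruct (classic (Q k)) as [Qk|Qk].
    - eapply Rle_trans; [apply (HK k Hk)|]. apply Rmult_le_compat_l; [assumption|].
      fold r. destruct (close k Hk) as [_ U]. specialize (Hgap k Hk (conj Qk Nk)).
      assert (L : eta / 2 * r + fst (mu k * X)%C <= r * (c - eta) - r * (eta / 2)).
      { assert (r * (Cre (sw * mu k)%C + eta) <= r * (c - 3 * eta + eta)) by (apply Rmult_le_compat_l; lra).
        nra. }
      destruct L as [L|L]; [left; now apply exp_increasing|right; now f_equal].
    - rewrite Csum_zero, Cnorm_zero; [nra|]. intros j Hj.
      destruct (classic (a k j = Czero)) as [E|NE]; [rewrite E; ring|].
      exfalso. apply Qk. now exists j. }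
  assert (Hup : C * exp (R0 * r) <= Rabs C * exp (r * (c - eta) - r * (eta / 2))).
  { assert (PE := exp_pos (R0 * r)). apply Rle_trans with (Rabs C * exp (R0 * r)).
    - apply Rmult_le_compat_r; [lra|apply Rle_abs].
    - apply Rmult_le_compat_l; [apply Rabs_pos|].
      assert (L : R0 * r <= r * (c - eta) - r * (eta / 2)) by nra.
      destruct L as [L|L]; [left; now apply exp_increasing|right; now f_equal]. }
  assert (T := Cnorm_sub_ge main (- rest)%C). rewrite Cnorm_opp in T.
  replace (main - - rest)%C with (main + rest)%C in T by ring.
  assert (PE := exp_pos (r * (c - eta))). assert (PE2 := exp_pos (r * (c - eta) - r * (eta / 2))).
  assert (F : d * exp (r * (c - eta)) <= KK * exp (r * (c - eta) - r * (eta / 2))) by (unfold KK; lra).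
  assert (F2 : exp (r * (c - eta)) = exp (r * (eta / 2)) * exp (r * (c - eta) - r * (eta / 2))).
  { rewrite <- exp_plus. f_equal. ring. }
  rewrite F2, <- Rmult_assoc in F. apply Rmult_le_reg_r in F; [|assumption].
  assert (F3 := exp_ineq1_le (r * (eta / 2))).
  assert (F4 : KK / d < r * (eta / 2)).
  { apply (Rmult_lt_compat_r (eta / 2)) in R3; [|lra].
    replace (2 / eta * (KK / d) * (eta / 2)) with (KK / d) in R3 by (field; lra). assumption. }
  assert (F5 : KK < d * (r * (eta / 2))).
  { apply (Rmult_lt_compat_l d) in F4; [|lra]. replace (d * (KK / d)) with KK in F4 by (field; lra). assumption. }
  nra.
Qed.

(** Only n <= phi n is asked of the selection; this suffices for limits at infinity and avoids
    constructing a strictly increasing one. *)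
Lemma bounded_subsequence (u : nat -> R) : (forall n, Rabs (u n) <= 1) ->
  exists l (phi : nat -> nat), (forall n, (n <= phi n)%nat) /\ Un_cv (fun n => u (phi n)) l.
Proof.
  intros H.
  destruct (Bolzano_Weierstrass u (fun x => -1 <= x <= 1) (compact_P3 (-1) 1)) as [l Hl].
  { intros n. specialize (H n). apply Rabs_le_bounds in H. lra. }
  assert (S : forall n, {p | (n <= p)%nat /\ Rabs (u p - l) < / INR (S n)}).
  { intros n. apply constructive_indefinite_description.
    assert (Hn : 0 < / INR (S n)) by (apply Rinv_0_lt_compat, lt_0_INR; lia).
    destruct (Hl (disc l (mkposreal _ Hn)) n) as [p [Hp Dp]].
    - exists (mkposreal _ Hn). intros y Hy. exact Hy.
    - exists p. split; [assumption|exact Dp]. }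
  exists l, (fun n => proj1_sig (S n)). split.
  - intros n. apply (proj2_sig (S n)).
  - intros eps He. destruct (archimed_cor1 eps He) as [N [HN PN]]. exists N. intros n Hn.
    destruct (proj2_sig (S n)) as [_ D]. unfold Rdist. eapply Rlt_trans; [exact D|].
    eapply Rle_lt_trans; [|exact HN]. apply Rinv_le_contravar; [now apply lt_0_INR|].
    apply le_INR. lia.
Qed.

Lemma bounded_subsequence_C (u : nat -> Cplx) : (forall n, Cnorm (u n) <= 1) ->
  exists l (phi : nat -> nat), (forall n, (n <= phi n)%nat) /\ Ccv (fun n => u (phi n)) l.
Proof.
  intros H.
  destruct (bounded_subsequence (fun n => fst (u n))) as [x [f [Hf Cx]]].
  { intros n. eapply Rle_trans; [apply Cre_le_norm|apply H]. }
  destruct (bounded_subsequence (fun n => snd (u (f n)))) as [y [g [Hg Cy]]].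
  { intros n. eapply Rle_trans; [apply Cim_le_norm|apply H]. }
  exists (x, y), (fun n => f (g n)). split.
  - intros n. specialize (Hg n). specialize (Hf (g n)). lia.
  - intros eps He. destruct (Cx (eps / 2)) as [N1 H1]; [lra|]. destruct (Cy (eps / 2)) as [N2 H2]; [lra|].
    exists (Nat.max N1 N2). intros n Hn. specialize (Hg n).
    specialize (H1 (g n) ltac:(lia)). specialize (H2 n ltac:(lia)).
    eapply Rle_lt_trans; [apply Cnorm_le_abs|]. unfold Rdist, Rminus in *. simpl. lra.
Qed.

(** The condition defining D_M relaxed to a growth rate R0: the nodes a quasi-polynomial of that
    rate on the sequence can involve. *)
Definition low_node (mu : nat -> Cplx) (Lam : Cplx -> Prop) (kappa : Cplx -> R) (R0 : R) (k : nat) : Prop :=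
  forall sw, PM mu Lam sw -> Cre (sw * mu k)%C <= Rmax (kappa sw) R0.

(** Compactness of the circle: infinitely many low nodes would accumulate at some direction s_tau.
    The direction s_omega attached to it makes Re(s_omega mu) unbounded along them, by (B) directly,
    and by (A) because this real part is eventually at least |mu| Re(s_omega s_tau) / 2. The number
    [kap] found there may differ from [kappa sw], as only membership in P_M is used. *)
Theorem finitely_many_low_nodes (mu : nat -> Cplx) (Lam : Cplx -> Prop) (kappa : Cplx -> R) (R0 : R) :
  discrete_seq mu ->
  (forall st, limit_dir (node_set mu) st ->
     (exists sw kap, condA mu Lam st sw kap) \/ (exists sw kap, condB mu Lam st sw kap)) ->
  exists N, forall k, low_node mu Lam kappa R0 k -> (k < N)%nat.
Proof.
  intros Hdisc HAB. apply NNPP. intros Hno.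
  assert (S : forall n, {k | (n <= k)%nat /\ low_node mu Lam kappa R0 k}).
  { intros n. apply constructive_indefinite_description. apply NNPP. intros H. apply Hno.
    exists n. intros k Hk. destruct (Nat.le_gt_cases n k); [|assumption]. exfalso. apply H. now exists k. }
  (* Starting at n0 excludes the node 0, which has no direction. *)
  destruct (Hdisc 0) as [n0 Hn0].
  set (ks := fun n => proj1_sig (S (n + n0)%nat)).
  assert (Hks : forall n, (n + n0 <= ks n)%nat /\ low_node mu Lam kappa R0 (ks n)).
  { intros n. apply (proj2_sig (S (n + n0)%nat)). }
  assert (Hnz : forall n, mu (ks n) <> Czero).
  { intros n. apply Cnorm_gt0_neq, Hn0. destruct (Hks n). lia. }
  destruct (bounded_subsequence_C (fun n => dir (mu (ks n)))) as [st [phi [Hphi Hst]]].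
  { intros n. rewrite Cnorm_dir; [lra|apply Hnz]. }
  set (kl := fun n => ks (phi n)).
  assert (Hinf : Cto_infty (fun l => mu (kl l))).
  { intros A. destruct (Hdisc A) as [N HN]. exists N. intros k Hk. apply HN. unfold kl.
    destruct (Hks (phi k)). specialize (Hphi k). lia. }
  assert (Hlim : limit_dir (node_set mu) st).
  { split.
    - apply Rle_antisym.
      + apply (Ccv_norm_le _ _ _ 0 Hst). intros n _. rewrite Cnorm_dir; [lra|apply Hnz].
      + apply le_epsilon. intros eps He. destruct (Hst eps He) as [N HN]. specialize (HN N (le_n N)).
        assert (T := Cnorm_sub_ge (dir (mu (ks (phi N)))) (dir (mu (ks (phi N))) - st)%C).
        replace (dir (mu (ks (phi N))) - (dir (mu (ks (phi N))) - st))%C with st in T by ring.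
        rewrite (Cnorm_dir (mu _) (Hnz _)) in T. lra.
    - exists (fun l => mu (kl l)). split; [intros k; now exists (kl k)|]. split; assumption. }
  assert (contra : forall sw, PM mu Lam sw -> ~ Rto_pinfty (fun l => Cre (sw * mu (kl l))%C)).
  { intros sw HPM Hp. destruct (Hp (Rmax (kappa sw) R0)) as [N HN]. specialize (HN N (le_n N)).
    destruct (Hks (phi N)) as [_ L]. specialize (L sw HPM). unfold kl in HN. lra. }
  destruct (HAB st Hlim) as [[sw [kap H]]|[sw [kap H]]].
  - apply (contra sw); [exists kap; exists st; auto|].
    destruct H as [[Nsw _] [Hpos _]]. set (c := Cre (Cmul sw st)) in *.
    intros A. destruct (Hst (c / 2)) as [N1 H1]; [lra|].
    destruct (Hinf (Rmax 0 (2 * A / c))) as [N2 H2].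
    exists (Nat.max N1 N2). intros l Hl. specialize (H1 l ltac:(lia)). specialize (H2 l ltac:(lia)).
    assert (P1 := Rle_lt_trans _ _ _ (Rmax_l _ _) H2). assert (P2 := Rle_lt_trans _ _ _ (Rmax_r _ _) H2).
    rewrite Re_mul_dir by apply Hnz. unfold kl in *.
    assert (D : c / 2 < Cre (sw * dir (mu (ks (phi l))))%C).
    { assert (T := Cre_le_norm (sw * (dir (mu (ks (phi l))) - st))%C).
      rewrite Cnorm_mul, Nsw, Rmult_1_l in T.
      replace (fst (sw * (dir (mu (ks (phi l))) - st))%C) with (Cre (sw * dir (mu (ks (phi l))))%C - c) in T
        by (unfold c, Cre; simpl; ring).
      apply Rle_lt_trans with (2 := H1) in T. apply Rabs_def2 in T. lra. }
    apply (Rmult_lt_compat_r (c / 2)) in P2; [|lra].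
    replace (2 * A / c * (c / 2)) with A in P2 by (field; lra). nra.
  - apply (contra sw); [exists kap; exists st; auto|]. now apply H.
Qed.

(** The threshold N depends on the rate R0 alone, neither on the coefficients nor on C. This
    uniformity allows the interpolation to freeze finitely many nodes at each stage. *)
Definition bounded_quasi_finite (mu : nat -> Cplx) (m : nat -> nat) (lam : nat -> Cplx) : Prop :=
  forall R0, exists N, forall N' a C,
    (forall n, Cnorm (quasi mu m N' a (lam n)) <= C * exp (R0 * Cnorm (lam n))) ->
    forall k j, (N <= k)%nat -> (k < N')%nat -> (j < m k)%nat -> a k j = Czero.

(** * Interpolation by lacunary exponential series *)

Lemma pairing_sym (u v : nat -> Cplx) : pairing u v = pairing v u.
Proof.
  unfold pairing. f_equal. apply functional_extensionality. intros i. unfold pterm. ring.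
Qed.

Lemma pairing_scal_r (c : Cplx) (u v : nat -> Cplx) : expo_type u -> entire_type v ->
  pairing u (fun i => c * v i)%C = (c * pairing u v)%C.
Proof.
  intros Hu Hv. apply csum_eq. apply (Cseries_ext (fun i => c * pterm u v i)%C).
  - intros i. unfold pterm. ring.
  - now apply Cseries_scal, pairing_series.
Qed.

Lemma shiftn_geo (j : nat) (z : Cplx) : shiftn j (geo z) = (fun i => Cpow z j * geo z i)%C.
Proof. apply functional_extensionality. intros i. unfold shiftn, geo. apply Cpow_add. Qed.

Lemma expo_type_iter_mulz (j : nat) (u : nat -> Cplx) : expo_type u -> expo_type (Nat.iter j mulz u).
Proof. intros H. induction j; [assumption|]. now apply expo_type_mulz. Qed.

Lemma pairing_iter_mulz (j : nat) (u v : nat -> Cplx) : expo_type u -> entire_type v ->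
  pairing (Nat.iter j mulz u) v = pairing u (shiftn j v).
Proof.
  intros Hu. revert v. induction j; intros v Hv; [reflexivity|].
  change (Nat.iter (S j) mulz u) with (mulz (Nat.iter j mulz u)).
  rewrite pairing_mulz by auto using expo_type_iter_mulz.
  rewrite IHj by now apply entire_type_shiftn. now rewrite shiftn_shiftn.
Qed.

Lemma ev_iter_mulz (j : nat) (u : nat -> Cplx) (z : Cplx) : expo_type u ->
  ev (Nat.iter j mulz u) z = (Cpow z j * ev u z)%C.
Proof.
  intros Hu. unfold ev. rewrite pairing_sym, pairing_iter_mulz by auto using entire_type_geo.
  rewrite shiftn_geo, pairing_scal_r by auto using entire_type_geo. now rewrite pairing_sym.
Qed.

Lemma ev_geo (mu z : Cplx) : ev (geo mu) z = Cexp (mu * z).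
Proof.
  destruct (entire_as_ev Cexp entire_Cexp) as [v [Hv [Ev _]]].
  assert (V : forall j, v j = Cone).
  { intros j.
    assert (X := deriv_chain_unique Cexp (ev v) (fun _ => Cexp) _ Ev
      (conj (fun z => eq_refl) (fun j z => proj2 (Cderiv_cdiff _ _ _) (cdiff_Cexp z)))
      (ev_chain v Hv) j Czero). simpl in X.
    rewrite Cexp_zero, ev_zero in X by now apply entire_type_shiftn.
    rewrite X. unfold shiftn. f_equal. lia. }
  rewrite Ev. unfold ev, pairing. f_equal. apply functional_extensionality. intros i.
  unfold pterm, geo. rewrite V, Cpow_mul. ring.
Qed.

(** The functional taking the derivative of order [snd q] at the node [fst q]; as a sequence, the
    derivatives at the origin of z^j exp(mu z). *)
Definition node_seq (mu : nat -> Cplx) (q : nat * nat) : nat -> Cplx :=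
  Nat.iter (snd q) mulz (geo (mu (fst q))).
Definition node_exp (mu : nat -> Cplx) (q : nat * nat) (z : Cplx) : Cplx :=
  (Cpow z (snd q) * Cexp (mu (fst q) * z))%C.

Lemma expo_type_node_seq (mu : nat -> Cplx) (q : nat * nat) : expo_type (node_seq mu q).
Proof. apply expo_type_iter_mulz, expo_type_geo. Qed.

Lemma ev_node_seq (mu : nat -> Cplx) (q : nat * nat) (z : Cplx) : ev (node_seq mu q) z = node_exp mu q z.
Proof. unfold node_seq. now rewrite ev_iter_mulz, ev_geo by apply expo_type_geo. Qed.

Lemma pairing_node_seq (mu : nat -> Cplx) (q : nat * nat) (v : nat -> Cplx) : entire_type v ->
  pairing (node_seq mu q) v = ev (shiftn (snd q) v) (mu (fst q)).
Proof. intros Hv. apply pairing_iter_mulz; [apply expo_type_geo|assumption]. Qed.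

Definition node_index (m : nat -> nat) (N : nat) : list (nat * nat) :=
  flat_map (fun k => map (fun j => (k, j)) (seq 0 (m k))) (seq 0 N).

Lemma in_node_index (m : nat -> nat) (N k j : nat) :
  In (k, j) (node_index m N) <-> (k < N)%nat /\ (j < m k)%nat.
Proof.
  unfold node_index. rewrite in_flat_map. split.
  - intros [k' [Hk Hj]]. apply in_map_iff in Hj. destruct Hj as [j' [E Hj]].
    inversion E; subst. apply in_seq in Hk. apply in_seq in Hj. lia.
  - intros [Hk Hj]. exists k. split; [apply in_seq; lia|].
    apply in_map_iff. exists j. split; [reflexivity|apply in_seq; lia].
Qed.

Lemma NoDup_node_index (m : nat -> nat) (N : nat) : NoDup (node_index m N).
Proof.
  induction N; [constructor|]. unfold node_index. rewrite seq_S, flat_map_app. simpl.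
  rewrite app_nil_r. apply NoDup_app; [exact IHN| |].
  - apply Injective_map_NoDup; [|apply seq_NoDup]. intros j j' E. congruence.
  - intros [k j] H1 H2. apply in_node_index in H1. apply in_map_iff in H2.
    destruct H2 as [j' [E _]]. inversion E. lia.
Qed.

Lemma Lsum_map {I J : Type} (f : I -> J) (L : list I) (g : J -> Cplx) :
  Lsum (map f L) g = Lsum L (fun i => g (f i)).
Proof. induction L; simpl; [reflexivity|now rewrite IHL]. Qed.

Lemma Lsum_seq (n : nat) (g : nat -> Cplx) : Lsum (seq 0 n) g = Csum n g.
Proof.
  induction n; [reflexivity|]. rewrite seq_S, Lsum_app, IHn. simpl. ring.
Qed.

Lemma Lsum_node_index (m : nat -> nat) (N : nat) (F : nat * nat -> Cplx) :
  Lsum (node_index m N) F = Csum N (fun k => Csum (m k) (fun j => F (k, j))).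
Proof.
  induction N; [reflexivity|]. unfold node_index. rewrite seq_S, flat_map_app, Lsum_app.
  fold (node_index m N). rewrite IHN. simpl. rewrite app_nil_r, Lsum_map, Lsum_seq. reflexivity.
Qed.

(** * Formal exponential sums over the lambda_n *)

Section FormalSums.
Variable lam : nat -> Cplx.

Definition fscal (c : Cplx) (x : list (nat * Cplx)) : list (nat * Cplx) :=
  map (fun p => (fst p, (c * snd p)%C)) x.
Definition fsum_seq (x : list (nat * Cplx)) (i : nat) : Cplx :=
  Lsum x (fun p => snd p * geo (lam (fst p)) i)%C.
Definition fsum_val (g : Cplx -> Cplx) (x : list (nat * Cplx)) : Cplx :=
  Lsum x (fun p => snd p * g (lam (fst p)))%C.
(** A weighted l^1 norm of the list of terms, not of the function they sum to. A functional
    dominated by it is therefore one whose values on single exponentials grow at most like exp(r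
    |lambda_n|), while [fsum_seq_bound] converts the norm into bounds on derivatives. *)
Definition fsum_norm (r : R) (x : list (nat * Cplx)) : R :=
  fold_right (fun p acc => Cnorm (snd p) * exp (r * Cnorm (lam (fst p))) + acc) 0 x.

Lemma linear_fsum_val (g : Cplx -> Cplx) :
  linear_fun _ nil (@app (nat * Cplx)) fscal (fsum_val g).
Proof.
  split; [reflexivity|split].
  - intros x y. apply Lsum_app.
  - intros c x. unfold fsum_val, fscal. rewrite Lsum_map, <- Lsum_scal. apply Lsum_ext.
    intros; simpl; ring.
Qed.

Lemma fsum_norm_pos (r : R) (x : list (nat * Cplx)) : 0 <= fsum_norm r x.
Proof.
  induction x as [|p x IH]; simpl; [lra|].
  assert (P := exp_pos (r * Cnorm (lam (fst p)))). assert (Q := Cnorm_ge0 (snd p)). nra.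
Qed.

Lemma seminorm_fsum_norm (r : R) : seminorm _ nil (@app (nat * Cplx)) fscal (fsum_norm r).
Proof.
  split; [reflexivity|]. split; [apply fsum_norm_pos|]. split.
  - intros x y. induction x; simpl; lra.
  - intros c x. induction x as [|p x IH]; simpl; [lra|]. rewrite Cnorm_mul. lra.
Qed.

Lemma seminorm_zero : seminorm _ nil (@app (nat * Cplx)) fscal (fun _ => 0).
Proof. split; [reflexivity|]. split; [intros; lra|]. split; intros; lra. Qed.

Lemma fsum_seq_bound (r : R) (x : list (nat * Cplx)) : 0 < r ->
  fact_bound (fsum_norm r x) (/ r) (fsum_seq x).
Proof.
  intros Hr i. assert (F := factR_pos i). assert (Pi : 0 < (/ r) ^ i) by (apply pow_lt, Rinv_0_lt_compat; lra).
  induction x as [|p x IH].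
  - unfold fsum_seq; simpl. rewrite Cnorm_zero. lra.
  - unfold fsum_seq in *. simpl. eapply Rle_trans; [apply Cnorm_add|].
    rewrite Cnorm_mul. unfold geo at 1. rewrite Cnorm_pow.
    assert (Nl := Cnorm_ge0 (lam (fst p))).
    assert (B := pow_le_fact_exp (r * Cnorm (lam (fst p))) i ltac:(nra)).
    assert (E : Cnorm (lam (fst p)) ^ i = (/ r) ^ i * (r * Cnorm (lam (fst p))) ^ i).
    { rewrite <- Rpow_mult_distr. f_equal. field. lra. }
    rewrite E.
    assert (Cnorm (snd p) * ((/ r) ^ i * (r * Cnorm (lam (fst p))) ^ i)
      <= Cnorm (snd p) * ((/ r) ^ i * (factR i * exp (r * Cnorm (lam (fst p)))))).
    { apply Rmult_le_compat_l; [apply Cnorm_ge0|]. apply Rmult_le_compat_l; lra. }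
    lra.
Qed.

Lemma fsum_norm_le (r s : R) (x : list (nat * Cplx)) : r <= s -> fsum_norm r x <= fsum_norm s x.
Proof.
  intros H. induction x as [|p x IH]; simpl; [lra|]. apply Rplus_le_compat; [|assumption].
  apply Rmult_le_compat_l; [apply Cnorm_ge0|].
  assert (L : r * Cnorm (lam (fst p)) <= s * Cnorm (lam (fst p)))
    by (apply Rmult_le_compat_r; auto using Cnorm_ge0).
  destruct L as [L|L]; [left; now apply exp_increasing|right; now f_equal].
Qed.

Lemma expo_type_fsum_seq (x : list (nat * Cplx)) : expo_type (fsum_seq x).
Proof.
  induction x as [|p x IH]; [apply expo_type_zero|].
  apply (expo_type_ext (fun i => fsum_seq x i + snd p * geo (lam (fst p)) i)%C).
  - intros i. unfold fsum_seq. simpl. ring.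
  - apply expo_type_lin; [assumption|apply expo_type_geo].
Qed.

Lemma pairing_fsum_seq (u : nat -> Cplx) (x : list (nat * Cplx)) : expo_type u ->
  pairing u (fsum_seq x) = fsum_val (ev u) x.
Proof.
  intros Hu. induction x as [|p x IH].
  - apply pairing_zero.
  - change (fsum_val (ev u) (p :: x)) with (snd p * ev u (lam (fst p)) + fsum_val (ev u) x)%C.
    rewrite <- IH.
    replace (fsum_seq (p :: x)) with (fun i => fsum_seq x i + snd p * geo (lam (fst p)) i)%C.
    + rewrite pairing_lin_r; auto using entire_type_geo, expo_type_entire_type, expo_type_fsum_seq.
      unfold ev. rewrite (pairing_sym u (geo _)). ring.
    + apply functional_extensionality. intros i. unfold fsum_seq. simpl. ring.
Qed.

End FormalSums.

Definition mass (m : nat -> nat) (N : nat) (a b : nat -> nat -> Cplx) : Cplx :=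
  Csum N (fun k => Csum (m k) (fun j => a k j * b k j)%C).

(* The solution is a series of formal exponential sums: the stage [i] fixes the equations of
   finitely many new nodes with a correction that is small for the [i]-th norm.  Such a
   correction exists by [interpolation_alternative], because a combination of the equations
   that is dominated by the [i]-th norm involves only the nodes fixed before. *)
Theorem lacunary_interpolation (mu : nat -> Cplx) (m : nat -> nat) (lam : nat -> Cplx)
  (b : nat -> nat -> Cplx) :
  bounded_quasi_finite mu m lam ->
  (forall N a, (forall n, quasi mu m N a (lam n) = Czero) -> mass m N a b = Czero) ->
  exists phi, entire_type phi /\
    (forall k j, (j < m k)%nat -> ev (shiftn j phi) (mu k) = b k j) /\
    (forall A, expo_type A -> (forall n, ev A (lam n) = Czero) ->
       forall l, pairing A (shiftn l phi) = Czero).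
Proof.
  intros HF Hb.
  set (e := fun q => fsum_val lam (node_exp mu q)).
  assert (He : forall q, linear_fun _ nil (@app (nat * Cplx)) fscal (e q))
    by (intros; apply linear_fsum_val).
  assert (single : forall N a n,
    Lsum (node_index m N) (fun q => a q * e q ((n, Cone) :: nil))%C
      = quasi mu m N (fun k j => a (k, j)) (lam n)).
  { intros N a n. rewrite Lsum_node_index. unfold quasi.
    apply Csum_ext. intros k _. apply Csum_ext. intros j _. unfold e, fsum_val, node_exp. simpl. ring. }
  assert (HN : forall i, {N | forall N' a C,
     (forall n, Cnorm (quasi mu m N' a (lam n)) <= C * exp (INR (S i) * Cnorm (lam n))) ->
     forall k j, (N <= k)%nat -> (k < N')%nat -> (j < m k)%nat -> a k j = Czero})
    by (intros i; apply constructive_indefinite_description, HF).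
  (* [M] is nondecreasing, at least i so that every node is eventually treated, and at least the
     threshold belonging to the rate i + 1. *)
  set (M := fix M i := match i with O => proj1_sig (HN O)
            | S i' => Nat.max (S i') (Nat.max (M i') (proj1_sig (HN (S i')))) end).
  assert (HM : forall i, (i <= M i)%nat /\ (M i <= M (S i))%nat /\ (proj1_sig (HN i) <= M i)%nat).
  { assert (MS : forall i, M (S i) = Nat.max (S i) (Nat.max (M i) (proj1_sig (HN (S i))))) by reflexivity.
    assert (M0 : M O = proj1_sig (HN O)) by reflexivity. clearbody M.
    intros [|i]; rewrite !MS, ?M0; lia. }
  set (P := fun i X => forall k j, (k < M i)%nat -> (j < m k)%nat -> e (k, j) X = b k j).
  (* Corrections are summable, and the rate i + 1 of the norm grows with the stage, so the limit is
     controlled on every disc. *)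
  set (Q := fun i X Y => exists x, Y = X ++ x /\ fsum_norm lam (INR (S i)) x < (/ 2) ^ i).
  assert (H0 : exists X, P O X).
  (* For the zero seminorm domination means vanishing at every lambda_n, so the obstruction at the
     initial stage is excluded exactly by [Hb]. *)
  { destruct (interpolation_alternative nil (@app (nat * Cplx)) fscal (fun _ => 0) seminorm_zero e He
      (node_index m (M O)) (fun q => b (fst q) (snd q)) (NoDup_node_index _ _)) as [A1|[a [[C [HC Ha]] Hn]]].
    - destruct (A1 1 ltac:(lra)) as [X [HX _]]. exists X. intros k j Hk Hj.
      apply (HX (k, j)). now apply in_node_index.
    - exfalso. apply Hn. rewrite Lsum_node_index. apply (Hb (M O) (fun k j => a (k, j))).
      intros n. rewrite <- single. apply Cnorm_eq0, Rle_antisym; [|apply Cnorm_ge0].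
      eapply Rle_trans; [apply Ha; exact Logic.I|cbv beta; lra]. }
  destruct H0 as [X0 HX0].
  destruct (dependent_choice P Q X0 HX0) as [X [EX0 HX]].
  { intros i X HX.
    destruct (interpolation_alternative nil (@app (nat * Cplx)) fscal _ (seminorm_fsum_norm lam (INR (S i))) e He
      (node_index m (M (S i))) (fun q => b (fst q) (snd q) - e q X)%C (NoDup_node_index _ _))
      as [A1|[a [[C [HC Ha]] Hn]]].
    - destruct (A1 ((/ 2) ^ i)) as [x [Hx Px]]; [apply pow_lt; lra|].
      exists (X ++ x). split; [|now exists x].
      intros k j Hk Hj. rewrite (proj1 (proj2 (He (k, j)))), (Hx (k, j)) by now apply in_node_index.
      simpl. ring.
    (* Below [M i] the data to be corrected are already zero. Beyond it the coefficients vanish,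
       since a combination dominated by this norm has rate i + 1 on the sequence. *)
    - exfalso. apply Hn. apply Lsum_zero. intros [k j] Hq. apply in_node_index in Hq. destruct Hq as [Hk Hj].
      simpl. destruct (Nat.lt_ge_cases k (M i)) as [L|G].
      + rewrite HX by assumption. ring.
      + destruct (HM i) as [_ [_ HMi]].
        rewrite (proj2_sig (HN i) (M (S i)) (fun k j => a (k, j)) C); try assumption; [ring| |lia].
        intros n. rewrite <- single. eapply Rle_trans; [apply Ha; exact Logic.I|].
        unfold fsum_norm; cbn [fold_right fst snd]. rewrite Cnorm_one. right. ring. }
  set (s := fun l i => (fsum_seq lam (X (S i)) l - fsum_seq lam (X i) l)%C).
  assert (Hs : forall r i l, 0 < r -> r <= INR (S i) -> Cnorm (s l i) <= ((/ r) ^ l * factR l) * (/ 2) ^ i).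
  { intros r i l Hr Hri. destruct (HX i) as [_ [x [Ex Px]]].
    assert (E : s l i = fsum_seq lam x l).
    { unfold s, fsum_seq. rewrite Ex, Lsum_app. ring. }
    rewrite E. assert (B := fsum_seq_bound lam r x Hr l).
    assert (B2 := fsum_norm_le lam r _ x Hri). assert (F := factR_pos l).
    assert (Pl : 0 < (/ r) ^ l) by (apply pow_lt, Rinv_0_lt_compat; lra).
    eapply Rle_trans; [exact B|]. rewrite Rmult_assoc, Rmult_comm.
    apply Rmult_le_compat_l; [nra|lra]. }
  assert (HS : forall l, Cseries (s l) (csum (s l))).
  { intros l. apply (csum_geo _ ((/ 1) ^ l * factR l) (/ 2)); [lra|]. intros i. apply Hs; [lra|].
    apply (le_INR 1). lia. }
  set (phi := fun l => (fsum_seq lam (X O) l + csum (s l))%C).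
  assert (tele : forall n l, (fsum_seq lam (X n) l = fsum_seq lam (X O) l + Csum n (s l))%C).
  { intros n l. induction n; simpl; [ring|]. unfold s at 2. rewrite IHn. ring. }
  assert (tail : forall r n, 0 < r -> r <= INR (S n) ->
     fact_bound (2 * (/ 2) ^ n) (/ r) (fun l => phi l + (- Cone) * fsum_seq lam (X n) l)%C).
  { intros r n Hr Hrn l.
    replace (phi l + - Cone * fsum_seq lam (X n) l)%C with (csum (s l) - Csum n (s l))%C
      by (unfold phi; rewrite (tele n l); ring).
    apply (Ccv_norm_le (fun k => Csum k (s l) - Csum n (s l))%C _ _ n).
    - apply (Ccv_add _ (fun _ => - Csum n (s l))%C); [apply HS|apply Ccv_const].
    - intros k Hk. replace k with (n + (k - n))%nat by lia. rewrite Csum_split.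
      replace (Csum n (s l) + Csum (k - n) (fun i => s l (n + i)%nat) - Csum n (s l))%C
        with (Csum (0 + (k - n)) (fun i => s l (n + i)%nat) - Csum 0 (fun i => s l (n + i)%nat))%C
        by (simpl; ring).
      eapply Rle_trans; [apply (Csum_geo_tail _ ((/ r) ^ l * factR l * (/ 2) ^ n) (/ 2)); [lra|]|].
      + intros i. rewrite Rmult_assoc, <- pow_add. apply Hs; [assumption|].
        eapply Rle_trans; [exact Hrn|]. apply le_INR. lia.
      + simpl. right. field. }
  assert (EX : forall n, entire_type (fsum_seq lam (X n)))
    by (intros; apply expo_type_entire_type, expo_type_fsum_seq).
  assert (large : forall e, 0 < e -> exists n, (/ e) <= INR (S n)).
  { intros ep Hep. destruct (archimed_cor1 ep Hep) as [n [Hn Pn]]. exists n.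
    apply Rle_trans with (INR n); [|apply le_INR; lia].
    rewrite <- (Rinv_inv (INR n)). apply Rinv_le_contravar; [|lra].
    apply Rinv_0_lt_compat. now apply lt_0_INR. }
  assert (Hphi : entire_type phi).
  { intros ep Hep. destruct (large ep Hep) as [n Hn].
    assert (Ie : 0 < / ep) by (now apply Rinv_0_lt_compat).
    assert (T := tail (/ ep) n Ie Hn). rewrite Rinv_inv in T.
    destruct (EX n ep Hep) as [K HK]. exists (2 * (/ 2) ^ n + K). intros l.
    replace (phi l) with ((phi l + - Cone * fsum_seq lam (X n) l) + fsum_seq lam (X n) l)%C by ring.
    eapply Rle_trans; [apply Cnorm_add|]. specialize (T l). specialize (HK l). simpl in T. lra. }
  (* A functional that is eventually constant on the partial sums takes the same value on the limit.
     This yields both the prescribed jets and the annihilation by functions vanishing on the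
     lambda_n. *)
  assert (lim : forall u c N, expo_type u ->
     (forall n, (N <= n)%nat -> fsum_val lam (ev u) (X n) = c) -> pairing u phi = c).
  { intros u c N Hu Hc. apply Csub_eq0, Cnorm_eq0, Rle_antisym; [|apply Cnorm_ge0].
    apply le_epsilon. intros eps Heps. rewrite Rplus_0_l.
    assert (Hu2 := Hu). destruct Hu2 as [C [A [HA Bu]]]. assert (HC := expo_bound_pos _ _ _ Bu).
    assert (IA : 0 < / A) by (now apply Rinv_0_lt_compat).
    destruct (large (/ 2 * / A)) as [n1 Hn1]; [lra|].
    destruct (geometric_small (/ 2) (4 * C) eps) as [n2 Hn2]; [lra|lra|assumption|].
    set (n := Nat.max N (Nat.max n1 n2)).
    assert (T : fact_bound (2 * (/ 2) ^ n) (/ 2 * / A) (fun l => phi l + (- Cone) * fsum_seq lam (X n) l)%C).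
    { rewrite <- (Rinv_inv (/ 2 * / A)). apply tail; [apply Rinv_0_lt_compat; lra|].
      eapply Rle_trans; [exact Hn1|]. apply le_INR. unfold n. lia. }
    assert (B := pairing_bound C A (2 * (/ 2) ^ n) (/ 2 * / A) u _ HA ltac:(lra) ltac:(right; field; lra) Bu T).
    rewrite pairing_lin_r, pairing_fsum_seq, Hc in B by (auto; unfold n; lia).
    replace (pairing u phi - c)%C with (pairing u phi + - Cone * c)%C by ring.
    eapply Rle_trans; [exact B|]. specialize (Hn2 n ltac:(unfold n; lia)). lra. }
  exists phi. split; [assumption|]. split.
  - intros k j Hj. rewrite <- (pairing_node_seq mu (k, j)) by assumption.
    apply (lim _ _ (S k)); [apply expo_type_node_seq|]. intros n Hn.
    destruct (HX n) as [PX _]. rewrite <- (PX k j); [|destruct (HM n); lia|assumption].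
    unfold e, fsum_val. apply Lsum_ext. intros p _. now rewrite ev_node_seq.
  - intros A HA Hz l. rewrite <- pairing_iter_mulz by assumption.
    apply (lim _ _ O); [now apply expo_type_iter_mulz|]. intros n _.
    apply Lsum_zero. intros p _. rewrite ev_iter_mulz, Hz by assumption. ring.
Qed.

(** * Products with lacunary zeros and synthesis in the kernel *)

Definition lacunary (lam : nat -> Cplx) : Prop :=
  (forall n, lam n <> Czero) /\ (forall n, 2 * Cnorm (lam n) < Cnorm (lam (S n))).
Definition tail_seq (N : nat) (lam : nat -> Cplx) : nat -> Cplx := fun n => lam (N + n)%nat.

(* Derivatives at the origin of [(1 - z / lam 0) ... (1 - z / lam (n - 1))]. *)
Fixpoint pcoef (n : nat) (lam : nat -> Cplx) : nat -> Cplx :=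
  match n with
  | O => geo Czero
  | S n' => fun j => (pcoef n' (tail_seq 1 lam) j
                      + (- Cinv (lam O)) * mulz (pcoef n' (tail_seq 1 lam)) j)%C
  end.

Lemma lacunary_tail (N : nat) (lam : nat -> Cplx) : lacunary lam -> lacunary (tail_seq N lam).
Proof.
  intros [H1 H2]. split; intros n; unfold tail_seq; [apply H1|].
  rewrite Nat.add_succ_r. apply H2.
Qed.

Lemma lacunary_inv_bound (lam : nat -> Cplx) : lacunary lam ->
  0 < / Cnorm (lam O) /\ 2 * / Cnorm (tail_seq 1 lam O) <= / Cnorm (lam O).
Proof.
  intros [H1 H2]. assert (P := Cnorm_pos _ (H1 O)). specialize (H2 O). split.
  - now apply Rinv_0_lt_compat.
  - unfold tail_seq. simpl. apply Rmult_le_reg_l with (Cnorm (lam 1%nat)); [lra|].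
    replace (Cnorm (lam 1%nat) * (2 * / Cnorm (lam 1%nat))) with 2 by (field; lra).
    apply Rmult_le_reg_r with (Cnorm (lam O)); [assumption|].
    rewrite Rmult_assoc, Rinv_l by lra. lra.
Qed.

Arguments geo : simpl never.

Lemma geo_zero_S (j : nat) : geo Czero (S j) = Czero.
Proof. unfold geo; simpl; ring. Qed.

Lemma pcoef_0 (n : nat) (lam : nat -> Cplx) : pcoef n lam O = Cone.
Proof.
  revert lam. induction n; intros lam; [reflexivity|]. simpl. rewrite IHn. ring.
Qed.

Lemma Cnorm_mulz_S (u : nat -> Cplx) (j : nat) : Cnorm (mulz u (S j)) = INR (S j) * Cnorm (u j).
Proof. unfold mulz. rewrite Cnorm_mul, Cnorm_RtoC, Rabs_pos_eq by apply pos_INR. reflexivity. Qed.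

Lemma INR_S_le_pow2 (j : nat) : 1 + INR j <= 2 ^ j.
Proof. induction j; [simpl; lra|]. rewrite S_INR. simpl. assert (P := pos_INR j). lra. Qed.

(** With t = 1 / |lam 0|, doubling of the moduli gives 2 / |lam 1| <= t, so the tail product has
    derivatives at most t^j. The factor 1 - z / lam 0 costs 1 + j <= 2^j, which restores the bound
    (2 t)^j. *)
Lemma pcoef_bound (n : nat) (lam : nat -> Cplx) (j : nat) : lacunary lam ->
  Cnorm (pcoef n lam j) <= (2 * / Cnorm (lam O)) ^ j.
Proof.
  revert lam j. induction n; intros lam j HL; assert (HB := lacunary_inv_bound lam HL); destruct HB as [P B].
  - destruct j; simpl pcoef.
    + unfold geo. simpl. rewrite Cnorm_one. lra.
    + rewrite geo_zero_S, Cnorm_zero. apply pow_le. lra.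
  - simpl pcoef. eapply Rle_trans; [apply Cnorm_add|]. rewrite Cnorm_mul, Cnorm_opp, Cnorm_inv by apply HL.
    set (t := / Cnorm (lam O)) in *.
    assert (HT := lacunary_tail 1 lam HL).
    assert (PT : 0 <= 2 * / Cnorm (tail_seq 1 lam O)).
    { destruct (lacunary_inv_bound _ HT). lra. }
    assert (IH : forall i, Cnorm (pcoef n (tail_seq 1 lam) i) <= t ^ i).
    { intros i. eapply Rle_trans; [now apply IHn|]. apply pow_incr. lra. }
    destruct j.
    + simpl. rewrite Cnorm_zero. specialize (IH O). simpl in IH. lra.
    + rewrite Cnorm_mulz_S. assert (IH1 := IH (S j)). assert (IH2 := IH j).
      assert (Pj : 0 < t ^ S j) by (now apply pow_lt).
      assert (Q := INR_S_le_pow2 (S j)). assert (PN := pos_INR (S j)).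
      apply Rle_trans with (t ^ S j + t * (INR (S j) * t ^ j)).
      * apply Rplus_le_compat; [assumption|]. apply Rmult_le_compat_l; [lra|].
        apply Rmult_le_compat_l; assumption.
      * rewrite Rpow_mult_distr.
        replace (t ^ S j + t * (INR (S j) * t ^ j)) with ((1 + INR (S j)) * t ^ S j) by (simpl pow; ring).
        apply Rmult_le_compat_r; lra.
Qed.

Definition pdiff (n : nat) (lam : nat -> Cplx) (j : nat) : Cplx :=
  (pcoef (S n) lam j - pcoef n lam j)%C.

Lemma pdiff_S (n : nat) (lam : nat -> Cplx) (j : nat) :
  pdiff (S n) lam j = (pdiff n (tail_seq 1 lam) j + (- Cinv (lam O)) * mulz (pdiff n (tail_seq 1 lam)) j)%C.
Proof.
  unfold pdiff.
  change (pcoef (S (S n)) lam j) with (pcoef (S n) (tail_seq 1 lam) j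
    + (- Cinv (lam O)) * mulz (pcoef (S n) (tail_seq 1 lam)) j)%C.
  change (pcoef (S n) lam j) with (pcoef n (tail_seq 1 lam) j
    + (- Cinv (lam O)) * mulz (pcoef n (tail_seq 1 lam)) j)%C.
  destruct j; unfold mulz; ring.
Qed.

Lemma pdiff_0 (n : nat) (lam : nat -> Cplx) : pdiff n lam O = Czero.
Proof. unfold pdiff. rewrite !pcoef_0. ring. Qed.

Lemma INR_SS_le_pow2 (j : nat) : (2 <= j)%nat -> 2 + INR j <= 2 ^ j.
Proof.
  induction 1; [simpl; lra|]. rewrite S_INR. simpl. assert (P := pos_INR m). lra.
Qed.

(** The induction of [pcoef_bound] with twice the base: passing to the tail halves it, and 2 + j <=
    2^j for j >= 2 leaves the additional factor 1/2. Order 0 vanishes, as all products have constant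
    term 1, and order 1 is direct. *)
Lemma pdiff_bound (n : nat) (lam : nat -> Cplx) (j : nat) : lacunary lam ->
  Cnorm (pdiff n lam j) <= (4 * / Cnorm (lam O)) ^ j * (/ 2) ^ n.
Proof.
  revert lam j. induction n; intros lam j HL; destruct (lacunary_inv_bound lam HL) as [P B];
    set (t := / Cnorm (lam O)) in *.
  - unfold pdiff. simpl pcoef.
    replace (geo Czero j + - Cinv (lam O) * mulz (geo Czero) j - geo Czero j)%C
      with (- Cinv (lam O) * mulz (geo Czero) j)%C by ring.
    rewrite Cnorm_mul, Cnorm_opp, Cnorm_inv by apply HL. fold t.
    destruct j as [|[|j]].
    + simpl. rewrite Cnorm_zero. lra.
    + rewrite Cnorm_mulz_S. unfold geo. simpl. rewrite Cnorm_one. lra.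
    + rewrite Cnorm_mulz_S, geo_zero_S, Cnorm_zero. 
      assert (0 <= (4 * t) ^ S (S j)) by (apply pow_le; lra). simpl ((/ 2) ^ 0). lra.
  - rewrite pdiff_S. eapply Rle_trans; [apply Cnorm_add|].
    rewrite Cnorm_mul, Cnorm_opp, Cnorm_inv by apply HL. fold t.
    assert (HT := lacunary_tail 1 lam HL).
    assert (PT : 0 <= 4 * / Cnorm (tail_seq 1 lam O)).
    { destruct (lacunary_inv_bound _ HT). lra. }
    assert (P2 : 0 < (/ 2) ^ n) by (apply pow_lt; lra).
    assert (IH : forall i, Cnorm (pdiff n (tail_seq 1 lam) i) <= (2 * t) ^ i * (/ 2) ^ n).
    { intros i. eapply Rle_trans; [now apply IHn|]. apply Rmult_le_compat_r; [lra|].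
      apply pow_incr. lra. }
    destruct j as [|[|j]].
    + simpl mulz. rewrite pdiff_0, !Cnorm_zero. simpl. lra.
    + rewrite Cnorm_mulz_S, pdiff_0, Cnorm_zero. specialize (IH 1%nat). simpl in *. lra.
    + rewrite Cnorm_mulz_S. assert (IH1 := IH (S (S j))). assert (IH2 := IH (S j)).
      assert (Q := INR_SS_le_pow2 (S (S j)) ltac:(lia)). assert (PN := pos_INR (S (S j))).
      set (q := (/ 2) ^ n) in *.
      apply Rle_trans with ((2 * t) ^ S (S j) * q + t * (INR (S (S j)) * ((2 * t) ^ S j * q))).
      * apply Rplus_le_compat; [assumption|]. apply Rmult_le_compat_l; [lra|].
        apply Rmult_le_compat_l; assumption.
      * replace (4 * t) with (2 * (2 * t)) by ring. rewrite (Rpow_mult_distr 2 (2 * t)).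
        assert (P3 : 0 < (2 * t) ^ S (S j)) by (apply pow_lt; lra).
        replace ((/ 2) ^ S n) with (/ 2 * q) by (unfold q; simpl; ring).
        replace ((2 * t) ^ S (S j) * q + t * (INR (S (S j)) * ((2 * t) ^ S j * q)))
          with ((2 + INR (S (S j))) * ((2 * t) ^ S (S j) * (/ 2 * q))) by (simpl pow; field).
        replace (2 ^ S (S j) * (2 * t) ^ S (S j) * (/ 2 * q))
          with (2 ^ S (S j) * ((2 * t) ^ S (S j) * (/ 2 * q))) by ring.
        apply Rmult_le_compat_r; [nra|assumption].
Qed.

(** Derivatives at the origin of the infinite product, as the telescoping sum of the increments
    between partial products. *)
Definition plim (lam : nat -> Cplx) (j : nat) : Cplx :=
  (geo Czero j + csum (fun n => pdiff n lam j))%C.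

Lemma pcoef_telescope (n : nat) (lam : nat -> Cplx) (j : nat) :
  (pcoef n lam j = geo Czero j + Csum n (fun k => pdiff k lam j))%C.
Proof.
  induction n; simpl Csum; [simpl; ring|]. unfold pdiff at 2. rewrite IHn. ring.
Qed.

Lemma pcoef_plim (n : nat) (lam : nat -> Cplx) (j : nat) : lacunary lam ->
  Cnorm (pcoef n lam j - plim lam j) <= 2 * (/ 2) ^ n * (4 * / Cnorm (lam O)) ^ j.
Proof.
  intros HL. rewrite pcoef_telescope. unfold plim. rewrite Cnorm_sub_sym.
  replace (geo Czero j + csum (fun n0 => pdiff n0 lam j) - (geo Czero j + Csum n (fun k => pdiff k lam j)))%C
    with (csum (fun n => pdiff n lam j) - Csum n (fun k => pdiff k lam j))%C by ring.
  eapply Rle_trans; [apply (csum_tail _ ((4 * / Cnorm (lam O)) ^ j) (/ 2)); [lra|]|].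
  - intros i. now apply pdiff_bound.
  - right. field.
Qed.

Lemma pcoef_cv (lam : nat -> Cplx) (j : nat) : lacunary lam -> Ccv (fun n => pcoef n lam j) (plim lam j).
Proof.
  intros HL. apply (Ccv_squeeze _ _ (2 * (4 * / Cnorm (lam O)) ^ j) (/ 2)); [lra|].
  intros n. eapply Rle_trans; [now apply pcoef_plim|]. lra.
Qed.

Lemma plim_bound (lam : nat -> Cplx) (j : nat) : lacunary lam ->
  Cnorm (plim lam j) <= (2 * / Cnorm (lam O)) ^ j.
Proof.
  intros HL. apply (Ccv_norm_le _ _ _ 0 (pcoef_cv lam j HL)). intros; now apply pcoef_bound.
Qed.

Lemma plim_0 (lam : nat -> Cplx) : lacunary lam -> plim lam O = Cone.
Proof.
  intros HL. apply (Ccv_unique (fun n => pcoef n lam O)); [now apply pcoef_cv|].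
  apply (Ccv_ext (fun _ => Cone)); [|apply Ccv_const]. intros; now rewrite pcoef_0.
Qed.

Lemma plim_S (lam : nat -> Cplx) (j : nat) : lacunary lam ->
  plim lam j = (plim (tail_seq 1 lam) j + (- Cinv (lam O)) * mulz (plim (tail_seq 1 lam)) j)%C.
Proof.
  intros HL. assert (HT := lacunary_tail 1 lam HL).
  apply (Ccv_unique (fun n => pcoef n lam j)); [now apply pcoef_cv|].
  apply Ccv_shift. simpl. apply Ccv_add; [now apply pcoef_cv|]. apply Ccv_scal.
  destruct j; simpl mulz; [apply Ccv_const|]. apply Ccv_scal. now apply pcoef_cv.
Qed.

Lemma expo_type_plim (lam : nat -> Cplx) : lacunary lam -> expo_type (plim lam).
Proof.
  intros HL. exists 1, (2 * / Cnorm (lam O)). split.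
  - destruct (lacunary_inv_bound lam HL). lra.
  - intros j. rewrite Rmult_1_l. now apply plim_bound.
Qed.

Lemma expo_type_pcoef (n : nat) (lam : nat -> Cplx) : lacunary lam -> expo_type (pcoef n lam).
Proof.
  intros HL. exists 1, (2 * / Cnorm (lam O)). split.
  - destruct (lacunary_inv_bound lam HL). lra.
  - intros j. rewrite Rmult_1_l. now apply pcoef_bound.
Qed.

Lemma Cprod_front (n : nat) (u : nat -> Cplx) :
  Cprod (S n) u = (u O * Cprod n (fun i => u (S i)))%C.
Proof.
  induction n; [simpl; ring|]. change (Cprod (S (S n)) u) with (Cprod (S n) u * u (S n))%C.
  rewrite IHn. simpl. ring.
Qed.

Lemma ev_pcoef (n : nat) (lam : nat -> Cplx) (z : Cplx) : lacunary lam ->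
  ev (pcoef n lam) z = Cprod n (fun i => Cone - z / lam i)%C.
Proof.
  revert lam. induction n; intros lam HL.
  - simpl. rewrite ev_geo. replace (Czero * z)%C with Czero by ring. apply Cexp_zero.
  - assert (HT := lacunary_tail 1 lam HL). assert (X := expo_type_pcoef n _ HT).
    rewrite Cprod_front. simpl pcoef.
    rewrite ev_lin by auto using expo_type_entire_type, expo_type_mulz.
    rewrite (ev_iter_mulz 1 (pcoef n (tail_seq 1 lam))) by assumption. rewrite IHn by assumption.
    unfold tail_seq, Cdiv. simpl. ring.
Qed.

Lemma ev_plim (lam : nat -> Cplx) (z : Cplx) : lacunary lam ->
  Ccv (fun n => Cprod n (fun i => Cone - z / lam i)%C) (ev (plim lam) z).
Proof.
  intros HL. destruct (lacunary_inv_bound lam HL) as [P _].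
  set (t := 4 * / Cnorm (lam O)). assert (Pt : 0 < t) by (unfold t; lra).
  assert (It : 0 < / t) by (now apply Rinv_0_lt_compat).
  destruct (entire_type_geo z (/ 2 * / t)) as [K HK]; [lra|].
  apply (Ccv_squeeze _ _ (4 * K) (/ 2)); [lra|]. intros n. rewrite <- ev_pcoef by assumption.
  assert (E : (ev (pcoef n lam) z - ev (plim lam) z)%C
    = pairing (fun i => pcoef n lam i + (- Cone) * plim lam i)%C (geo z)).
  { rewrite pairing_lin_l; auto using expo_type_pcoef, expo_type_plim, entire_type_geo.
    unfold ev. rewrite !(pairing_sym (geo z)). ring. }
  rewrite E. replace (4 * K * (/ 2) ^ n) with (2 * (2 * (/ 2) ^ n * K)) by ring.
  apply (pairing_bound _ t K (/ 2 * / t)); [assumption|lra|right; field; lra| |assumption].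
  intros i. replace (pcoef n lam i + - Cone * plim lam i)%C with (pcoef n lam i - plim lam i)%C by ring.
  now apply pcoef_plim.
Qed.

Lemma ev_plim_zero (lam : nat -> Cplx) (n : nat) : lacunary lam -> ev (plim lam) (lam n) = Czero.
Proof.
  intros HL. apply (Ccv_unique (fun N => Cprod N (fun i => Cone - lam n / lam i)%C)); [now apply ev_plim|].
  intros eps He. exists (S n). intros N HN.
  replace (Cprod N (fun i => Cone - lam n / lam i)%C) with Czero.
  - replace (Czero - Czero)%C with Czero by ring. now rewrite Cnorm_zero.
  - symmetry. induction HN; simpl.
    + replace (Cone - lam n / lam n)%C with Czero by (field; apply HL). ring.
    + rewrite IHHN. ring.
Qed.

Lemma Ccv_bounded (u : nat -> Cplx) (l : Cplx) : Ccv u l -> exists K, forall n, Cnorm (u n) <= K.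
Proof.
  intros H. destruct (H 1 ltac:(lra)) as [N HN].
  assert (F : forall M, exists K, forall n, (n < M)%nat -> Cnorm (u n) <= K).
  { induction M as [|M [K HK]]; [exists 0; intros; lia|].
    exists (Rmax K (Cnorm (u M))). intros n Hn. destruct (Nat.eq_dec n M) as [->|D]; [apply Rmax_r|].
    eapply Rle_trans; [apply HK; lia|apply Rmax_l]. }
  destruct (F N) as [K HK]. exists (Rmax K (Cnorm l + 1)). intros n.
  destruct (Nat.lt_ge_cases n N) as [L|G].
  - eapply Rle_trans; [now apply HK|apply Rmax_l].
  - eapply Rle_trans; [|apply Rmax_r]. specialize (HN n G).
    assert (T := Cnorm_sub_ge (u n) l). lra.
Qed.

(** Convergence at the real point 1 / e bounds the terms there, so the j! a_j have entire type;
    uniqueness of power series then identifies them with the derivatives of the product. *)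
Lemma product_coefficients (lam a : nat -> Cplx) : lacunary lam ->
  (forall z, exists w,
      Ccv (fun N => Cprod N (fun n => Csub Cone (Cdiv z (lam n)))) w /\
      Cseries (fun j => Cmul (a j) (Cpow z j)) w) ->
  forall j, (RtoC (factR j) * a j)%C = plim lam j.
Proof.
  intros HL HG. set (v := fun j => (RtoC (factR j) * a j)%C).
  assert (Hv : entire_type v).
  { intros e He. assert (Ie : 0 < / e) by (now apply Rinv_0_lt_compat).
    destruct (HG (RtoC (/ e))) as [w [_ Hw]]. destruct (Ccv_bounded _ _ Hw) as [K HK].
    exists (2 * K). intros j. assert (F := factR_pos j).
    assert (B : Cnorm (a j) * (/ e) ^ j <= 2 * K).
    { assert (K1 := HK j). assert (K2 := HK (S j)).
      replace (Cnorm (a j) * (/ e) ^ j) with (Cnorm (a j * Cpow (RtoC (/ e)) j)%C).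
      - replace (a j * Cpow (RtoC (/ e)) j)%C with (Csum (S j) (fun j => a j * Cpow (RtoC (/ e)) j)
          - Csum j (fun j => a j * Cpow (RtoC (/ e)) j))%C by (simpl; ring).
        eapply Rle_trans; [apply Cnorm_sub|]. lra.
      - rewrite Cnorm_mul, Cnorm_pow, Cnorm_RtoC, Rabs_pos_eq by lra. reflexivity. }
    unfold v. rewrite Cnorm_mul, Cnorm_RtoC, Rabs_pos_eq, Rmult_comm by lra.
    apply Rmult_le_compat_r; [lra|]. assert (Pe : 0 < e ^ j) by (now apply pow_lt).
    apply (Rmult_le_compat_r (e ^ j)) in B; [|lra].
    rewrite pow_inv, Rmult_assoc, Rinv_l, Rmult_1_r in B by lra. exact B. }
  apply (ev_inj v (plim lam)); [assumption|now apply expo_type_entire_type, expo_type_plim|].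
  intros z. destruct (HG z) as [w [Hw1 Hw2]].
  rewrite (Ccv_unique _ _ _ (ev_plim lam z HL) Hw1). apply csum_eq.
  apply (Cseries_ext (fun j => a j * Cpow z j)%C); [|assumption].
  intros i. unfold pterm, geo, v. assert (F := factR_pos i). rewrite RtoC_inv by lra.
  field. apply RtoC_neq0. lra.
Qed.

Lemma lacunary_growth (lam : nat -> Cplx) (n k : nat) : lacunary lam ->
  Cnorm (lam n) * 2 ^ k <= Cnorm (lam (n + k)%nat).
Proof.
  intros [_ H]. induction k; [rewrite Nat.add_0_r; simpl; lra|].
  rewrite Nat.add_succ_r. specialize (H (n + k)%nat). simpl. lra.
Qed.

Lemma lacunary_neq (lam : nat -> Cplx) (n N : nat) : lacunary lam -> (n < N)%nat -> lam n <> lam N.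
Proof.
  intros HL Hn E. assert (G := lacunary_growth lam n (N - n) HL).
  replace (n + (N - n))%nat with N in G by lia. rewrite E in G.
  assert (P := Cnorm_pos _ (proj1 HL N)).
  assert (2 <= 2 ^ (N - n)).
  { destruct (N - n)%nat eqn:D; [lia|]. simpl. assert (1 <= 2 ^ n0) by (apply pow_R1_Rle; lra). lra. }
  nra.
Qed.

(* Removing one zero of the symbol amounts to solving a first-order recursion, so after
   removing the first [N] zeros one is left with a combination of [N] geometric sequences. *)
Lemma tail_product_geometric (lam phi : nat -> Cplx) : lacunary lam -> entire_type phi ->
  (forall l, pairing (plim lam) (shiftn l phi) = Czero) ->
  forall N, exists b, forall i,
    pairing (plim (tail_seq N lam)) (shiftn i phi) = Csum N (fun n => b n * geo (lam n) i)%C.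
Proof.
  intros HL Hphi H0. induction N as [|N [b Hb]].
  - exists (fun _ => Czero). intros i. apply (H0 i).
  (* A particular solution of v_i - v_(i+1) / lam N = sum of b_n (lam n)^i, found termwise; 1 - lam
     n / lam N is non-zero by lacunarity. Homogeneous solutions are multiples of (lam N)^i. *)
  - set (w := fun i => Csum N (fun n => b n / (Cone - lam n / lam N) * geo (lam n) i)%C).
    set (v := fun i => pairing (plim (tail_seq (S N) lam)) (shiftn i phi)).
    assert (HLN := lacunary_tail N lam HL).
    assert (ET : tail_seq 1 (tail_seq N lam) = tail_seq (S N) lam).
    { apply functional_extensionality. intros n. unfold tail_seq. f_equal. lia. }
    assert (E0 : tail_seq N lam O = lam N) by (unfold tail_seq; f_equal; lia).
    assert (NZ := proj1 HL N).
    assert (rec : forall i, (Csum N (fun n => b n * geo (lam n) i) = v i - v (S i) / lam N)%C).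
    { intros i. rewrite <- Hb.
      rewrite (functional_extensionality _ _ (fun j => plim_S (tail_seq N lam) j HLN)).
      rewrite ET, E0. assert (X := expo_type_plim _ (lacunary_tail (S N) lam HL)).
      rewrite pairing_lin_l by auto using expo_type_mulz, entire_type_shiftn.
      rewrite pairing_mulz by auto using entire_type_shiftn.
      rewrite shiftn_shiftn, Nat.add_1_r. unfold v, Cdiv. ring. }
    assert (wrec : forall i, (Csum N (fun n => b n * geo (lam n) i) = w i - w (S i) / lam N)%C).
    { intros i. unfold w, Cdiv at 3.
      replace (Csum N (fun n => b n / (Cone - lam n / lam N) * geo (lam n) (S i)) * Cinv (lam N))%C
        with (Csum N (fun n => Cinv (lam N) * (b n / (Cone - lam n / lam N) * geo (lam n) (S i))))%C
        by (rewrite Csum_scal; ring).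
      rewrite <- Csum_sub. apply Csum_ext. intros n Hn. unfold geo. simpl Cpow.
      assert (D : (lam N - lam n)%C <> Czero).
      { intros D. apply Csub_eq0 in D. symmetry in D. revert D. now apply lacunary_neq. }
      field. split; assumption. }
    exists (fun n => if Nat.eq_dec n N then v O - w O else b n / (Cone - lam n / lam N))%C.
    intros i. fold (v i). simpl Csum.
    assert (step : forall i, (v (S i) - w (S i) = lam N * (v i - w i))%C).
    { intros k. assert (E := rec k). rewrite wrec in E.
      replace (v (S k)) with (lam N * (v k - (v k - v (S k) / lam N)))%C by (field; assumption).
      rewrite <- E. field. assumption. }
    assert (sol : forall i, (v i - w i = (v O - w O) * geo (lam N) i)%C).
    { intros k. induction k; [unfold geo; simpl; ring|]. rewrite step, IHk. unfold geo. simpl. ring. }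
    replace (v i) with (w i + (v i - w i))%C by ring. rewrite sol. f_equal.
    + unfold w. apply Csum_ext. intros n Hn. destruct (Nat.eq_dec n N); [lia|reflexivity].
    + destruct (Nat.eq_dec N N); [reflexivity|congruence].
Qed.

Theorem kernel_synthesis (lam phi u : nat -> Cplx) : lacunary lam -> entire_type phi -> expo_type u ->
  (forall l, pairing (plim lam) (shiftn l phi) = Czero) ->
  (forall n, ev u (lam n) = Czero) -> pairing u phi = Czero.
Proof.
  intros HL Hphi Hu H0 Hz.
  assert (Hu' := Hu). destruct Hu' as [C [A [HA Bu]]]. assert (HC := expo_bound_pos _ _ _ Bu).
  (* The summand 1 ensures D > 1, hence s^(j+1) <= s D^(j+1) for s = 2 / |lam N|: the small factor s
     splits off while the growth rate stays independent of N. *)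
  destruct (lacunary_inv_bound lam HL) as [Pt _]. set (B := 2 * / Cnorm (lam O) + 1).
  set (D := A + B). assert (HD : 1 < D) by (unfold D, B; lra).
  assert (ID : 0 < / D) by (apply Rinv_0_lt_compat; lra).
  destruct (Hphi (/ 4 * / D)) as [K HK]; [lra|]. assert (PK := fact_bound_pos _ _ _ HK).
  assert (ED : 2 * (/ 4 * / D) = / 2 * / D) by (field; lra).
  assert (bound : forall N, Cnorm (pairing u phi) <= 4 * C * K * (2 * / Cnorm (lam N))).
  { intros N. set (s := 2 * / Cnorm (lam N)).
    assert (HLN := lacunary_tail N lam HL).
    assert (E0 : tail_seq N lam O = lam N) by (unfold tail_seq; f_equal; lia).
    assert (PN := Cnorm_pos _ (proj1 HL N)).
    assert (Hs : 0 < s). { unfold s. assert (0 < / Cnorm (lam N)) by (now apply Rinv_0_lt_compat). lra. }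
    assert (HsB : s <= B).
    { unfold s, B. assert (G := lacunary_growth lam 0 N HL). simpl in G.
      assert (P0 := Cnorm_pos _ (proj1 HL O)).
      assert (1 <= 2 ^ N) by (apply pow_R1_Rle; lra).
      assert (/ Cnorm (lam N) <= / Cnorm (lam O)) by (apply Rinv_le_contravar; nra). lra. }
    destruct (tail_product_geometric lam phi HL Hphi H0 N) as [b Hb].
    set (v := fun i => pairing (plim (tail_seq N lam)) (shiftn i phi)).
    assert (Xp := expo_type_plim _ HLN).
    assert (Tv : entire_type v) by (now apply entire_type_pairing_shiftn).
    assert (Zv : pairing u v = Czero).
    { replace v with (fun i => Csum N (fun n => b n * geo (lam n) i)%C)
        by (apply functional_extensionality; intros; symmetry; apply Hb).
      destruct (pairing_Csum N b u (fun n => geo (lam n)) Hu (fun n => entire_type_geo _)) as [_ E].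
      rewrite E. apply Csum_zero. intros n _. rewrite pairing_sym. fold (ev u (lam n)). rewrite Hz. ring. }
    (* Pairing with [geo Czero] returns the derivative itself, so phi - v is minus the pairing with
       the tail product less 1, whose derivatives all carry the factor s. *)
    assert (Bv : fact_bound (2 * (s * K)) (/ 2 * / D) (fun i => phi i + (- Cone) * v i)%C).
    { intros i.
      assert (E : (phi i + - Cone * v i)%C
        = (- pairing (fun j => plim (tail_seq N lam) j + (- Cone) * geo Czero j) (shiftn i phi))%C).
      { rewrite pairing_lin_l by auto using expo_type_geo, entire_type_shiftn.
        fold (ev (shiftn i phi) Czero). rewrite ev_zero by now apply entire_type_shiftn.
        unfold v, shiftn at 3. rewrite Nat.add_0_r. ring. }
      rewrite E, Cnorm_opp.
      assert (BB := fact_bound_shiftn K (/ 4 * / D) i phi ltac:(lra) HK). rewrite ED in BB.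
      eapply Rle_trans.
      - apply (pairing_bound s D (K * (/ 2 * / D) ^ i * factR i) (/ 2 * / D)); [lra|lra|right; field; lra| |exact BB].
        intros j. destruct j.
        + rewrite plim_0 by assumption. unfold geo. simpl.
          replace (Cone + - Cone * Cone)%C with Czero by ring. rewrite Cnorm_zero. lra.
        + rewrite geo_zero_S.
          replace (plim (tail_seq N lam) (S j) + - Cone * Czero)%C with (plim (tail_seq N lam) (S j)) by ring.
          eapply Rle_trans; [now apply plim_bound|]. rewrite E0. fold s. simpl pow.
          apply Rmult_le_compat_l; [lra|].
          assert (s ^ j <= D ^ j) by (apply pow_incr; unfold D; lra).
          assert (0 < D ^ j) by (apply pow_lt; lra). nra.
      - right. ring. }
    assert (HAD : A * (/ 2 * / D) <= / 2).
    { apply Rle_trans with (D * (/ 2 * / D)); [|right; field; lra].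
      apply Rmult_le_compat_r; [lra|]. unfold D, B. lra. }
    assert (X := pairing_bound C A (2 * (s * K)) (/ 2 * / D) u _ HA ltac:(lra) HAD Bu Bv).
    rewrite pairing_lin_r, Zv in X by assumption.
    replace (pairing u phi + - Cone * Czero)%C with (pairing u phi) in X by ring. lra. }
  apply Cnorm_eq0, Rle_antisym; [|apply Cnorm_ge0]. apply le_epsilon. intros eps He. rewrite Rplus_0_l.
  assert (P0 := Cnorm_pos _ (proj1 HL O)).
  set (q := 8 * C * K * / Cnorm (lam O)).
  assert (Hq : 0 <= q) by (unfold q; repeat apply Rmult_le_pos; lra).
  destruct (geometric_small (/ 2) q eps) as [N HN]; [lra|assumption|assumption|].
  specialize (HN N (le_n N)). assert (P2 : 0 < (/ 2) ^ N) by (apply pow_lt; lra). eapply Rle_trans; [apply (bound N)|].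
  assert (G := lacunary_growth lam 0 N HL). simpl in G.
  assert (P3 : 0 < 2 ^ N) by (apply pow_lt; lra).
  assert (I1 : / Cnorm (lam N) <= / Cnorm (lam O) * (/ 2) ^ N).
  { rewrite pow_inv, <- Rinv_mult. apply Rinv_le_contravar; [now apply Rmult_lt_0_compat|assumption]. }
  assert (PCK : 0 <= 4 * C * K) by (repeat apply Rmult_le_pos; lra).
  apply Rle_trans with (q * (/ 2) ^ N).
  - unfold q. apply Rle_trans with (4 * C * K * (2 * (/ Cnorm (lam O) * (/ 2) ^ N))).
    + apply Rmult_le_compat_l; lra.
    + right; ring.
  - lra.
Qed.

(** * Ideals and dual bases *)

Lemma ev_mulz (w : nat -> Cplx) (z : Cplx) : entire_type w -> ev (mulz w) z = (z * ev w z)%C.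
Proof.
  intros Hw. apply csum_eq. apply Ccv_shift.
  apply (Ccv_ext (fun n => z * Csum n (pterm (geo z) w))%C).
  - intros n. induction n.
    + simpl. unfold pterm, mulz. ring.
    + change (Csum (S (S n)) (pterm (geo z) (mulz w)))
        with (Csum (S n) (pterm (geo z) (mulz w)) + pterm (geo z) (mulz w) (S n))%C.
      rewrite <- IHn. simpl Csum.
      assert (E : (z * pterm (geo z) w n)%C = pterm (geo z) (mulz w) (S n)); [|rewrite <- E; ring].
      unfold pterm, mulz, geo. assert (F := factR_pos n). assert (F2 := pos_INR n).
      assert (E : RtoC (/ factR n) = (RtoC (/ factR (S n)) * RtoC (INR (S n)))%C).
      { rewrite <- RtoC_mul. f_equal. change (fact (S n)) with (S n * fact n)%nat.
        rewrite mult_INR, S_INR. field. lra. }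
      rewrite E. simpl Cpow. ring.
  - apply Ccv_scal. apply pairing_series; [apply expo_type_geo|assumption].
Qed.

Lemma entire_type_mulz (w : nat -> Cplx) : entire_type w -> entire_type (mulz w).
Proof.
  intros Hw e He. destruct (Hw e He) as [K HK]. assert (PK := fact_bound_pos _ _ _ HK).
  exists (K * / e). assert (Ie : 0 < / e) by (now apply Rinv_0_lt_compat). intros [|i].
  - simpl. rewrite Cnorm_zero. nra.
  - rewrite Cnorm_mulz_S. change (fact (S i)) with (S i * fact i)%nat. rewrite mult_INR.
    replace (K * / e * e ^ S i * (INR (S i) * factR i)) with (INR (S i) * (K * e ^ i * factR i))
      by (simpl pow; field; lra).
    apply Rmult_le_compat_l; [apply pos_INR|apply HK].
Qed.

Lemma entire_type_iter_mulz (m : nat) (w : nat -> Cplx) : entire_type w -> entire_type (Nat.iter m mulz w).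
Proof. intros H. induction m; [assumption|]. now apply entire_type_mulz. Qed.

Lemma ev_iter_mulz_entire (m : nat) (w : nat -> Cplx) (z : Cplx) : entire_type w ->
  ev (Nat.iter m mulz w) z = (Cpow z m * ev w z)%C.
Proof.
  intros Hw. induction m; simpl; [ring|].
  rewrite ev_mulz, IHm by now apply entire_type_iter_mulz. ring.
Qed.

Lemma iter_mulz_low (m : nat) (w : nat -> Cplx) (j : nat) : (j < m)%nat -> Nat.iter m mulz w j = Czero.
Proof.
  revert j. induction m; intros j Hj; [lia|]. simpl. destruct j; [reflexivity|].
  unfold mulz. rewrite IHm by lia. ring.
Qed.

(** Each division by z shifts the sequence and divides by the index. The last clause preserves the
    information that the multiplicity is exact. *)
Lemma divide_power (m : nat) (v : nat -> Cplx) : entire_type v ->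
  (forall j, (j < m)%nat -> v j = Czero) ->
  exists w, entire_type w /\ (forall z, ev v z = Cpow z m * ev w z)%C /\
    (v m <> Czero -> w O <> Czero).
Proof.
  revert v. induction m; intros v Hv Hz.
  - exists v. split; [assumption|]. split; [intros; simpl; ring|auto].
  - set (w := fun i => (Cinv (RtoC (INR (S i))) * v (S i))%C).
    assert (NI : forall i, RtoC (INR (S i)) <> Czero).
    { intros i. apply RtoC_neq0. apply not_0_INR. lia. }
    assert (Ew : v = mulz w).
    { apply functional_extensionality. intros [|i]; [apply Hz; lia|].
      unfold mulz, w. field. apply NI. }
    assert (Hw : entire_type w).
    { intros e He. destruct (Hv e He) as [K HK]. assert (PK := fact_bound_pos _ _ _ HK).
      exists (K * e). intros i. unfold w.
      rewrite Cnorm_mul, Cnorm_inv, Cnorm_RtoC, Rabs_pos_eq by (try apply NI; apply pos_INR).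
      assert (PI := pos_INR i).
      specialize (HK (S i)). change (fact (S i)) with (S i * fact i)%nat in HK.
      rewrite mult_INR in HK. rewrite S_INR in *.
      apply Rmult_le_reg_l with (INR i + 1); [lra|].
      rewrite <- Rmult_assoc, Rinv_r, Rmult_1_l by lra. simpl pow in HK. lra. }
    destruct (IHm w Hw) as [g [Hg [Eg Ng]]].
    { intros j Hj. unfold w. rewrite Hz by lia. ring. }
    exists g. split; [assumption|]. split.
    + intros z. rewrite Ew, ev_mulz, Eg by assumption. simpl. ring.
    + intros N. apply Ng. unfold w. apply Cmul_neq0; [|assumption]. apply Cinv_neq0, NI.
Qed.

Lemma Ccont_nonzero (f : Cplx -> Cplx) (z : Cplx) : Ccont f z -> f z <> Czero ->
  exists d, 0 < d /\ forall w, Cnorm (w - z) < d -> f w <> Czero.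
Proof.
  intros Hc N. destruct (Hc (Cnorm (f z)) (Cnorm_pos _ N)) as [d [Hd H]].
  exists d. split; [assumption|]. intros w Hw E. specialize (H w Hw). rewrite E in H.
  replace (Czero - f z)%C with (- f z)%C in H by ring. rewrite Cnorm_opp in H. lra.
Qed.

Definition jets_vanish (mu : nat -> Cplx) (m : nat -> nat) (v : nat -> Cplx) : Prop :=
  forall k j, (j < m k)%nat -> ev (shiftn j v) (mu k) = Czero.

Lemma jets_factor (mu : nat -> Cplx) (m : nat -> nat) (v : nat -> Cplx) (k : nat) :
  entire_type v -> jets_vanish mu m v ->
  exists w, entire_type w /\ (forall z, ev v (mu k + z)%C = Cpow z (m k) * ev w z)%C /\
    (ev (shiftn (m k) v) (mu k) <> Czero -> ev w Czero <> Czero).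
Proof.
  intros Hv Hj. destruct (translate_spec v (mu k) Hv) as [Ht Et].
  destruct (divide_power (m k) (translate (mu k) v) Ht) as [w [Hw [Ew Nw]]].
  - intros j Hjm. now apply Hj.
  - exists w. split; [assumption|]. split.
    + intros z. now rewrite Et.
    + intros N. rewrite ev_zero by assumption. apply Nw, N.
Qed.

(** Local quotients agree wherever psi is non-zero, so z |-> g_z(z) coincides near z with the single
    function g_z and inherits its differentiability. *)
Lemma local_to_entire_quotient (f psi : Cplx -> Cplx) :
  (forall z, exists g d, 0 < d /\ (exists l, cdiff g z l) /\ f z = (g z * psi z)%C /\
     forall w, 0 < Cnorm (w - z) < d -> psi w <> Czero /\ f w = (g w * psi w)%C) ->
  exists r, entire r /\ forall z, f z = (r z * psi z)%C.
Proof.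
  intros H.
  assert (G : forall z, {g : Cplx -> Cplx | exists d, 0 < d /\ (exists l, cdiff g z l) /\ f z = (g z * psi z)%C /\
     forall w, 0 < Cnorm (w - z) < d -> psi w <> Czero /\ f w = (g w * psi w)%C})
    by (intros z; apply constructive_indefinite_description, H).
  exists (fun z => proj1_sig (G z) z).
  assert (E : forall z, f z = (proj1_sig (G z) z * psi z)%C).
  { intros z. destruct (proj2_sig (G z)) as [d [_ [_ [X _]]]]. exact X. }
  split; [|exact E]. apply entire_cdiff. intros z.
  destruct (proj2_sig (G z)) as [d [Hd [[l Hl] [_ Hw]]]]. exists l.
  apply (cdiff_local (proj1_sig (G z)) _ _ _ d Hd); [|exact Hl].
  intros w Hwd. destruct (classic (w = z)) as [->|N]; [reflexivity|].
  assert (P : 0 < Cnorm (w - z)) by (apply Cnorm_pos; intros X; apply N, Csub_eq0, X).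
  destruct (Hw w (conj P Hwd)) as [Np Ef].
  assert (Ew := eq_trans (eq_sym Ef) (E w)).
  apply Csub_eq0. destruct (Cmul_integral (proj1_sig (G z) w - proj1_sig (G w) w)%C (psi w)) as [X|X];
    [|exact X|contradiction].
  replace ((proj1_sig (G z) w - proj1_sig (G w) w) * psi w)%C
    with (proj1_sig (G z) w * psi w - proj1_sig (G w) w * psi w)%C by ring.
  rewrite Ew. ring.
Qed.

Lemma cdiff_ev_sub (w : nat -> Cplx) (z : Cplx) : entire_type w ->
  exists l, cdiff (fun x => ev w (x + - z)%C) z l.
Proof.
  intros Hw. eexists. apply (cdiff_comp (fun x => x + - z)%C (ev w)).
  - apply cdiff_add; [apply cdiff_id|apply cdiff_const].
  - now apply cdiff_ev.
Qed.

(** At a node the power (x - mu_k)^(m_k) cancels from both functions, and the cofactor of psi is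
    non-zero there because its multiplicity is exact; elsewhere psi itself is non-zero. *)
Theorem ideal_of_jets (mu : nat -> Cplx) (m : nat -> nat) (psi v : nat -> Cplx) :
  entire_type psi -> jets_vanish mu m psi ->
  (forall k, ev (shiftn (m k) psi) (mu k) <> Czero) ->
  (forall z, ev psi z = Czero -> exists k, z = mu k) ->
  entire_type v -> jets_vanish mu m v ->
  exists r, entire r /\ forall z, ev v z = (r z * ev psi z)%C.
Proof.
  intros Hpsi Jpsi Npsi Zpsi Hv Jv. apply local_to_entire_quotient. intros z.
  destruct (classic (ev psi z = Czero)) as [E|N].
  - destruct (Zpsi z E) as [k ->].
    destruct (jets_factor mu m psi k Hpsi Jpsi) as [p [Hp [Ep Np]]].
    destruct (jets_factor mu m v k Hv Jv) as [q [Hq [Eq _]]].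
    specialize (Np (Npsi k)).
    destruct (Ccont_nonzero (ev p) Czero (entire_Ccont _ _ (entire_ev p Hp)) Np) as [d [Hd Hnz]].
    destruct (cdiff_ev_sub p (mu k) Hp) as [l1 H1]. destruct (cdiff_ev_sub q (mu k) Hq) as [l2 H2].
    assert (V : forall x, ev v x = (Cpow (x + - mu k) (m k) * ev q (x + - mu k))%C).
    { intros x. rewrite <- Eq. f_equal. ring. }
    assert (P : forall x, ev psi x = (Cpow (x + - mu k) (m k) * ev p (x + - mu k))%C).
    { intros x. rewrite <- Ep. f_equal. ring. }
    assert (Z0 : (mu k + - mu k)%C = Czero) by ring.
    exists (fun x => ev q (x + - mu k) / ev p (x + - mu k))%C, d.
    split; [assumption|]. split; [|split].
    + apply (cdiff_div _ _ _ _ _ H2 H1). now rewrite Z0.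
    + rewrite V, P. field. now rewrite Z0.
    + intros w [Hw1 Hw2].
      assert (Nw : ev p (w + - mu k)%C <> Czero).
      { apply Hnz. now replace (w + - mu k - Czero)%C with (w - mu k)%C by ring. }
      split.
      * rewrite P. apply Cmul_neq0; [|assumption]. apply Cpow_neq0, Cnorm_gt0_neq. exact Hw1.
      * rewrite V, P. field. exact Nw.
  - destruct (Ccont_nonzero (ev psi) z (entire_Ccont _ _ (entire_ev psi Hpsi)) N) as [d [Hd Hnz]].
    exists (fun x => ev v x / ev psi x)%C, d. split; [assumption|]. split; [|split].
    + apply (cdiff_div _ _ _ _ _ (cdiff_ev v z Hv) (cdiff_ev psi z Hpsi) N).
    + field. exact N.
    + intros w [_ Hw]. specialize (Hnz w Hw). split; [assumption|]. field. exact Hnz.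
Qed.

(** Factoring psi at the node replaces the Leibniz rule: the translated product is an m_k-fold
    multiplication by the variable, whose entries of order below m_k are zero. *)
Lemma jets_of_ideal (mu : nat -> Cplx) (m : nat -> nat) (psi v : nat -> Cplx) (r : Cplx -> Cplx) :
  entire_type psi -> jets_vanish mu m psi -> entire r -> entire_type v ->
  (forall z, ev v z = (r z * ev psi z)%C) -> jets_vanish mu m v.
Proof.
  intros Hpsi Jpsi Hr Hv E k j Hj.
  destruct (jets_factor mu m psi k Hpsi Jpsi) as [p [Hp [Ep _]]].
  destruct (entire_as_ev (fun z => r (mu k + z) * ev p z)%C) as [g [Hg [Eg _]]].
  { apply entire_mul; [now apply entire_translate|now apply entire_ev]. }
  destruct (translate_spec v (mu k) Hv) as [Ht Et].
  assert (X : translate (mu k) v j = Nat.iter (m k) mulz g j).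
  { apply ev_inj; [assumption|now apply entire_type_iter_mulz|].
    intros z. rewrite <- Et, E, ev_iter_mulz_entire, <- Eg, Ep by assumption. ring. }
  change (ev (shiftn j v) (mu k)) with (translate (mu k) v j). rewrite X. now apply iter_mulz_low.
Qed.

(** * Linear combinations and points dual to linearly independent functions *)

Lemma lin_comb_S (d : nat) (c : nat -> Cplx) (b : nat -> Cplx -> Cplx) (z : Cplx) :
  lin_comb (S d) c b z = (lin_comb d c b z + c d * b d z)%C.
Proof. reflexivity. Qed.

Lemma lin_comb_Csum (d n : nat) (c : nat -> Cplx) (t : nat -> nat -> Cplx) (b : nat -> Cplx -> Cplx) (z : Cplx) :
  Csum n (fun l => c l * lin_comb d (t l) b z)%C = lin_comb d (fun k => Csum n (fun l => c l * t l k)%C) b z.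
Proof.
  unfold lin_comb. rewrite (Csum_ext n _ (fun l => Csum d (fun k => c l * t l k * b k z))%C).
  - rewrite Csum_swap. apply Csum_ext. intros k _.
    rewrite (Csum_ext n _ (fun l => b k z * (c l * t l k))%C) by (intros; ring).
    rewrite Csum_scal. ring.
  - intros l _. rewrite <- Csum_scal. apply Csum_ext. intros; ring.
Qed.

Definition kron (i l : nat) : Cplx := if Nat.eq_dec i l then Cone else Czero.

Lemma Csum_kron_r (d l : nat) (u : nat -> Cplx) : (l < d)%nat -> Csum d (fun i => u i * kron i l)%C = u l.
Proof.
  intros Hl. rewrite (Csum_single d l); [|assumption|].
  - unfold kron. destruct (Nat.eq_dec l l); [ring|congruence].
  - intros i _ Hi. unfold kron. destruct (Nat.eq_dec i l); [congruence|ring].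
Qed.

Lemma lin_indep_pred (d : nat) (b : nat -> Cplx -> Cplx) : lin_indep (S d) b -> lin_indep d b.
Proof.
  intros Hb c Hc i Hi. set (c' := fun k => if Nat.eq_dec k d then Czero else c k).
  assert (X : c' i = Czero).
  { apply Hb; [|lia]. intros z. rewrite lin_comb_S.
    replace (lin_comb d c' b z) with (lin_comb d c b z).
    - rewrite Hc. unfold c'. destruct (Nat.eq_dec d d); [ring|congruence].
    - apply Csum_ext. intros k Hk. unfold c'. destruct (Nat.eq_dec k d); [lia|reflexivity]. }
  unfold c' in X. destruct (Nat.eq_dec i d); [lia|exact X].
Qed.

(** The points become the exponents of the complement. Subtracting from b_d its interpolant at the
    points found so far leaves p, which vanishes at them; independence gives a new point x with p x
    <> 0, and p / p x is used to correct the earlier q_l. The last clause is Lagrange interpolation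
    on the span. *)
Lemma dual_basis (d : nat) (b : nat -> Cplx -> Cplx) : lin_indep d b ->
  exists (xi : nat -> Cplx) (q : nat -> Cplx -> Cplx),
    (forall l, (l < d)%nat -> exists t, forall z, q l z = lin_comb d t b z) /\
    (forall i l, (i < d)%nat -> (l < d)%nat -> q i (xi l) = kron i l) /\
    (forall k, (k < d)%nat -> forall z, b k z = Csum d (fun l => b k (xi l) * q l z)%C).
Proof.
  induction d; intros Hb.
  - exists (fun _ => Czero), (fun _ _ => Czero). repeat split; intros; lia.
  - destruct IHd as [xi [q [Hspan [Hdual Hexp]]]].
    { now apply lin_indep_pred. }
    assert (T : forall l, exists t, (l < d)%nat -> forall z, q l z = lin_comb d t b z).
    { intros l. destruct (Nat.lt_ge_cases l d) as [L|L].
      - destruct (Hspan l L) as [t Ht]. exists t. auto.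
      - exists (fun _ => Czero). lia. }
    set (tt := fun l => proj1_sig (constructive_indefinite_description _ (T l))).
    assert (Htt : forall l, (l < d)%nat -> forall z, q l z = lin_comb d (tt l) b z)
      by (intros l; apply (proj2_sig (constructive_indefinite_description _ (T l)))).
    set (p := fun z => (b d z - Csum d (fun l => b d (xi l) * q l z))%C).
    set (s := fun k => if Nat.eq_dec k d then Cone else (- Csum d (fun l => b d (xi l) * tt l k))%C).
    assert (Ep : forall z, p z = lin_comb (S d) s b z).
    { intros z. rewrite lin_comb_S. unfold p.
      rewrite (Csum_ext d _ (fun l => b d (xi l) * lin_comb d (tt l) b z)%C)
        by (intros l Hl; now rewrite Htt).
      rewrite lin_comb_Csum. unfold s at 2. destruct (Nat.eq_dec d d); [|congruence].
      replace (lin_comb d s b z) with (- lin_comb d (fun k => Csum d (fun l => b d (xi l) * tt l k)%C) b z)%C; [ring|].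
      replace (- lin_comb d (fun k => Csum d (fun l => b d (xi l) * tt l k)%C) b z)%C
        with ((- Cone) * lin_comb d (fun k => Csum d (fun l => b d (xi l) * tt l k)%C) b z)%C by ring.
      unfold lin_comb. rewrite <- Csum_scal. apply Csum_ext. intros k Hk. unfold s.
      destruct (Nat.eq_dec k d); [lia|ring]. }
    assert (Np : exists x, p x <> Czero).
    { apply NNPP. intros H. apply Cone_neq0.
      assert (X := Hb s). specialize (X ltac:(intros z; rewrite <- Ep; apply NNPP; intros N; apply H; now exists z)
        d ltac:(lia)). unfold s in X. destruct (Nat.eq_dec d d); congruence. }
    destruct Np as [x Nx].
    assert (Pxi : forall l, (l < d)%nat -> p (xi l) = Czero).
    { intros l Hl. unfold p. rewrite (Csum_ext d _ (fun i => b d (xi i) * kron i l)%C)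
        by (intros i Hi; now rewrite Hdual).
      rewrite Csum_kron_r by assumption. ring. }
    set (xi' := fun l => if Nat.eq_dec l d then x else xi l).
    set (qd := fun z => (p z / p x)%C).
    set (q' := fun l z => if Nat.eq_dec l d then qd z else (q l z - q l x * qd z)%C).
    assert (Qd : forall z, qd z = lin_comb (S d) (fun k => Cinv (p x) * s k)%C b z).
    { intros z. unfold qd, Cdiv. rewrite Ep at 1. unfold lin_comb.
      rewrite (Csum_ext (S d) (fun i => Cinv (p x) * s i * b i z)%C (fun i => Cinv (p x) * (s i * b i z))%C)
        by (intros; ring). rewrite Csum_scal. ring. }
    exists xi', q'. split; [|split].
    + intros l Hl. unfold q'. destruct (Nat.eq_dec l d) as [E|N].
      * eexists. exact Qd.
      * exists (fun k => (if Nat.eq_dec k d then Czero else tt l k) - q l x * (Cinv (p x) * s k))%C.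
        intros z. rewrite Htt, Qd by lia. unfold lin_comb.
        rewrite <- Csum_scal.
        replace (Csum d (fun i => tt l i * b i z)%C)
          with (Csum (S d) (fun i => (if Nat.eq_dec i d then Czero else tt l i) * b i z)%C).
        -- rewrite <- Csum_sub. apply Csum_ext. intros; ring.
        -- simpl. destruct (Nat.eq_dec d d); [|congruence].
           rewrite (Csum_ext d _ (fun i => tt l i * b i z)%C); [ring|].
           intros i Hi. destruct (Nat.eq_dec i d); [lia|reflexivity].
    + assert (Qx : qd x = Cone) by (unfold qd; field; assumption).
      assert (Qxi : forall l, (l < d)%nat -> qd (xi l) = Czero).
      { intros l Hl. unfold qd. rewrite Pxi by assumption. field. assumption. }
      intros i l Hi Hl. unfold q', xi'.
      destruct (Nat.eq_dec i d) as [Ei|Ni]; destruct (Nat.eq_dec l d) as [El|Nl].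
      * subst. rewrite Qx. unfold kron. destruct (Nat.eq_dec d d); congruence.
      * subst. rewrite Qxi by lia. unfold kron. destruct (Nat.eq_dec d l); [congruence|reflexivity].
      * subst. rewrite Qx. unfold kron. destruct (Nat.eq_dec i d); [congruence|ring].
      * rewrite Qxi, Hdual by lia. ring.
    + assert (Eqd : forall z, b d z = (Csum d (fun l => b d (xi l) * q l z) + p x * qd z)%C).
      { intros z. replace (p x * qd z)%C with (p z) by (unfold qd; field; exact Nx). unfold p. ring. }
      assert (gen : forall k z, (forall z, b k z = Csum d (fun l => b k (xi l) * q l z)
             + (b k x - Csum d (fun l => b k (xi l) * q l x)) * qd z)%C ->
           b k z = Csum (S d) (fun l => b k (xi' l) * q' l z)%C).
      { intros k z H. simpl. rewrite (H z).
        rewrite (Csum_ext d (fun l => b k (xi' l) * q' l z)%C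
          (fun l => b k (xi l) * q l z - qd z * (b k (xi l) * q l x))%C).
        - rewrite Csum_sub, Csum_scal. unfold xi', q'. destruct (Nat.eq_dec d d); [ring|congruence].
        - intros l Hl. unfold xi', q'. destruct (Nat.eq_dec l d); [lia|ring]. }
      intros k Hk z. apply gen. clear z. intros z. destruct (Nat.eq_dec k d) as [->|N].
      * exact (Eqd z).
      * rewrite <- !Hexp by lia. ring.
Qed.

(** * The annihilator of the sum of the kernel and the ideal *)

Lemma pairing_Csum_l (n : nat) (c : nat -> Cplx) (u : nat -> nat -> Cplx) (v : nat -> Cplx) :
  (forall j, expo_type (u j)) -> entire_type v ->
  expo_type (fun i => Csum n (fun j => c j * u j i)%C) /\
  pairing (fun i => Csum n (fun j => c j * u j i)%C) v = Csum n (fun j => c j * pairing (u j) v)%C.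
Proof.
  intros Hu Hv. induction n; simpl.
  - split; [apply expo_type_zero|]. rewrite pairing_sym. apply pairing_zero.
  - destruct IHn as [T E]. split; [now apply expo_type_lin|]. now rewrite pairing_lin_l, E.
Qed.

Definition quasi_seq (mu : nat -> Cplx) (m : nat -> nat) (N : nat) (c : nat -> nat -> Cplx) (i : nat) : Cplx :=
  Csum N (fun k => Csum (m k) (fun j => c k j * node_seq mu (k, j) i)%C).

Definition jet (mu : nat -> Cplx) (v : nat -> Cplx) (k j : nat) : Cplx := ev (shiftn j v) (mu k).

Lemma quasi_seq_spec (mu : nat -> Cplx) (m : nat -> nat) (N : nat) (c : nat -> nat -> Cplx) (v : nat -> Cplx) :
  entire_type v ->
  expo_type (quasi_seq mu m N c) /\ pairing (quasi_seq mu m N c) v = mass m N c (jet mu v).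
Proof.
  intros Hv.
  assert (B : forall k, expo_type (fun i => Csum (m k) (fun j => c k j * node_seq mu (k, j) i)%C) /\
    pairing (fun i => Csum (m k) (fun j => c k j * node_seq mu (k, j) i)%C) v
      = Csum (m k) (fun j => c k j * jet mu v k j)%C).
  { intros k. destruct (pairing_Csum_l (m k) (c k) (fun j => node_seq mu (k, j)) v) as [T E];
      [intros; apply expo_type_node_seq|assumption|].
    split; [exact T|]. rewrite E. apply Csum_ext. intros j _. now rewrite pairing_node_seq. }
  destruct (pairing_Csum_l N (fun _ => Cone)
    (fun k i => Csum (m k) (fun j => c k j * node_seq mu (k, j) i)%C) v) as [T E];
    [intros; apply B|assumption|].
  assert (X : (fun i => Csum N (fun k => Cone * Csum (m k) (fun j => c k j * node_seq mu (k, j) i))%C)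
    = quasi_seq mu m N c).
  { apply functional_extensionality. intros i. apply Csum_ext. intros; ring. }
  rewrite X in T, E. split; [exact T|]. rewrite E. apply Csum_ext. intros k _.
  rewrite (proj2 (B k)). ring.
Qed.

Lemma expo_type_quasi_seq (mu : nat -> Cplx) (m : nat -> nat) (N : nat) (c : nat -> nat -> Cplx) :
  expo_type (quasi_seq mu m N c).
Proof. apply (quasi_seq_spec mu m N c _ entire_type_zero). Qed.

Lemma ev_quasi_seq (mu : nat -> Cplx) (m : nat -> nat) (N : nat) (c : nat -> nat -> Cplx) (z : Cplx) :
  ev (quasi_seq mu m N c) z = quasi mu m N c z.
Proof.
  unfold ev. rewrite pairing_sym. rewrite (proj2 (quasi_seq_spec mu m N c _ (entire_type_geo z))).
  apply Csum_ext. intros k _. apply Csum_ext. intros j _. f_equal.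
  unfold jet. rewrite <- (pairing_node_seq mu (k, j)) by apply entire_type_geo.
  rewrite pairing_sym. apply (ev_node_seq mu (k, j)).
Qed.

Lemma quasi_bounded_support (mu : nat -> Cplx) (m : nat -> nat) (Lam : Cplx -> Prop) (kappa : Cplx -> R)
  (lam : nat -> Cplx) (R0 C : R) (N : nat) (c : nat -> nat -> Cplx) :
  (forall sw, PM mu Lam sw -> admissible mu Lam sw (kappa sw)) ->
  (forall s, limit_dir (node_set lam) s <-> PM mu Lam s) ->
  (forall n, Cnorm (quasi mu m N c (lam n)) <= C * exp (R0 * Cnorm (lam n))) ->
  forall k, (k < N)%nat -> (exists j, (j < m k)%nat /\ c k j <> Czero) ->
    forall sw, PM mu Lam sw -> Cre (sw * mu k)%C <= Rmax (kappa sw) R0.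
Proof.
  intros Hk Hd HB k Hkn Hsup sw HPM.
  destruct (proj2 (Hd sw) HPM) as [_ [x [Hx [Xinf Xdir]]]].
  apply (dominant_exponent mu m N c sw (kappa sw) C R0 x); auto.
  - destruct (Hk sw HPM) as [st [_ [H|H]]]; apply H.
  - intros l. destruct (Hx l) as [n <-]. apply HB.
Qed.

Lemma list_bounded (L : list nat) : exists N, forall k, In k L -> (k < N)%nat.
Proof.
  induction L as [|k L [N HN]]; [exists O; intros _ []|].
  exists (Nat.max N (S k)). intros j [->|Hj]; [lia|]. specialize (HN j Hj). lia.
Qed.

Definition support_in (L : list nat) (c : nat -> nat -> Cplx) (k j : nat) : Cplx :=
  if in_dec Nat.eq_dec k L then c k j else Czero.

Lemma Lsum_as_Csum (L : list nat) (N : nat) (F : nat -> Cplx) : NoDup L ->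
  (forall k, In k L -> (k < N)%nat) ->
  Lsum L F = Csum N (fun k => if in_dec Nat.eq_dec k L then F k else Czero).
Proof.
  intros ND HN. induction L as [|k L IH].
  - simpl. rewrite Csum_zero; auto.
  - inversion ND as [|? ? Hk NDL]; subst.
    change (Lsum (k :: L) F) with (F k + Lsum L F)%C.
    rewrite IH by (auto; intros; apply HN; now right).
    rewrite (Csum_extract N k (fun i => if in_dec Nat.eq_dec i (k :: L) then F i else Czero))
      by (apply HN; now left). f_equal.
    + destruct (in_dec Nat.eq_dec k (k :: L)) as [_|N1]; [reflexivity|]. exfalso. apply N1. now left.
    + apply Csum_ext. intros i _. destruct (Nat.eq_dec i k) as [->|Nik].
      * destruct (in_dec Nat.eq_dec k L); [contradiction|reflexivity].
      * destruct (in_dec Nat.eq_dec i L) as [I1|I1]; destruct (in_dec Nat.eq_dec i (k :: L)) as [I2|I2];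
          try reflexivity.
        -- exfalso. apply I2. now right.
        -- exfalso. destruct I2 as [E|I2]; [congruence|contradiction].
Qed.

Lemma quasi_poly_as_quasi (mu : nat -> Cplx) (m : nat -> nat) (Lam : Cplx -> Prop)
  (kappa : Cplx -> R) (P : Cplx -> Cplx) : quasi_poly_DM mu m Lam kappa P ->
  exists N c, forall z, P z = quasi mu m N c z.
Proof.
  intros [L [c [_ [ND HP]]]]. destruct (list_bounded L) as [N HN].
  exists N, (support_in L c). intros z. rewrite HP.
  change (Lsum L (fun k => Csum (m k) (fun j => c k j * (Cpow z j * Cexp (mu k * z)))%C)
    = quasi mu m N (support_in L c) z).
  rewrite (Lsum_as_Csum L N) by assumption. apply Csum_ext. intros k _. unfold support_in.
  destruct (in_dec Nat.eq_dec k L); [reflexivity|]. rewrite Csum_zero; [reflexivity|]. intros; ring.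
Qed.

(** Nodes with only zero coefficients are filtered out, since the list of a [quasi_poly_DM] may
    contain only indices in D_M. *)
Lemma quasi_as_quasi_poly (mu : nat -> Cplx) (m : nat -> nat) (Lam : Cplx -> Prop)
  (kappa : Cplx -> R) (N : nat) (c : nat -> nat -> Cplx) :
  (forall k, (k < N)%nat -> (exists j, (j < m k)%nat /\ c k j <> Czero) -> in_DM mu Lam kappa k) ->
  quasi_poly_DM mu m Lam kappa (quasi mu m N c).
Proof.
  intros H.
  set (Q := fun k => exists j, (j < m k)%nat /\ c k j <> Czero).
  set (L := filter (fun k => if excluded_middle_informative (Q k) then true else false) (seq 0 N)).
  assert (HL : forall k, In k L <-> (k < N)%nat /\ Q k).
  { intros k. unfold L. rewrite filter_In, in_seq.
    destruct (excluded_middle_informative (Q k)); split; intros [A B]; try congruence; split; auto; lia. }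
  exists L, c. split; [|split].
  - intros k Hk. apply HL in Hk. now apply H.
  - apply NoDup_filter, seq_NoDup.
  - intros z.
    change (quasi mu m N c z = Lsum L (fun k => Csum (m k) (fun j => c k j * (Cpow z j * Cexp (mu k * z)))%C)).
    rewrite (Lsum_as_Csum L N).
    + apply Csum_ext. intros k Hk. destruct (in_dec Nat.eq_dec k L) as [I1|I1]; [reflexivity|].
      apply Csum_zero. intros j Hj. destruct (classic (c k j = Czero)) as [E|NE]; [rewrite E; ring|].
      exfalso. apply I1, HL. split; [assumption|now exists j].
    + apply NoDup_filter, seq_NoDup.
    + intros k Hk. apply HL in Hk. tauto.
Qed.

(** By [pairing_translate] the convolution is the entire function whose l-th derivative at the
    origin is [pairing (plim lam) (shiftn l phi)]; it vanishes identically exactly when all of these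
    do. *)
Lemma in_Ker_iff (lam a : nat -> Cplx) (f : Cplx -> Cplx) : lacunary lam ->
  (forall j, (RtoC (factR j) * a j)%C = plim lam j) ->
  (in_Ker a f <-> exists phi, entire_type phi /\ (forall z, f z = ev phi z) /\
     forall l, pairing (plim lam) (shiftn l phi) = Czero).
Proof.
  intros HL Ha. assert (HA := expo_type_plim lam HL).
  assert (T : forall phi z j,
    (a j * ev (shiftn j phi) z)%C = pterm (plim lam) (translate z phi) j).
  { intros phi z j. unfold pterm, translate. rewrite <- Ha. assert (F := factR_pos j).
    rewrite RtoC_inv by lra. field. apply RtoC_neq0. lra. }
  split.
  - intros [Hf [D [HD HS]]]. destruct (entire_as_ev f Hf) as [phi [Hphi [Ephi _]]].
    exists phi. split; [assumption|]. split; [assumption|].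
    apply ev_injective; [now apply entire_type_pairing_shiftn|]. intros z.
    rewrite <- pairing_translate by assumption. apply csum_eq.
    apply (Cseries_ext (fun j => a j * D j z)%C); [|apply HS].
    intros j. rewrite <- T. f_equal.
    now apply (deriv_chain_unique f (ev phi) D _ Ephi HD (ev_chain phi Hphi)).
  - intros [phi [Hphi [Ef H0]]]. split; [apply (entire_ext (ev phi)); [auto|now apply entire_ev]|].
    exists (fun j => ev (shiftn j phi)). split.
    + split; [intros z; now rewrite Ef|]. apply (ev_chain phi Hphi).
    + intros z. apply (Cseries_ext (pterm (plim lam) (translate z phi))); [intros; now rewrite T|].
      replace Czero with (pairing (plim lam) (translate z phi)).
      * apply pairing_series; [assumption|]. now apply translate_spec.
      * rewrite pairing_translate by assumption.
        replace (fun l => pairing (plim lam) (shiftn l phi)) with (fun _ : nat => Czero)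
          by (apply functional_extensionality; auto).
        apply pairing_zero.
Qed.

(* The annihilator of [Ker + ideal]: quasi-polynomials with exponents in [M] vanishing on [lam]. *)
Definition annihilator (mu : nat -> Cplx) (m : nat -> nat) (lam : nat -> Cplx) (u : nat -> Cplx) : Prop :=
  (exists N c, u = quasi_seq mu m N c) /\ forall n, ev u (lam n) = Czero.

Lemma annihilator_expo (mu : nat -> Cplx) (m : nat -> nat) (lam u : nat -> Cplx) :
  annihilator mu m lam u -> expo_type u.
Proof. intros [[N [c ->]] _]. apply expo_type_quasi_seq. Qed.

Theorem Ker_plus_ideal_iff (mu : nat -> Cplx) (m : nat -> nat) (lam a psi : nat -> Cplx) (f : Cplx -> Cplx) :
  lacunary lam -> (forall j, (RtoC (factR j) * a j)%C = plim lam j) ->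
  bounded_quasi_finite mu m lam ->
  entire_type psi -> jets_vanish mu m psi ->
  (forall k, ev (shiftn (m k) psi) (mu k) <> Czero) ->
  (forall z, ev psi z = Czero -> exists k, z = mu k) ->
  (Ker_plus_ideal a (ev psi) f <-> exists phi, entire_type phi /\ (forall z, f z = ev phi z) /\
     forall u, annihilator mu m lam u -> pairing u phi = Czero).
Proof.
  intros HL Ha HF Hpsi Jpsi Npsi Zpsi. split.
  - intros [g [h [Hg [[r [Hr Eh]] E]]]].
    apply (in_Ker_iff lam a g HL Ha) in Hg. destruct Hg as [gam [Hgam [Eg Kg]]].
    assert (Hh : entire h).
    { apply (entire_ext (fun z => r z * ev psi z)%C); [auto|]. apply entire_mul; [assumption|now apply entire_ev]. }
    destruct (entire_as_ev h Hh) as [eta [Heta [Eeta _]]].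
    assert (Jeta : jets_vanish mu m eta).
    { apply (jets_of_ideal mu m psi eta r); auto. intros z. now rewrite <- Eeta, Eh. }
    exists (fun i => gam i + Cone * eta i)%C. split; [now apply entire_type_lin|]. split.
    + intros z. rewrite E, Eg, Eeta, ev_lin by assumption. ring.
    + intros u Hu. assert (Tu := annihilator_expo _ _ _ _ Hu). destruct Hu as [[N [c ->]] Hz].
      rewrite pairing_lin_r by assumption.
      rewrite (kernel_synthesis lam gam) by assumption.
      rewrite (proj2 (quasi_seq_spec mu m N c eta Heta)). unfold mass.
      rewrite Csum_zero; [ring|]. intros k _. apply Csum_zero. intros j Hj.
      unfold jet. rewrite (Jeta k j Hj). ring.
  - intros [phi [Hphi [E Hann]]].
    (* [gam] lies in the kernel and shares the jets of [phi] on the nodes, so that phi - gam falls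
       into the ideal. *)
    destruct (lacunary_interpolation mu m lam (jet mu phi) HF) as [gam [Hgam [Jgam Kgam]]].
    { intros N c Hz. rewrite <- (proj2 (quasi_seq_spec mu m N c phi Hphi)). apply Hann.
      split; [now exists N, c|]. intros n. now rewrite ev_quasi_seq. }
    assert (Tdiff : entire_type (fun i => phi i + (- Cone) * gam i)%C) by (now apply entire_type_lin).
    destruct (ideal_of_jets mu m psi (fun i => phi i + (- Cone) * gam i)%C) as [r [Hr Er]]; auto.
    { intros k j Hj.
      change (shiftn j (fun i => phi i + - Cone * gam i)%C)
        with (fun i => shiftn j phi i + - Cone * shiftn j gam i)%C.
      rewrite ev_lin, Jgam by auto using entire_type_shiftn. unfold jet. ring. }
    exists (ev gam), (ev (fun i => phi i + (- Cone) * gam i)%C). split; [|split].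
    + apply (in_Ker_iff lam a _ HL Ha). exists gam. split; [assumption|]. split; [reflexivity|].
      apply Kgam; [now apply expo_type_plim|]. intros n. now apply ev_plim_zero.
    + exists r. split; assumption.
    + intros z. rewrite ev_lin by assumption. rewrite E. ring.
Qed.

(** A functional of rate A is continuous for uniform convergence on the disc of radius 2 A, by
    Cauchy's estimate and the pairing bound; the two factors 2 give the 4 in eps / (4 C + 1). *)
Theorem annihilated_closed (mu : nat -> Cplx) (m : nat -> nat) (lam : nat -> Cplx)
  (fs : nat -> Cplx -> Cplx) (f : Cplx -> Cplx) :
  (forall n, exists phi, entire_type phi /\ (forall z, fs n z = ev phi z) /\
     forall u, annihilator mu m lam u -> pairing u phi = Czero) ->
  entire f -> loc_unif_cv fs f ->
  exists phi, entire_type phi /\ (forall z, f z = ev phi z) /\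
     forall u, annihilator mu m lam u -> pairing u phi = Czero.
Proof.
  intros Hfs Hf Hcv. destruct (entire_as_ev f Hf) as [phi [Hphi [Ephi _]]].
  exists phi. split; [assumption|]. split; [assumption|]. intros u Hu.
  assert (Tu := annihilator_expo _ _ _ _ Hu). destruct Tu as [C [A [HA Bu]]].
  assert (HC := expo_bound_pos _ _ _ Bu). assert (Tu := annihilator_expo _ _ _ _ Hu).
  apply Cnorm_eq0, Rle_antisym; [|apply Cnorm_ge0]. apply le_epsilon. intros eps He. rewrite Rplus_0_l.
  set (e := eps / (4 * C + 1)). assert (He0 : 0 < e) by (apply Rdiv_lt_0_compat; lra).
  destruct (Hcv (2 * A) e He0) as [n Hn]. specialize (Hn n).
  destruct (Hfs n) as [phin [Hphin [En Zn]]].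
  assert (Hd : entire (fun z => f z - fs n z)%C).
  { apply entire_sub; [assumption|]. apply (entire_ext (ev phin)); [auto|now apply entire_ev]. }
  destruct (entire_as_ev _ Hd) as [v [Hv [Ev Bv]]].
  assert (V : forall i, (phi i + (- Cone) * phin i)%C = v i).
  { apply ev_inj; [now apply entire_type_lin|assumption|]. intros z.
    rewrite ev_lin, <- Ev, <- En, <- Ephi by assumption. ring. }
  specialize (Bv (2 * A) e ltac:(lra)).
  assert (B2 : fact_bound (2 * e) (/ (2 * A)) v).
  { apply Bv. intros z Hz. rewrite Cnorm_sub_sym. left. apply Hn; [lia|assumption]. }
  assert (IA : 0 < / (2 * A)) by (apply Rinv_0_lt_compat; lra).
  assert (X := pairing_bound C A (2 * e) (/ (2 * A)) u v HA IA ltac:(right; field; lra) Bu B2).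
  replace v with (fun i => phi i + (- Cone) * phin i)%C in X by (apply functional_extensionality; exact V).
  rewrite pairing_lin_r, (Zn u Hu) in X by assumption.
  replace (pairing u phi + - Cone * Czero)%C with (pairing u phi) in X by ring.
  assert (E4 : (4 * C + 1) * e = eps) by (unfold e; field; lra). lra.
Qed.

(** The i-th function has derivative 1 of order m_(k0) + i at the node k0, and all its other
    prescribed derivatives are zero, so independence is read off there while membership in the ideal
    only concerns the original multiplicities. *)
Lemma kernel_ideal_infinite_dim (mu : nat -> Cplx) (m : nat -> nat) (lam a psi : nat -> Cplx) :
  lacunary lam -> (forall j, (RtoC (factR j) * a j)%C = plim lam j) ->
  (forall m', bounded_quasi_finite mu m' lam) ->
  entire_type psi -> jets_vanish mu m psi ->
  (forall k, ev (shiftn (m k) psi) (mu k) <> Czero) ->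
  (forall z, ev psi z = Czero -> exists k, z = mu k) ->
  infinite_dim (fun f => in_Ker a f /\ in_ideal (ev psi) f).
Proof.
  intros HL Ha HF Hpsi Jpsi Npsi Zpsi n.
  (* Raise the multiplicity of one node outside every annihilating quasi-polynomial, and
     prescribe only the additional derivatives there. *)
  assert (exists k0, forall N' c, (forall l, quasi mu (fun k => (m k + n)%nat) N' c (lam l) = Czero) ->
     forall j, (k0 < N')%nat -> (j < m k0 + n)%nat -> c k0 j = Czero) as [k0 Hk0].
  (* Vanishing on the sequence is the growth bound with C = 0, so the rate 0 serves; the threshold
     itself is taken as k0. *)
  { destruct (HF (fun k => (m k + n)%nat) 0) as [N HN]. exists N. intros N' c Hz j Hk Hj.
    apply (HN N' c 0); try assumption; [|lia]. intros l. rewrite Hz, Cnorm_zero. lra. }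
  assert (S : forall i, {phi | entire_type phi /\
     (forall k j, (j < m k + n)%nat -> ev (shiftn j phi) (mu k) =
         if Nat.eq_dec k k0 then kron j (m k0 + i) else Czero) /\
     forall l, pairing (plim lam) (shiftn l phi) = Czero}).
  { intros i. apply constructive_indefinite_description.
    destruct (lacunary_interpolation mu (fun k => (m k + n)%nat) lam
      (fun k j => if Nat.eq_dec k k0 then kron j (m k0 + i) else Czero) (HF _)) as [phi [H1 [H2 H3]]].
    - intros N c Hz. apply Csum_zero. intros k Hk. apply Csum_zero. intros j Hj.
      destruct (Nat.eq_dec k k0) as [->|]; [|ring]. rewrite (Hk0 N c Hz j Hk Hj). ring.
    - exists phi. split; [assumption|]. split; [assumption|].
      apply H3; [now apply expo_type_plim|]. intros l. now apply ev_plim_zero. }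
  set (Phi := fun i => proj1_sig (S i)).
  assert (T : forall i, entire_type (Phi i)) by (intros i; apply (proj2_sig (S i))).
  assert (J : forall i k j, (j < m k + n)%nat -> ev (shiftn j (Phi i)) (mu k) =
         if Nat.eq_dec k k0 then kron j (m k0 + i) else Czero) by (intros i; apply (proj2_sig (S i))).
  assert (K : forall i l, pairing (plim lam) (shiftn l (Phi i)) = Czero) by (intros i; apply (proj2_sig (S i))).
  clearbody Phi. clear S.
  exists (fun i => ev (Phi i)). split.
  - intros i Hi. split.
    + apply (in_Ker_iff lam a _ HL Ha). exists (Phi i). auto.
    + destruct (ideal_of_jets mu m psi (Phi i)) as [r [Hr Er]]; auto.
      * intros k j Hj. rewrite J by lia. destruct (Nat.eq_dec k k0) as [->|]; [|reflexivity].
        unfold kron. destruct (Nat.eq_dec j (m k0 + i)); [lia|reflexivity].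
      * now exists r.
  - intros c Hc l Hl.
    destruct (pairing_Csum n c (geo Czero) Phi (expo_type_geo _) T) as [TT _].
    assert (Z : forall i, Csum n (fun k => c k * Phi k i)%C = Czero).
    { apply ev_injective; [assumption|]. intros z. rewrite <- (Hc z).
      apply (pairing_Csum n c (geo z) Phi (expo_type_geo _) T). }
    destruct (pairing_Csum n c (node_seq mu (k0, (m k0 + l)%nat)) Phi
      (expo_type_node_seq _ _) T) as [_ E].
    replace (fun i => Csum n (fun k => c k * Phi k i)%C) with (fun _ : nat => Czero) in E
      by (apply functional_extensionality; auto).
    rewrite pairing_node_seq in E by apply entire_type_zero.
    rewrite (Csum_ext n _ (fun i => c i * kron i l)%C) in E.
    + rewrite Csum_kron_r in E by assumption. rewrite <- E. apply pairing_zero.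
    + intros i Hi. rewrite pairing_node_seq by apply T. simpl. rewrite J by lia.
      destruct (Nat.eq_dec k0 k0); [|congruence]. f_equal. unfold kron.
      destruct (Nat.eq_dec (m k0 + l) (m k0 + i)); destruct (Nat.eq_dec i l); try reflexivity; lia.
Qed.

(** The [w l] are the functionals whose [ev] are the dual functions of [dual_basis]. They span the
    annihilator, and exp(xi_l z) pairs with w_i to the value of the i-th dual function at xi_l. *)
Theorem annihilator_complement (mu : nat -> Cplx) (m : nat -> nat) (Lam : Cplx -> Prop)
  (kappa : Cplx -> R) (lam : nat -> Cplx) (dM : nat) :
  (forall sw, PM mu Lam sw -> admissible mu Lam sw (kappa sw)) ->
  (forall s, limit_dir (node_set lam) s <-> PM mu Lam s) ->
  has_dim (fun P => quasi_poly_DM mu m Lam kappa P /\ forall n, P (lam n) = Czero) dM ->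
  exists (xi : nat -> Cplx) (w : nat -> nat -> Cplx),
    (forall l, (l < dM)%nat -> expo_type (w l)) /\
    (forall i l, (i < dM)%nat -> (l < dM)%nat -> pairing (w i) (geo (xi l)) = kron i l) /\
    (forall l phi, (l < dM)%nat -> entire_type phi ->
       (forall u, annihilator mu m lam u -> pairing u phi = Czero) -> pairing (w l) phi = Czero) /\
    (forall u phi, annihilator mu m lam u -> entire_type phi ->
       (forall l, (l < dM)%nat -> pairing (w l) phi = Czero) -> pairing u phi = Czero).
Proof.
  intros Hk Hd [b [Hb [Hind Hspan]]].
  destruct (dual_basis dM b Hind) as [xi [q [Hq [Hdual Hexp]]]].
  assert (U : forall k, exists u, (k < dM)%nat -> annihilator mu m lam u /\ forall z, b k z = ev u z).
  { intros k. destruct (Nat.lt_ge_cases k dM) as [L|G]; [|exists (fun _ => Czero); lia].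
    destruct (Hb k L) as [HP HZ]. destruct (quasi_poly_as_quasi _ _ _ _ _ HP) as [N [c E]].
    exists (quasi_seq mu m N c). intros _. split; [split|].
    - now exists N, c.
    - intros n. now rewrite ev_quasi_seq, <- E.
    - intros z. now rewrite ev_quasi_seq. }
  (* Zero from dM on, so that the whole family has exponential type, as [pairing_Csum_l]
     requires. *)
  set (u := fun k => if Nat.ltb k dM
    then proj1_sig (constructive_indefinite_description _ (U k)) else fun _ => Czero).
  assert (Hu : forall k, (k < dM)%nat -> annihilator mu m lam (u k) /\ forall z, b k z = ev (u k) z).
  { intros k L. unfold u. destruct (Nat.ltb_spec k dM); [|lia].
    now apply (proj2_sig (constructive_indefinite_description _ (U k))). }
  assert (Tu : forall k, expo_type (u k)).
  { intros k. destruct (Nat.lt_ge_cases k dM) as [L|G].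
    - eapply annihilator_expo. apply (Hu k L).
    - unfold u. destruct (Nat.ltb_spec k dM); [lia|apply expo_type_zero]. }
  assert (T : forall l, exists t, (l < dM)%nat -> forall z, q l z = lin_comb dM t b z).
  { intros l. destruct (Nat.lt_ge_cases l dM) as [L|L]; [|exists (fun _ => Czero); lia].
    destruct (Hq l L) as [t Ht]. exists t. auto. }
  set (t := fun l => proj1_sig (constructive_indefinite_description _ (T l))).
  assert (Ht : forall l, (l < dM)%nat -> forall z, q l z = lin_comb dM (t l) b z)
    by (intros l; apply (proj2_sig (constructive_indefinite_description _ (T l)))).
  set (w := fun l i => Csum dM (fun k => t l k * u k i)%C).
  assert (Hw : forall l v, entire_type v -> expo_type (w l) /\
     pairing (w l) v = Csum dM (fun k => t l k * pairing (u k) v)%C).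
  { intros l v Hv. apply pairing_Csum_l; auto. }
  assert (Tw : forall l, expo_type (w l)) by (intros l; apply (Hw l _ entire_type_zero)).
  assert (Ew : forall l z, (l < dM)%nat -> q l z = ev (w l) z).
  { intros l z L. unfold ev. rewrite pairing_sym, (proj2 (Hw l _ (entire_type_geo z))), (Ht l L).
    apply Csum_ext. intros k Hkd. rewrite (proj2 (Hu k Hkd)). unfold ev. now rewrite pairing_sym. }
  exists xi, w. split; [auto|]. split; [|split].
  - intros i l Hi Hl. rewrite pairing_sym. fold (ev (w i) (xi l)). rewrite <- Ew by assumption. auto.
  - intros l phi Hl Hphi H. rewrite (proj2 (Hw l phi Hphi)). apply Csum_zero. intros k Hkd.
    rewrite H by apply (Hu k Hkd). ring.
  - intros v phi Hv Hphi H. assert (Tv := annihilator_expo _ _ _ _ Hv).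
    assert (Hv' := Hv). destruct Hv' as [[N [c Ev]] Zv].
    assert (HP : quasi_poly_DM mu m Lam kappa (quasi mu m N c)).
    { apply quasi_as_quasi_poly. intros k Hkn Hsup sw HPM.
      (* With C = 0 every rate is admissible; the rate [kappa sw] collapses the maximum to
         [kappa sw], which is the condition defining D_M. *)
      assert (X := quasi_bounded_support mu m Lam kappa lam (kappa sw) 0 N c Hk Hd).
      specialize (X ltac:(intros n; rewrite <- ev_quasi_seq, <- Ev, Zv, Cnorm_zero; lra) k Hkn Hsup sw HPM).
      rewrite Rmax_left in X by lra. exact X. }
    destruct (Hspan (quasi mu m N c)) as [s Hs].
    { split; [assumption|]. intros n. now rewrite <- ev_quasi_seq, <- Ev. }
    set (s' := fun l => Csum dM (fun k => s k * b k (xi l))%C).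
    destruct (pairing_Csum_l dM s' w phi Tw Hphi) as [Ts Es].
    replace v with (fun i => Csum dM (fun l => s' l * w l i)%C).
    + rewrite Es. apply Csum_zero. intros l Hl. rewrite (H l Hl). ring.
    + apply functional_extensionality.
      apply ev_inj; [now apply expo_type_entire_type|now apply expo_type_entire_type|].
      intros z. rewrite Ev, ev_quasi_seq, Hs.
      transitivity (Csum dM (fun l => s' l * q l z)%C).
      * unfold ev. rewrite pairing_sym.
        rewrite (proj2 (pairing_Csum_l dM s' w (geo z) Tw (entire_type_geo z))).
        apply Csum_ext. intros l Hl. rewrite Ew by assumption. unfold ev. now rewrite pairing_sym.
      * unfold lin_comb, s'.
        rewrite (Csum_ext dM (fun i => s i * b i z)%C (fun k => Csum dM (fun l => s k * b k (xi l) * q l z)%C)).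
        -- rewrite Csum_swap. apply Csum_ext. intros l _.
           rewrite (Csum_ext dM (fun i => s i * b i (xi l) * q l z)%C (fun i => q l z * (s i * b i (xi l)))%C)
             by (intros; ring). rewrite Csum_scal. ring.
        -- intros k Hkd. rewrite (Hexp k Hkd z) at 1. rewrite <- Csum_scal. apply Csum_ext. intros; ring.
Qed.

(** * Closedness, codimension and complement read off from the annihilator *)

Theorem theorem1
  (* nodes M = {mu_k} (pairwise distinct, discrete) with multiplicities m_k >= 1 *)
  (mu : nat -> Cplx) (m : nat -> nat)
  (Hinj : forall k k', mu k = mu k' -> k = k')
  (Hdisc : discrete_seq mu)
  (Hm : forall k, (1 <= m k)%nat)
  (* Lambda unbounded *)
  (Lam : Cplx -> Prop)
  (HLam : forall A, exists z, Lam z /\ A < Cnorm z)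
  (* every s_tau in P(M) satisfies (A) or (B) *)
  (HAB : forall st, limit_dir (node_set mu) st ->
     (exists sw kap, condA mu Lam st sw kap) \/ (exists sw kap, condB mu Lam st sw kap))
  (* a choice of the numbers kappa(s_omega), s_omega in P_M(Lambda) *)
  (kappa : Cplx -> R)
  (Hkappa : forall sw, PM mu Lam sw -> admissible mu Lam sw (kappa sw))
  (* the sequence lambda_n *)
  (lam : nat -> Cplx)
  (Hlam_in : forall n, Lam (lam n))
  (Hlam_nz : forall n, lam n <> Czero)
  (Hlam_grow : forall n, 2 * Cnorm (lam n) < Cnorm (lam (S n)))
  (Hlam_dir : forall s, limit_dir (node_set lam) s <-> PM mu Lam s)
  (* a = Taylor coefficients of G1(z) = prod_n (1 - z/lambda_n) *)
  (a : nat -> Cplx)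
  (HG1 : forall z, exists w,
      Ccv (fun N => Cprod N (fun n => Csub Cone (Cdiv z (lam n)))) w /\
      Cseries (fun j => Cmul (a j) (Cpow z j)) w)
  (* psi_M: entire, zero set exactly M, multiplicity exactly m_k at mu_k *)
  (psi : Cplx -> Cplx)
  (Hpsi : entire psi)
  (Hpsi_mult : exists D, deriv_chain psi D /\
      forall k, (forall j, (j < m k)%nat -> D j (mu k) = Czero) /\ D (m k) (mu k) <> Czero)
  (Hpsi_zeros : forall z, psi z = Czero -> exists k, z = mu k)
  (* d_M *)
  (dM : nat)
  (HdM : has_dim (fun P => quasi_poly_DM mu m Lam kappa P /\
                           forall n, P (lam n) = Czero) dM) :
  (closed_in_H (Ker_plus_ideal a psi) /\
   ((0 < dM)%nat ->
      has_codim (Ker_plus_ideal a psi) dM /\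
      exists xi : nat -> Cplx, forall f, entire f ->
        exists g c, Ker_plus_ideal a psi g /\
          forall z, f z = Cadd (g z) (lin_comb dM c (fun l w => Cexp (Cmul (xi l) w)) z))) /\
  (dM = 0%nat -> forall f, entire f -> Ker_plus_ideal a psi f) /\
  infinite_dim (fun f => in_Ker a f /\ in_ideal psi f).
Proof.
  assert (HL : lacunary lam) by (split; assumption).
  assert (Ha := product_coefficients lam a HL HG1).
  assert (HF : forall m', bounded_quasi_finite mu m' lam).
  (* Low nodes are defined without reference to multiplicities, so the argument covers every m',
     including the raised multiplicities needed for the intersection. *)
  { intros m' R0. destruct (finitely_many_low_nodes mu Lam kappa R0 Hdisc HAB) as [N HN].
    exists N. intros N' c C HB k j Hk Hk' Hj. apply NNPP. intros Hc.
    assert (Hlow : (k < N)%nat); [|lia]. apply HN. intros sw HPM.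
    apply (quasi_bounded_support mu m' Lam kappa lam R0 C N' c); auto. now exists j. }
  destruct (entire_as_ev psi Hpsi) as [p [Hp [Ep _]]].
  assert (psi = ev p) by (apply functional_extensionality; assumption). subst psi.
  destruct Hpsi_mult as [D [HD Hmult]].
  assert (ED : forall j z, D j z = ev (shiftn j p) z)
    by (exact (deriv_chain_unique _ _ _ _ (fun z => eq_refl) HD (ev_chain p Hp))).
  assert (Jp : jets_vanish mu m p).
  { intros k j Hj. rewrite <- ED. now apply Hmult. }
  assert (Np : forall k, ev (shiftn (m k) p) (mu k) <> Czero).
  { intros k. rewrite <- ED. apply Hmult. }
  assert (HS := fun f => Ker_plus_ideal_iff mu m lam a p f HL Ha (HF m) Hp Jp Np Hpsi_zeros).
  destruct (annihilator_complement mu m Lam kappa lam dM Hkappa Hlam_dir HdM)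
    as [xi [w [Tw [Hdual [Hw1 Hw2]]]]].
  assert (Tcomb : forall c : nat -> Cplx, entire_type (fun i => Csum dM (fun l => c l * geo (xi l) i)%C)).
  { intros c. apply (pairing_Csum dM c (geo Czero) (fun l => geo (xi l)) (expo_type_geo _)).
    intros; apply entire_type_geo. }
  assert (Ecomb : forall (c : nat -> Cplx) z, ev (fun i => Csum dM (fun l => c l * geo (xi l) i)%C) z
     = lin_comb dM c (fun l x => Cexp (xi l * x)%C) z).
  { intros c z. unfold ev. rewrite (proj2 (pairing_Csum dM c (geo z) (fun l => geo (xi l)) (expo_type_geo _)
      (fun l => entire_type_geo _))).
    apply Csum_ext. intros l _. f_equal. apply ev_geo. }
  assert (Pcomb : forall (c : nat -> Cplx) i, (i < dM)%nat ->
     pairing (w i) (fun j => Csum dM (fun l => c l * geo (xi l) j)%C) = c i).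
  { intros c i Hi. rewrite (proj2 (pairing_Csum dM c (w i) (fun l => geo (xi l)) (Tw i Hi)
      (fun l => entire_type_geo _))).
    rewrite <- (Csum_kron_r dM i c Hi). apply Csum_ext. intros l Hl. rewrite Hdual by assumption.
    f_equal. unfold kron. destruct (Nat.eq_dec i l); destruct (Nat.eq_dec l i); congruence. }
  assert (decomp : forall f, entire f -> exists g c, Ker_plus_ideal a (ev p) g /\
     forall z, f z = Cadd (g z) (lin_comb dM c (fun l x => Cexp (Cmul (xi l) x)) z)).
  { intros f Hf. destruct (entire_as_ev f Hf) as [phi [Hphi [Ephi _]]].
    (* By duality, subtracting the exponentials with these coefficients makes every [w l] vanish on
       the remainder, and with them the whole annihilator. *)
    set (c := fun l => pairing (w l) phi).
    set (comb := fun i => Csum dM (fun l => c l * geo (xi l) i)%C).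
    exists (ev (fun i => phi i + (- Cone) * comb i)%C), c. split.
    - apply HS. exists (fun i => phi i + (- Cone) * comb i)%C.
      assert (T : entire_type (fun i => phi i + (- Cone) * comb i)%C)
        by (apply entire_type_lin; [assumption|apply Tcomb]).
      split; [assumption|]. split; [reflexivity|]. intros u Hu. apply Hw2; try assumption.
      intros l Hl. rewrite pairing_lin_r by (auto; apply Tcomb).
      unfold comb. rewrite Pcomb by assumption. unfold c. ring.
    - intros z. rewrite ev_lin, Ephi, <- Ecomb by (auto; apply Tcomb). fold comb. ring. }
  split; [split|split].
  - intros fs f Hfs Hf Hcv. apply HS. apply (annihilated_closed mu m lam fs f); try assumption.
    intros n. apply HS, Hfs.
  - intros _. split; [|now exists xi].
    exists (fun l x => Cexp (xi l * x)%C). split; [|split].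
    + intros i _. apply (entire_comp (fun x => xi i * x)%C Cexp); [|apply entire_Cexp].
      apply entire_mul; [apply entire_const|apply entire_id].
    + exact decomp.
    + intros c Hc i Hi. apply HS in Hc. destruct Hc as [phi [Hphi [Ephi Hann]]].
      rewrite <- (Pcomb c i Hi).
      replace (fun j => Csum dM (fun l => c l * geo (xi l) j)%C) with phi.
      * now apply Hw1.
      * apply functional_extensionality. apply ev_inj; [assumption|apply Tcomb|].
        intros z. now rewrite Ecomb, <- Ephi.
  - intros E f Hf. destruct (decomp f Hf) as [g [c [Hg Eg]]].
    replace f with g; [assumption|]. apply functional_extensionality. intros z.
    rewrite Eg, E. unfold lin_comb. simpl. ring.
  - now apply (kernel_ideal_infinite_dim mu m lam).
Qed.
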